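(* Fix $p\ge2$ and let $q\ge2p+\gamma$. Then there exist constants $C_1(p),C_2(p)$ such that, whenever $(\mu^N_t)_{t\ge0}$ is a Kac process on $N\ge2$ particles (either noncutoff, or $K$-cutoff for some $K\ge1$) satisfying an initial moment bound $\Lambda_q(\mu^N_0)\le a_3$, $a_3\ge1$, then for all $t_{\mathrm{fin}}\ge0$ and $\epsilon>0$, $$\mathbb{P}\left(\sup_{t\le t_{\mathrm{fin}}}\langle|v|^p,\mu^N_t\rangle\ge\max(\langle|v|^p,\mu^N_0\rangle,C_1)+\epsilon\right)\le C_2\,t_{\mathrm{fin}}\,a_3\,N^{-1}\epsilon^{-2}.$$ Define, for $b\ge1$, $$T^N_b=\inf\left\{t\ge0:\Lambda_p(\mu^N_t)>\frac{b}{2^{\frac p2+1}}\right\}.$$ As a consequence, there exists $C=C(p)$ such that, if the initial data has the moment estimates $\Lambda_p(\mu^N_0)\le a_1$, $\Lambda_q(\mu^N_0)\le a_3$, then $$\mathbb{P}(T^N_{Ca_1}\le t_{\mathrm{fin}})\le C\,t_{\mathrm{fin}}\,a_3\,N^{-1}.$$ The constants do not depend on $N$ or on the cutoff parameter $K\ge1$ (they may depend on the fixed kernel $B$ and $d$).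
   Context: Kernel. Fix $d\ge 3$ and let $d\sigma$ be surface measure on $\mathbb{S}^{d-1}$. The collision kernel is $B(v,\sigma)=|v|^\gamma(\sin\theta)^{2-d}\beta(\theta)$, where $\cos\theta=\sigma\cdot v/|v|$, $\gamma\in[0,1]$, $\nu\in[0,1)$ and $\beta(\theta)\sim\theta^{-1-\nu}$ as $\theta\downarrow0$, and $\beta(\theta)=b(\cos\theta)$ for a convex function $b:(-1,1)\to[0,\infty)$, which, by symmetry of collisions, is taken to be supported on $[0,1)$ (only the values on $[0,1)$ matter, where $b$ is convex). For $K>0$, $B_K(v,\sigma)=B(v,\sigma)1(\theta>\theta_0(K))$, with $\theta_0(K)$ chosen so that $\int_{\mathbb{S}^{d-1}}B_K(v,\sigma)d\sigma=K|v|^\gamma$. State space. $\langle\cdot,\cdot\rangle$ denotes integration against a measure. $\mathcal{S}_N$ is the set of measures $\mu=N^{-1}\sum_{i=1}^N\delta_{v_i}$ on $\mathbb{R}^d$ with $\langle v,\mu\rangle=0$, $\langle|v|^2,\mu\rangle=1$, with the Wasserstein-1 distance $w_1$. $\Lambda_k(\mu)=\langle(1+|v|^2)^{k/2},\mu\rangle$. Kac processes. With $v'=\frac{v+v_\star}{2}+\frac{|v-v_\star|}{2}\sigma$, $v'_\star=\frac{v+v_\star}{2}-\frac{|v-v_\star|}{2}\sigma$, set $\mu^{N,v,v_\star,\sigma}=\mu^N+N^{-1}(\delta_{v'}+\delta_{v'_\star}-\delta_v-\delta_{v_\star})$. An $N$-particle noncutoff Kac process is a Markov process in $(\mathcal{S}_N,w_1)$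 with càdlàg paths and generator, for Lipschitz $F$, $(\mathcal{G}^NF)(\mu^N)=N\int(F(\mu^{N,v,v_\star,\sigma})-F(\mu^N))B(v-v_\star,\sigma)\mu^N(dv)\mu^N(dv_\star)d\sigma$. A $K$-cutoff Kac process is defined in the same way with $B_K$ in place of $B$. *)

(* Defs.v *)
From HB Require Import structures.
From mathcomp Require Import all_boot all_order all_algebra.
From mathcomp Require Import all_classical all_reals all_analysis.

Set Implicit Arguments.
Unset Strict Implicit.
Unset Printing Implicit Defensive.

Import Order.TTheory GRing.Theory Num.Theory.
Import numFieldNormedType.Exports.

Local Open Scope classical_set_scope.
Local Open Scope ring_scope.

(* R^d with its Borel sigma-algebra.  The norm that the library puts on row
   vectors is the sup norm, so the Euclidean norm [enorm] is defined here. *)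
Definition vec (R : realType) (d : nat) : measurableType _ :=
  g_sigma_algebraType (@open 'rV[R]_d).

Section Euclidean.
Variables (R : realType) (d : nat).
Implicit Types u v : 'rV[R]_d.

Definition dot u v : R := \sum_(i < d) u 0 i * v 0 i.

Definition enorm v : R := Num.sqrt (dot v v).

Definition sphere : set (vec R d) := [set s | enorm (s : 'rV[R]_d) = 1].

End Euclidean.

(* Lebesgue measure on R^d, by iterated integration over the first coordinate *)
Fixpoint lebesgue_vec (R : realType) (d : nat) : set (vec R d) -> \bar R :=
  match d with
  | 0%N => fun A => \d_(0 : vec R 0) A
  | d'.+1 => fun A =>
      (\int[@lebesgue_measure R]_t
         lebesgue_vec [set x : vec R d' |
           A (row_mx (const_mx t : 'rV[R]_1) (x : 'rV[R]_d'))])%E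
  end.

(* The measure on the unit sphere given by polar coordinates:
   sigma(A) = d * |{r s : 0 < r <= 1, s in A}|.  It is carried by [sphere]. *)
Definition surface_measure (R : realType) (d : nat) (A : set (vec R d)) :
    \bar R :=
  (d%:R%:E * lebesgue_vec [set x : vec R d |
     (0 < enorm (x : 'rV[R]_d) <= 1)%R /\
     A ((enorm (x : 'rV[R]_d))^-1 *: (x : 'rV[R]_d))%R])%E.

(* [b] is only constrained on ]-1, 1[, and [beta theta = b (cos theta)]. *)
Definition angular_profile (R : realType) (nu : R) (b : R -> R) : Prop :=
  [/\ forall x : R, -1 < x < 1 -> 0 <= b x,
      forall x : R, -1 < x < 0 -> b x = 0,
      convex_function (`[0, 1[%classic : set R) b &
      (fun theta : R => (b (cos theta) : R^o))
        ~_(0^'+) (fun theta : R => (theta `^ (-1 - nu) : R^o))].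

Section Kernel.
Variables (R : realType) (d : nat) (gamma : R) (b : R -> R).
Implicit Types v s : 'rV[R]_d.

Definition deviation_angle v s : R := acos (dot s v / enorm v).

(* (sin theta)^(2-d) is the inverse power below; at the poles, where
   sin theta = 0, it evaluates to 0. *)
Definition kernel_B v s : R :=
  enorm v `^ gamma * (sin (deviation_angle v s)) ^- (d - 2)
    * b (cos (deviation_angle v s)).

Definition kernel_cut (theta0 : R) v s : R :=
  if theta0 < deviation_angle v s then kernel_B v s else 0.

(* theta0 is a legitimate value of theta_0(K).  The velocity v = 0, where the
   deviation angle is undefined, is left out. *)
Definition cutoff_angle (K theta0 : R) : Prop :=
  forall v, v != 0 ->
    integral (@surface_measure R d) (@sphere R d)
      (fun s : vec R d => (kernel_cut theta0 v s)%:E)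
    = (K * enorm v `^ gamma)%:E.

End Kernel.

(* Measures on R^d are handled as set functions: mu^{N,v,v*,sigma} is a set
   function for all v, v*, but a measure only if v, v* are atoms of mu. *)
Definition setfun (R : realType) (d : nat) : Type := set (vec R d) -> \bar R.

Section StateSpace.
Variables (R : realType) (d : nat).
Local Notation V := (vec R d).

Definition empirical (N : nat) (x : 'I_N -> V) : setfun R d :=
  fun A => ((N%:R^-1 : R)%:E * \sum_(i < N) \d_(x i) A)%E.

Definition bracket (f : V -> R) (mu : setfun R d) : R :=
  fine (integral mu setT (fun v => (f v)%:E)).

Definition Lambda (k : R) (mu : setfun R d) : R :=
  bracket (fun v => (1 + enorm (v : 'rV[R]_d) ^+ 2) `^ (k / 2)) mu.

Definition moment (p : R) (mu : setfun R d) : R :=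
  bracket (fun v => enorm (v : 'rV[R]_d) `^ p) mu.

Definition stateset (N : nat) : set (setfun R d) :=
  [set mu | [/\ exists x : 'I_N -> V, mu = empirical x,
                forall i : 'I_d, bracket (fun v => (v : 'rV[R]_d) 0 i) mu = 0 &
                bracket (fun v => enorm (v : 'rV[R]_d) ^+ 2) mu = 1]].

Definition coupling (mu nu : setfun R d) : set (probability (V * V)%type R) :=
  [set m | forall A : set V, measurable A ->
     m (A `*` setT) = mu A /\ m (setT `*` A) = nu A].

Definition w1 (mu nu : setfun R d) : \bar R :=
  ereal_inf [set (\int[m]_z (enorm ((z.1 : 'rV[R]_d) - (z.2 : 'rV[R]_d))%R)%:E)%E
            | m in coupling mu nu].

Definition w1_open (N : nat) : set (set (setfun R d)) :=
  [set U | U `<=` stateset N /\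
     forall mu, U mu -> exists2 e : R, 0 < e &
       forall nu, stateset N nu -> (w1 mu nu < e%:E)%E -> U nu].

(* F is Lipschitz on (S_N, w_1); its values off S_N are irrelevant. *)
Definition w1_lipschitz (N : nat) (F : setfun R d -> R) : Prop :=
  exists L : R, forall mu nu, stateset N mu -> stateset N nu ->
    (`|F mu - F nu|%:E <= L%:E * w1 mu nu)%E.

Definition post1 (v w s : 'rV[R]_d) : V :=
  2^-1 *: (v + w) + (enorm (v - w) / 2) *: s.

Definition post2 (v w s : 'rV[R]_d) : V :=
  2^-1 *: (v + w) - (enorm (v - w) / 2) *: s.

Definition jump (N : nat) (mu : setfun R d) (v w s : V) : setfun R d :=
  fun A => (mu A + (N%:R^-1 : R)%:E *
    (\d_(post1 v w s) A + \d_(post2 v w s) A - \d_v A - \d_w A))%E.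

Definition generator (N : nat) (B : 'rV[R]_d -> 'rV[R]_d -> R)
    (F : setfun R d -> R) (mu : setfun R d) : R :=
  N%:R * fine (integral mu setT (fun v : V =>
    integral mu setT (fun w : V =>
      integral (@surface_measure R d) (@sphere R d) (fun s : V =>
        ((F (jump N mu v w s) - F mu)
          * B ((v : 'rV[R]_d) - (w : 'rV[R]_d)) s)%:E)))).

End StateSpace.

(* All set functions, with the sigma-algebra whose trace on S_N is the Borel
   sigma-algebra of (S_N, w_1) *)
Definition state (R : realType) (d N : nat) : measurableType _ :=
  g_sigma_algebraType (@w1_open R d N).

Section Processes.
Variables (R : realType) (d N : nat).
Variables (dO : measure_display) (Omega : measurableType dO).
Variable P : probability Omega R.
Local Notation E := (state R d N).
Local Notation SN := (@stateset R d N : set E).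

Definition cadlag (x : R -> E) : Prop :=
  [/\ forall t : R, 0 <= t -> SN (x t),
      forall t : R, 0 <= t -> w1 (x t) (x s) @[s --> t^'+] --> 0%E &
      forall t : R, 0 < t -> exists mu : E,
        SN mu /\ (w1 mu (x s) @[s --> t^'-] --> 0%E)].

Definition history (X : R -> Omega -> E) (s : R) : set (set Omega) :=
  <<s [set H | exists (r : R) (A : set E),
         [/\ 0 <= r <= s, measurable A & H = X r @^-1` A]] >>.

(* p t mu is the law at time t started from mu, for mu in S_N. *)
Definition transition_semigroup (p : R -> R.-pker E ~> E) : Prop :=
  [/\ forall (t : R) mu, 0 <= t -> SN mu -> p t mu SN = 1%E,
      forall mu (A : set E), SN mu -> measurable A ->
        p 0 mu A = \d_mu A &
      forall (s t : R) mu (A : set E), 0 <= s -> 0 <= t -> SN mu -> measurable A ->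
        p (s + t) mu A = (\int[p s mu]_(nu in SN) p t nu A)%E].

(* relative to the natural filtration of X *)
Definition markov_with (p : R -> R.-pker E ~> E) (X : R -> Omega -> E) : Prop :=
  forall (s t : R) (H : set Omega) (A : set E), 0 <= s -> 0 <= t ->
    history X s H -> measurable A ->
    P (H `&` X (s + t) @^-1` A) = (\int[P]_(om in H) p t (X s om) A)%E.

(* G is the generator on F: (P_h F - F) / h --> G F uniformly on S_N *)
Definition generates (p : R -> R.-pker E ~> E) (F : E -> R) (GF : E -> R) :
    Prop :=
  forall e : R, 0 < e -> \forall h \near 0^'+, forall mu, SN mu ->
    `|(fine (\int[p h mu]_(nu in SN) (F nu)%:E)%E - F mu) / h - GF mu| <= e.

Definition kac_process_of (B : 'rV[R]_d -> 'rV[R]_d -> R)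
    (X : R -> Omega -> E) : Prop :=
  [/\ forall t : R, 0 <= t -> measurable_fun setT (X t),
      forall om, cadlag (X ^~ om) &
      exists p : R -> R.-pker E ~> E,
        [/\ transition_semigroup p, markov_with p X &
            forall F, w1_lipschitz N F -> generates p F (generator N B F)]].

Definition noncutoff_kac_process (gamma : R) (b : R -> R) :=
  kac_process_of (kernel_B gamma b).

Definition cutoff_kac_process (gamma : R) (b : R -> R) (K : R)
    (X : R -> Omega -> E) : Prop :=
  exists2 theta0, cutoff_angle d gamma b K theta0 &
    kac_process_of (kernel_cut gamma b theta0) X.

Definition kac_process (gamma : R) (b : R -> R) (X : R -> Omega -> E) : Prop :=
  noncutoff_kac_process gamma b X \/
  exists2 K, 1 <= K & cutoff_kac_process gamma b K X.

Definition sup_moment (p tfin : R) (X : R -> Omega -> E) (om : Omega) : \bar R :=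
  ereal_sup [set (moment p (X t om))%:E | t in `[0, tfin]%classic].

(* T^N_b, equal to +oo when the level is never exceeded *)
Definition exceed_time (p c : R) (X : R -> Omega -> E) (om : Omega) : \bar R :=
  ereal_inf [set t%:E | t in
    [set t : R | 0 <= t /\ Lambda p (X t om) > c / 2 `^ (p / 2 + 1)]].

End Processes.

(* Main.v *)
Require Import Defs.
From HB Require Import structures.
From mathcomp Require Import all_boot all_order all_algebra.
From mathcomp Require Import all_classical all_reals all_analysis.
From mathcomp Require Import measurable_realfun ring lra.

(**
The [p]-th moment of a Kac process is a function of a Markov process, and its
fluctuations are of order [N^(-1/2)] around a drift that is negative as soon as
the moment is large. The proof makes this quantitative, with constants that see
the kernel only through two grazing moments.

Collisions. The two energies after a collision are averages of the energies
before it, with weights given by the deviation angle [theta], up to an azimuthal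
exchange of size at most [sin theta |v| |w|]. By convexity the gain of
[|v|^p + |w|^p] is then at most [- c sin^2 theta (|v|^p + |w|^p)] plus a mixed
term of first order in [sin theta] ([povzner]), and its absolute value is of first order in
[sin theta] ([transfer_bound]). So two integrals of the kernel matter. That of
[sin theta] is finite because [nu < 1]; that of [sin^2 theta] is bounded below,
either by the part of the kernel that lies on a fixed band of directions, or, if
the cutoff removes this band, by the total rate [K >= 1]. Both bounds hold
uniformly in the cutoff ([kernel_bounds]).

Drift. Averaging over pairs and using that the energy is normalised, the mixed
terms are absorbed: the generator maps the moment of order [k] to at most
[C - c * moment k] ([generator_moment_le]). Let [excess m y] be the square of
the positive part of [y - m]. For [m] above the equilibrium value of the
[p]-th moment, the first-order part of the generator on [excess m (moment p)]
is nonpositive. A collision changes the moment by [transfer / N] and collisions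
occur at a rate of order [N], so the second-order part is at most [C2 / N] times
the moment of order [2 p + gamma] ([generator_excess_le]).

Maximal inequality. These functionals are Lipschitz on the state space, where all
speeds are at most [sqrt N], so they may be used in the definition of the
process. That definition says that a time step [h] of the Markov process adds [h] times the
generator, with an error [e h] uniform in the state; this makes it possible to
work with discrete times and to let the mesh tend to zero. The first drift bound
shows that the moment of order [2 p + gamma] stays of order [a3] in mean
([moment_grid]). By the second one the expected excess, stopped when the moment
passes [m + eps], grows at a rate of order [a3 / N]; passing the level costs
[eps ^+ 2] ([maximal_grid]). Dyadic times exhaust the supremum because the paths
are right-continuous, and slicing the initial data turns the deterministic
level [m] into the maximum of [C1] and the initial moment ([maximal_moment]).

Hitting times. Since [Lambda p] is comparable to [1 + moment p], passing a large
multiple of [a1] forces the moment to exceed its initial value and [C1] by at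
least [1], so the second claim follows from the first with [eps = 1]
([kac_exceed]).
*)

Set Implicit Arguments.
Unset Strict Implicit.
Unset Printing Implicit Defensive.

Import Order.TTheory GRing.Theory Num.Theory.
Import numFieldNormedType.Exports.
Import HBNNSimple.

Local Open Scope classical_set_scope.
Local Open Scope ring_scope.

(** * Convexity inequalities for powers *)

Section PowerInequalities.
Variable R : realType.
Implicit Types (q x y t tau s eta : R).

Lemma le_powR2 q x y : 0 <= q -> 0 <= x -> x <= y -> x `^ q <= y `^ q.
Proof.
by move=> q0 x0 xy; apply: ge0_ler_powR => //; rewrite nnegrE // (le_trans x0).
Qed.

Lemma powR_subl_le q x y : 1 <= q -> 0 <= x -> x <= y ->
  y `^ q - x `^ q <= q * y `^ (q - 1) * (y - x).
Proof.
move=> q1 x0 xy; have q0 : 0 < q by exact: lt_le_trans q1.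
have [->|xn0] := eqVneq x 0.
  rewrite powR0 ?gt_eqF// !subr0 -mulrA.
  have [->|yn0] := eqVneq y 0; first by rewrite powR0 ?gt_eqF// !mulr0.
  rewrite mulrC -{3}(powRr1 (le_trans x0 xy)) -powRD; last first.
    by apply/implyP => _.
  by rewrite subrK ler_peMr// powR_ge0.
have xp : 0 < x by rewrite lt_neqAle eq_sym xn0.
have der t : t \in `]x, y[ -> is_derive t 1 ((@powR R)^~ q) (q * t `^ (q - 1)).
  by rewrite in_itv/= => /andP[xt _]; apply: is_derive1_powR; exact: lt_trans xt.
have cont : {within `[x, y], continuous ((@powR R)^~ q)}.
  apply: derivable_within_continuous => t; rewrite in_itv/= => /andP[xt _].
  have t0 : 0 < t by exact: lt_le_trans xt.
  by have [] := is_derive1_powR q t0.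
have [c + ->] := MVT_segment xy der cont.
rewrite in_itv/= => /andP[xc cy].
rewrite ler_wpM2r ?subr_ge0// ler_wpM2l ?(ltW q0)// le_powR2 ?subr_ge0//.
exact: le_trans xc.
Qed.

Lemma powR_lipschitz q x y M : 1 <= q -> 0 <= x <= M -> 0 <= y <= M ->
  `|x `^ q - y `^ q| <= q * M `^ (q - 1) * `|x - y|.
Proof.
move=> q1; wlog xy : x y / x <= y.
  move=> H; case: (leP x y) => [|/ltW yx]; first exact: H.
  by move=> xM yM; rewrite distrC (distrC x); exact: H.
move=> /andP[x0 xM] /andP[y0 yM].
rewrite distrC (distrC x) !ger0_norm ?subr_ge0 ?le_powR2//; last 1 first.
  exact: le_trans q1.
apply: le_trans (powR_subl_le q1 x0 xy) _.
rewrite ler_wpM2r ?subr_ge0// ler_wpM2l ?le_powR2 ?subr_ge0//.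
exact: le_trans q1.
Qed.

Lemma convex_functionE (D : set R) (f : R -> R) x y t :
  convex_function (D : set R) f -> D x -> D y -> 0 <= t <= 1 ->
  f ((1 - t) * x + t * y) <= (1 - t) * f x + t * f y.
Proof.
move=> cf Dx Dy t01.
have /andP[t0 t1] : 0 <= 1 - t <= 1 by move: t01 => /andP[? ?]; lra.
have H := cf (Itv01 t0 t1) x y (mem_set Dx) (mem_set Dy).
have e : 1 - (1 - t) = t by ring.
by rewrite -{2 4}e; exact: H.
Qed.

Lemma powR_convex q x y t : 1 <= q -> 0 <= x -> 0 <= y -> 0 <= t <= 1 ->
  ((1 - t) * x + t * y) `^ q <= (1 - t) * x `^ q + t * y `^ q.
Proof.
move=> q1 x0 y0; apply: (convex_functionE (convex_powR q1));
  by rewrite /= in_itv/= andbT.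
Qed.

(** Expand around the larger of [x] and [y]: the smaller one is at most
    [sqrt (x y)], so what the power of the sum has in excess of the sum of the
    powers is a mixed term. *)
Lemma powR_addl_le q x y : 1 <= q -> 0 <= x -> 0 <= y ->
  (x + y) `^ q <= x `^ q + y `^ q + q * Num.sqrt (x * y) * (x + y) `^ (q - 1).
Proof.
move=> q1; wlog yx : x y / y <= x.
  move=> H x0 y0; case: (leP y x) => [|/ltW yx]; first by move=> ?; exact: H.
  by rewrite addrC (addrC (x `^ _)) (mulrC x) H.
move=> x0 y0.
have q0 : 0 <= q by exact: le_trans q1.
have xxy : x <= x + y by rewrite lerDl.
have := powR_subl_le q1 x0 xxy; rewrite lerBlDl addrAC subrr add0r => H.
apply: le_trans H _; rewrite -addrA lerD2l.
rewrite -[leLHS]add0r lerD ?powR_ge0// -mulrA -[leRHS]mulrA ler_wpM2l//.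
rewrite mulrC ler_wpM2r ?powR_ge0//.
by rewrite -[leLHS](ger0_norm y0) -sqrtr_sqr ler_wsqrtr// expr2 ler_wpM2r.
Qed.

(** Strict convexity with an explicit gain: the defect at the midpoint is of the
    order of [x^q + y^q], up to a mixed term that only counts when [x] and [y]
    are comparable. *)
Lemma midpoint_defect q x y : 1 <= q -> 0 <= x -> 0 <= y ->
  (1 - 2 `^ (1 - q)) * (x `^ q + y `^ q)
    - q * Num.sqrt (x * y) * (x + y) `^ (q - 1)
  <= x `^ q + y `^ q - 2 * ((x + y) / 2) `^ q.
Proof.
move=> q1 x0 y0; have q0 : 0 <= q by exact: le_trans q1.
have -> : 2 * ((x + y) / 2) `^ q = 2 `^ (1 - q) * (x + y) `^ q.
  rewrite powRM ?addr_ge0// ?invr_ge0// powRB ?powRr1//; last first.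
    by apply/implyP.
  rewrite -[2^-1]powR_inv1// -powRrM mulN1r powRN; ring.
have := powR_addl_le q1 x0 y0.
set T := q * _ * _; set A := x `^ q + y `^ q; set s := 2 `^ _ => H.
have T0 : 0 <= T by rewrite !mulr_ge0// ?sqrtr_ge0// powR_ge0.
have s0 : 0 <= s by rewrite powR_ge0.
have s1 : s <= 1.
  by rewrite /s -[leRHS](powRr0 2); apply: ler_powR; lra.
nra.
Qed.

(** Povzner inequality in terms of energies. Here [tau] is [1 - cos theta], [s]
    is [sin theta], and [eta] is the part of the energy transfer that depends on
    the azimuth of the collision. Replacing the energies [x], [y] by the averages
    [a], [b] lowers the sum of the powers by [tau] times the midpoint defect;
    moving by [eta] costs a mixed term, since a power is Lipschitz. *)
Lemma povzner_scalar q x y tau s eta : 1 <= q -> 0 <= x -> 0 <= y ->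
  0 <= s <= 1 -> s ^+ 2 / 2 <= tau <= s ^+ 2 ->
  `|eta| <= s * Num.sqrt (x * y) ->
  let a := (1 - tau) * x + tau * ((x + y) / 2) in
  let b := (1 - tau) * y + tau * ((x + y) / 2) in
  0 <= a + eta -> 0 <= b - eta ->
  (a + eta) `^ q + (b - eta) `^ q - x `^ q - y `^ q
  <= - (s ^+ 2 / 2 * (1 - 2 `^ (1 - q)) * (x `^ q + y `^ q))
     + 3 * q * s * Num.sqrt (x * y) * (x + y) `^ (q - 1).
Proof.
move=> q1 x0 y0 /andP[s0 s1] /andP[stau taus] etas a b a0 b0.
have q0 : 0 <= q by exact: le_trans q1.
have tau0 : 0 <= tau by apply: le_trans stau; rewrite divr_ge0// sqr_ge0.
have s2 : s ^+ 2 <= 1 by rewrite expr_le1.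
have tau1 : tau <= 1 by exact: le_trans s2.
have t01 : 0 <= tau <= 1 by rewrite tau0.
have m0 : 0 <= (x + y) / 2 by lra.
have Ea := powR_convex q1 x0 m0 t01.
have Eb := powR_convex q1 y0 m0 t01.
have ab : a + b = x + y by rewrite /a /b; field.
have aM : 0 <= a <= x + y by apply/andP; split; rewrite /a; nra.
have bM : 0 <= b <= x + y by apply/andP; split; rewrite /b; nra.
have aeM : 0 <= a + eta <= x + y by rewrite a0/=; lra.
have beM : 0 <= b - eta <= x + y by rewrite b0/=; lra.
have La := powR_lipschitz q1 aeM aM.
have Lb := powR_lipschitz q1 beM bM.
have -> : (a + eta) `^ q + (b - eta) `^ q - x `^ q - y `^ q =
  ((a + eta) `^ q - a `^ q) + ((b - eta) `^ q - b `^ q) +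
  (a `^ q + b `^ q - x `^ q - y `^ q) by ring.
have {}La : (a + eta) `^ q - a `^ q <=
    q * (x + y) `^ (q - 1) * (s * Num.sqrt (x * y)).
  apply: le_trans (ler_norm _) _; apply: le_trans La _.
  rewrite ler_wpM2l ?mulr_ge0 ?powR_ge0//.
  by have -> : a + eta - a = eta by ring.
have {}Lb : (b - eta) `^ q - b `^ q <=
    q * (x + y) `^ (q - 1) * (s * Num.sqrt (x * y)).
  apply: le_trans (ler_norm _) _; apply: le_trans Lb _.
  rewrite ler_wpM2l ?mulr_ge0 ?powR_ge0//.
  have -> : b - eta - b = - eta by ring.
  by rewrite normrN.
have D0 : 0 <= x `^ q + y `^ q - 2 * ((x + y) / 2) `^ q.
  have h01 : 0 <= (2^-1 : R) <= 1 by lra.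
  have := powR_convex q1 x0 y0 h01.
  have -> : (1 - 2^-1) * x + 2^-1 * y = (x + y) / 2 by field.
  lra.
have D1 := midpoint_defect q1 x0 y0.
set T := q * Num.sqrt (x * y) * (x + y) `^ (q - 1) in D1.
have T0 : 0 <= T by rewrite !mulr_ge0// ?sqrtr_ge0// powR_ge0.
set D := x `^ q + y `^ q - _ in D0 D1.
have Dab : a `^ q + b `^ q - x `^ q - y `^ q <= - (tau * D).
  rewrite /D; rewrite -/a in Ea; rewrite -/b in Eb; lra.
have -> : 3 * q * s * Num.sqrt (x * y) * (x + y) `^ (q - 1) = 3 * s * T.
  by rewrite /T; ring.
have E1 : q * (x + y) `^ (q - 1) * (s * Num.sqrt (x * y)) = s * T.
  by rewrite /T; ring.
rewrite E1 in La Lb.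
have H1 : s ^+ 2 / 2 * D <= tau * D by rewrite ler_wpM2r.
set A := _ * (x `^ q + y `^ q) in D1.
have -> : s ^+ 2 / 2 * (1 - 2 `^ (1 - q)) * (x `^ q + y `^ q) = s ^+ 2 / 2 * A.
  by rewrite /A; ring.
have H2 : s ^+ 2 / 2 * (A - T) <= s ^+ 2 / 2 * D.
  by rewrite ler_wpM2l// divr_ge0// sqr_ge0.
have H3 : s ^+ 2 / 2 * T <= s * T.
  rewrite ler_wpM2r//; nra.
lra.
Qed.

(** Both [tau] and [eta] are of the order of [s], hence so are the changes of the
    two energies. *)
Lemma powR_transfer_bound q x y tau s eta : 1 <= q -> 0 <= x -> 0 <= y ->
  0 <= s <= 1 -> 0 <= tau <= s ^+ 2 ->
  `|eta| <= s * Num.sqrt (x * y) ->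
  let a := (1 - tau) * x + tau * ((x + y) / 2) in
  let b := (1 - tau) * y + tau * ((x + y) / 2) in
  0 <= a + eta -> 0 <= b - eta ->
  `|(a + eta) `^ q + (b - eta) `^ q - x `^ q - y `^ q|
  <= 2 * q * s * (x + y) `^ q.
Proof.
move=> q1 x0 y0 /andP[s0 s1] /andP[tau0 taus] etas a b a0 b0.
have q0 : 0 <= q by exact: le_trans q1.
have s2 : s ^+ 2 <= s by rewrite expr2 ler_piMr.
have ab : a + b = x + y by rewrite /a /b; field.
have aeM : 0 <= a + eta <= x + y by rewrite a0/=; lra.
have beM : 0 <= b - eta <= x + y by rewrite b0/=; lra.
have xM : 0 <= x <= x + y by rewrite x0 lerDl.
have yM : 0 <= y <= x + y by rewrite y0 lerDr.
have La := powR_lipschitz q1 aeM xM.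
have Lb := powR_lipschitz q1 beM yM.
have sxy : Num.sqrt (x * y) <= (x + y) / 2.
  rewrite -[leRHS]ger0_norm; last by lra.
  rewrite -sqrtr_sqr ler_wsqrtr//.
  by have := sqr_ge0 (x - y); rewrite !expr2; lra.
have sxy' : s * Num.sqrt (x * y) <= s * ((x + y) / 2) by rewrite ler_wpM2l.
have taux : tau * `|y - x| <= s * (x + y).
  apply: ler_pM => //; first lra.
  by rewrite ler_norml; apply/andP; split; lra.
have Ex : `|a + eta - x| <= s * (x + y).
  have -> : a + eta - x = tau * (y - x) / 2 + eta by rewrite /a; field.
  apply: le_trans (ler_normD _ _) _.
  rewrite !normrM (ger0_norm tau0) (ger0_norm (_ : 0 <= 2^-1)) ?invr_ge0//; lra.
have Ey : `|b - eta - y| <= s * (x + y).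
  have -> : b - eta - y = - (a + eta - x) by rewrite /a /b; field.
  by rewrite normrN.
have E : q * (x + y) `^ (q - 1) * (s * (x + y)) = q * s * (x + y) `^ q.
  have [z0|zn0] := eqVneq (x + y) 0.
    by rewrite z0 !mulr0 powR0 ?mulr0//; apply: lt0r_neq0; lra.
  have <- : (x + y) `^ (q - 1) * (x + y) = (x + y) `^ q.
    rewrite -{2}(powRr1 (addr_ge0 x0 y0)) -powRD ?subrK//.
    by apply/implyP.
  ring.
have -> : (a + eta) `^ q + (b - eta) `^ q - x `^ q - y `^ q =
  ((a + eta) `^ q - x `^ q) + ((b - eta) `^ q - y `^ q) by ring.
apply: le_trans (ler_normD _ _) _.
have := le_trans La (ler_wpM2l (mulr_ge0 q0 (powR_ge0 _ _)) Ex).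
have := le_trans Lb (ler_wpM2l (mulr_ge0 q0 (powR_ge0 _ _)) Ey).
rewrite E; lra.
Qed.

End PowerInequalities.

(** * Collisions and the Povzner inequality *)

Section EuclideanFacts.
Variables (R : realType) (d : nat).
Implicit Types (u v w s : 'rV[R]_d) (a x : R).

Lemma dotC u v : dot u v = dot v u.
Proof. by apply: eq_bigr => i _; rewrite mulrC. Qed.

Lemma dotDl u v w : dot (u + v) w = dot u w + dot v w.
Proof. by rewrite -big_split; apply: eq_bigr => i _; rewrite mxE mulrDl. Qed.

Lemma dotZl a u v : dot (a *: u) v = a * dot u v.
Proof. by rewrite /dot mulr_sumr; apply: eq_bigr => i _; rewrite mxE mulrA. Qed.

Lemma dotDr u v w : dot w (u + v) = dot w u + dot w v.
Proof. by rewrite dotC dotDl !(dotC w). Qed.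

Lemma dotZr a u v : dot u (a *: v) = a * dot u v.
Proof. by rewrite dotC dotZl dotC. Qed.

Lemma dotNl u v : dot (- u) v = - dot u v.
Proof. by rewrite -scaleN1r dotZl mulN1r. Qed.

Lemma dotNr u v : dot u (- v) = - dot u v.
Proof. by rewrite dotC dotNl dotC. Qed.

Definition dotE := (dotDl, dotDr, dotNl, dotNr, dotZl, dotZr).

Lemma dot_ge0 u : 0 <= dot u u.
Proof. by apply: sumr_ge0 => i _; rewrite -expr2 sqr_ge0. Qed.

Lemma enorm_ge0 u : 0 <= enorm u.
Proof. exact: sqrtr_ge0. Qed.

Lemma enorm_sqr u : enorm u ^+ 2 = dot u u.
Proof. by rewrite sqr_sqrtr ?dot_ge0. Qed.

Lemma enorm0_eq0 u : enorm u = 0 -> u = 0.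
Proof.
move=> u0; have /eqP := enorm_sqr u; rewrite u0 expr0n/= eq_sym.
rewrite psumr_eq0; last by move=> i _; rewrite -expr2 sqr_ge0.
move=> /allP H; apply/rowP => i; rewrite mxE.
have := H i (mem_index_enum _); rewrite -expr2 sqrf_eq0 => /eqP//.
Qed.

Lemma enorm_gt0 u : u != 0 -> 0 < enorm u.
Proof.
move=> u0; rewrite lt_neqAle enorm_ge0 andbT eq_sym.
by apply: contra u0 => /eqP/enorm0_eq0 ->.
Qed.

Lemma enorm_eq0 : enorm (0 : 'rV[R]_d) = 0.
Proof.
rewrite /enorm; have -> : dot (0 : 'rV[R]_d) 0 = 0; last by rewrite sqrtr0.
by rewrite -[X in dot X _](scale0r (0 : 'rV[R]_d)) dotZl mul0r.
Qed.

Lemma enormZ a u : enorm (a *: u) = `|a| * enorm u.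
Proof.
by rewrite /enorm dotZl dotZr mulrA -expr2 sqrtrM ?sqr_ge0// sqrtr_sqr.
Qed.

Lemma enormN u : enorm (- u) = enorm u.
Proof. by rewrite -scaleN1r enormZ normrN1 mul1r. Qed.

Lemma dot_sqr_le u v : dot u v ^+ 2 <= dot u u * dot v v.
Proof.
have [->|v0] := eqVneq v 0.
  by rewrite -(scale0r (0 : 'rV[R]_d)) !dotE !mul0r expr0n mulr0.
have vv : 0 < dot v v by rewrite -enorm_sqr exprn_gt0// enorm_gt0.
have := dot_ge0 (u - (dot u v / dot v v) *: v).
rewrite !dotE (dotC v u).
set e := (X in 0 <= X -> _).
have -> : e = (dot u u * dot v v - dot u v ^+ 2) / dot v v.
  by rewrite /e; field; rewrite gt_eqF.
by rewrite pmulr_lge0 ?invr_gt0// subr_ge0.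
Qed.

Lemma dot_le u v : `|dot u v| <= enorm u * enorm v.
Proof.
rewrite -sqrtr_sqr /enorm -sqrtrM ?dot_ge0// ler_wsqrtr//.
exact: dot_sqr_le.
Qed.

Lemma enormD u v : enorm (u + v) <= enorm u + enorm v.
Proof.
rewrite -(ler_pXn2r (n := 2))// ?nnegrE ?addr_ge0 ?enorm_ge0//.
rewrite sqrrD !enorm_sqr !dotE (dotC v u).
by have := le_trans (ler_norm _) (dot_le u v); lra.
Qed.

Lemma enormB u v : `|enorm u - enorm v| <= enorm (u - v).
Proof.
have := enormD (u - v) v; rewrite subrK.
have := enormD (v - u) u; rewrite subrK -(opprB u v) enormN => H1 H2.
by rewrite ler_norml; apply/andP; split; lra.
Qed.

Lemma le_coord_enorm u (i : 'I_d) : `|u 0 i| <= enorm u.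
Proof.
rewrite -sqrtr_sqr ler_wsqrtr// expr2 /dot (bigD1 i)//= lerDl.
by apply: sumr_ge0 => j _; rewrite -expr2 sqr_ge0.
Qed.

Lemma enorm_le_coord u a : 0 <= a -> (forall i, `|u 0 i| <= a) ->
  enorm u <= d%:R * a.
Proof.
move=> a0 H; rewrite -[leRHS]ger0_norm ?mulr_ge0// -sqrtr_sqr ler_wsqrtr//.
have -> : (d%:R * a) ^+ 2 = d%:R ^+ 2 * a ^+ 2 by rewrite exprMn.
apply: (@le_trans _ _ (d%:R * a ^+ 2)).
  rewrite mulr_natl -[in leRHS](card_ord d) -sumr_const.
  apply: ler_sum => i _; rewrite -expr2 -real_normK ?num_real//.
  by rewrite lerXn2r ?nnegrE.
rewrite ler_wpM2r ?sqr_ge0// expr2.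
by case: (d) => [|n]; rewrite ?mul0r// ler_peMl// ler1n.
Qed.

Lemma enorm_powR u (p : R) : enorm u `^ p = dot u u `^ (p / 2).
Proof.
rewrite -enorm_sqr -powR_mulrn ?enorm_ge0// -powRrM.
by congr (_ `^ _); field.
Qed.

Lemma sqrt_dot u v : Num.sqrt (dot u u * dot v v) = enorm u * enorm v.
Proof. by rewrite sqrtrM ?dot_ge0. Qed.

(** The deviation angle lies between [0] and [pi], so its sine is a function of
    its cosine; working with these two numbers avoids the angle itself. *)
Definition cosd (z s : 'rV[R]_d) : R := dot s z / enorm z.
Definition sind (z s : 'rV[R]_d) : R := Num.sqrt (1 - cosd z s ^+ 2).

Lemma cosd_itv z s : enorm s = 1 -> -1 <= cosd z s <= 1.
Proof.
move=> s1; rewrite -ler_norml /cosd normrM normfV (ger0_norm (enorm_ge0 z)).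
have [z0|z0] := eqVneq z 0; first by rewrite z0 enorm_eq0 invr0 mulr0.
rewrite ler_pdivrMr ?enorm_gt0// mul1r.
by apply: le_trans (dot_le _ _) _; rewrite s1 mul1r.
Qed.

Lemma cosd_sqr z s : enorm s = 1 -> cosd z s ^+ 2 <= 1.
Proof.
by move=> /(cosd_itv z); rewrite -ler_norml => H; rewrite -real_normK ?num_real// expr_le1.
Qed.

Lemma sind_sqr z s : enorm s = 1 -> sind z s ^+ 2 = 1 - cosd z s ^+ 2.
Proof. by move=> s1; rewrite sqr_sqrtr// subr_ge0 cosd_sqr. Qed.

Lemma sind_ge0 z s : 0 <= sind z s.
Proof. exact: sqrtr_ge0. Qed.

Lemma sind_le1 z s : sind z s <= 1.
Proof.
by rewrite -[leRHS]sqrtr1 ler_wsqrtr// gerBl sqr_ge0.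
Qed.

Definition transfer (p : R) v w s : R :=
  enorm (post1 v w s : 'rV[R]_d) `^ p + enorm (post2 v w s : 'rV[R]_d) `^ p
  - enorm v `^ p - enorm w `^ p.

(** The component of [s] orthogonal to [v - w], paired with [v + w] and scaled by
    half the relative speed: the part of the exchanged energy that the deviation
    angle does not determine. *)
Definition azimuth v w s : R :=
  enorm (v - w) / 2 * dot s (v + w) - cosd (v - w) s / 2 * (dot v v - dot w w).

Lemma dot_post1 v w s : enorm s = 1 ->
  let tau := 1 - cosd (v - w) s in
  dot (post1 v w s) (post1 v w s) =
  (1 - tau) * dot v v + tau * ((dot v v + dot w w) / 2) + azimuth v w s.
Proof.
move=> s1 tau; have ss : dot s s = 1 by rewrite -enorm_sqr s1 expr1n.
have zz := enorm_sqr (v - w); rewrite !dotE in zz.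
rewrite /post1 /azimuth /tau !dotE ss (dotC w v) (dotC v s) (dotC w s).
rewrite (dotC w v) in zz.
have n2 : (enorm (v - w) / 2) * (enorm (v - w) / 2) =
    (dot v v - dot v w *+ 2 + dot w w) / 4.
  have -> : enorm (v - w) / 2 * (enorm (v - w) / 2) = enorm (v - w) ^+ 2 / 4.
    by field.
  by rewrite zz; field.
by lra.
Qed.

Lemma dot_post2 v w s : enorm s = 1 ->
  let tau := 1 - cosd (v - w) s in
  dot (post2 v w s) (post2 v w s) =
  (1 - tau) * dot w w + tau * ((dot v v + dot w w) / 2) - azimuth v w s.
Proof.
move=> s1 tau; have ss : dot s s = 1 by rewrite -enorm_sqr s1 expr1n.
have zz := enorm_sqr (v - w); rewrite !dotE in zz.
rewrite /post2 /azimuth /tau !dotE ss (dotC w v) (dotC v s) (dotC w s).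
rewrite (dotC w v) in zz.
have n2 : (enorm (v - w) / 2) * (enorm (v - w) / 2) =
    (dot v v - dot v w *+ 2 + dot w w) / 4.
  have -> : enorm (v - w) / 2 * (enorm (v - w) / 2) = enorm (v - w) ^+ 2 / 4.
    by field.
  by rewrite zz; field.
by lra.
Qed.

(** The component [u] of [s] orthogonal to [z = v - w] has length [sin theta], and
    the component [y] of [v] orthogonal to [z] satisfies [|z| |y| <= |v| |w|];
    the azimuthal term is [|z|] times the scalar product of [u] and [y]. *)
Lemma azimuth_le v w s : enorm s = 1 -> v != w ->
  `|azimuth v w s| <= sind (v - w) s * Num.sqrt (dot v v * dot w w).
Proof.
move=> s1 vw; rewrite /azimuth /sind.
have [z zE] : exists z, z = v - w by exists (v - w).
rewrite -zE; set x := cosd z s; set n := enorm z.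
have n0 : 0 < n by rewrite enorm_gt0// zE subr_eq0.
have ss : dot s s = 1 by rewrite -enorm_sqr s1 expr1n.
have zz : dot z z = n ^+ 2 by rewrite enorm_sqr.
have x2 : 0 <= 1 - x ^+ 2 by rewrite subr_ge0 cosd_sqr.
have sz : dot s z = x * n by rewrite /x /cosd divfK ?gt_eqF.
have wE : w = v - z by rewrite zE opprB addrC subrK.
rewrite -sqrtr_sqr -sqrtrM// ler_wsqrtr// wE !dotE (dotC z v).
pose u := s - (x / n) *: z; pose y := v - (dot v z / n ^+ 2) *: z.
have uu : dot u u = 1 - x ^+ 2.
  by rewrite /u !dotE ss (dotC z s) zz sz; field; rewrite gt_eqF.
have yy : dot y y = dot v v - dot v z ^+ 2 / n ^+ 2.
  by rewrite /y !dotE (dotC z v) zz; field; rewrite gt_eqF.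
have uy : n * dot u y = n * dot s v - x * dot v z.
  by rewrite /u /y !dotE sz zz (dotC z v); field; rewrite gt_eqF.
have := dot_sqr_le u y; rewrite uu => H.
set e := (X in X ^+ 2 <= _).
have -> : e = n * dot u y by rewrite uy /e sz zz; field.
rewrite exprMn.
apply: (@le_trans _ _ (n ^+ 2 * ((1 - x ^+ 2) * dot y y))).
  by rewrite ler_wpM2l ?sqr_ge0.
rewrite mulrCA ler_wpM2l// yy zz.
set V := dot v v; set c := dot v z.
have -> : n ^+ 2 * (V - c ^+ 2 / n ^+ 2) = n ^+ 2 * V - c ^+ 2.
  by field; rewrite gt_eqF.
by have := sqr_ge0 (V - c); rewrite -/V; lra.
Qed.

Lemma transferE p v w s : enorm s = 1 ->
  let tau := 1 - cosd (v - w) s in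
  transfer p v w s =
  ((1 - tau) * dot v v + tau * ((dot v v + dot w w) / 2) + azimuth v w s) `^ (p / 2)
  + ((1 - tau) * dot w w + tau * ((dot v v + dot w w) / 2) - azimuth v w s) `^ (p / 2)
  - dot v v `^ (p / 2) - dot w w `^ (p / 2).
Proof.
by move=> s1 tau; rewrite /transfer !enorm_powR dot_post1// dot_post2.
Qed.

Lemma povzner p v w s : 2 <= p -> v != w -> enorm s = 1 ->
  0 <= cosd (v - w) s ->
  transfer p v w s <=
  - (sind (v - w) s ^+ 2 / 2 * (1 - 2 `^ (1 - p / 2)) *
      (enorm v `^ p + enorm w `^ p))
  + 3 * (p / 2) * sind (v - w) s * (enorm v * enorm w) *
      (dot v v + dot w w) `^ (p / 2 - 1).
Proof.
move=> p2 vw s1 x0; rewrite transferE// -!sqrt_dot !enorm_powR.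
have /andP[_ x1] := cosd_itv (v - w) s1.
apply: povzner_scalar; rewrite ?dot_ge0//.
- lra.
- by rewrite sind_ge0 sind_le1.
- by rewrite sind_sqr//; apply/andP; split; nra.
- exact: azimuth_le.
- by rewrite -dot_post1// dot_ge0.
- by rewrite -dot_post2// dot_ge0.
Qed.

Lemma transfer_bound p v w s : 2 <= p -> enorm s = 1 ->
  0 <= cosd (v - w) s ->
  `|transfer p v w s| <= p * sind (v - w) s * (dot v v + dot w w) `^ (p / 2).
Proof.
move=> p2 s1 x0; have [vw|vw] := eqVneq v w.
  rewrite vw /transfer /post1 /post2 subrr enorm_eq0 mul0r scale0r addr0 subr0.
  have -> : 2^-1 *: (w + w) = w.
    by rewrite scalerDr -scalerDl -[RHS]scale1r; congr (_ *: _); field.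
  rewrite addrK subrr normr0 !mulr_ge0 ?sind_ge0 ?powR_ge0//; lra.
have /andP[_ x1] := cosd_itv (v - w) s1.
rewrite transferE//.
have -> : p = 2 * (p / 2) by field.
have -> : 2 * (p / 2) / 2 = p / 2 by field.
apply: powR_transfer_bound; rewrite ?dot_ge0//.
- lra.
- by rewrite sind_ge0 sind_le1.
- by rewrite sind_sqr//; apply/andP; split; nra.
- exact: azimuth_le.
- by rewrite -dot_post1// dot_ge0.
- by rewrite -dot_post2// dot_ge0.
Qed.

End EuclideanFacts.

(** * Borel sets and Lebesgue measure on the Euclidean space *)

Section BorelVectors.
Variables (R : realType) (d : nat).
Local Notation V := (vec R d).

Lemma open_vec_measurable (U : set 'rV[R]_d) : open U -> measurable (U : set V).
Proof. by move=> oU; exact: sub_sigma_algebra. Qed.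

Lemma continuous_vec_measurable (f : 'rV[R]_d -> R) :
  continuous f -> measurable_fun setT (f : V -> R).
Proof.
move=> /continuousP cf.
apply: (measurability _ (RGenOInfty.measurableE R)) => _ [_ [x ->] <-].
rewrite setTI; apply: open_vec_measurable; apply: cf.
exact: interval_open.
Qed.

Lemma measurable_coord (i : 'I_d) :
  measurable_fun setT ((fun v => (v : 'rV[R]_d) 0 i) : V -> R).
Proof. by apply: continuous_vec_measurable; exact: coord_continuous. Qed.

(** Rational boxes form a countable base of the topology, so a map into
    [R^d] is Borel as soon as its coordinates are. *)
Lemma measurable_to_vec (dT : measure_display) (T : measurableType dT)
    (f : T -> V) :
  (forall i, measurable_fun setT (fun t => (f t : 'rV[R]_d) 0 i)) ->
  measurable_fun setT f.
Proof.
move=> mf; apply: (@measurability _ _ T V setT f (@open 'rV[R]_d) erefl).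
move=> _ [U oU <-]; rewrite setTI.
pose box (x : 'rV[rat]_d * nat) : set 'rV[R]_d :=
  [set y | forall i, `|y 0 i - ratr (x.1 0 i)| < x.2.+1%:R^-1].
have -> : f @^-1` U = \bigcup_(x in [set x | box x `<=` U]) (f @^-1` box x).
  apply/seteqP; split => [t /= Ut|t [x /= xU ft]]; last exact: xU.
  have : nbhs (f t : 'rV[R]_d) U by apply: open_nbhs_nbhs; split.
  move=> /nbhs_ballP[e e0 eU].
  have [n ne] : exists n : nat, n.+1%:R^-1 < e / 2.
    have e2 : 0 < e / 2 by rewrite divr_gt0.
    have := near_infty_natSinv_lt (PosNum e2).
    by move=> [N _ /(_ N (leqnn N))] ?; exists N.
  have n0 : (0 : R) < n.+1%:R^-1 by rewrite invr_gt0.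
  have H i : exists q : rat, `|(f t : 'rV[R]_d) 0 i - ratr q| < n.+1%:R^-1.
    have : (f t : 'rV[R]_d) 0 i - n.+1%:R^-1 < (f t : 'rV[R]_d) 0 i + n.+1%:R^-1.
      by rewrite ltrBlDr -addrA ltrDl addr_gt0.
    move=> /rat_in_itvoo[q]; rewrite in_itv/= => /andP[h1 h2].
    by exists q; rewrite distrC ltr_distl h1.
  pose q := \row_i sval (cid (H i)).
  exists (q, n) => [y /= yq|i /=]; last first.
    by rewrite mxE; case: cid.
  apply: eU; split => // i j; rewrite (ord1 i) /ball/=.
  have := yq j; rewrite mxE; case: cid => /= r hr hy.
  have -> : (f t : 'rV[R]_d) 0 j - y 0 j =
    ((f t : 'rV[R]_d) 0 j - ratr r) - (y 0 j - ratr r) by ring.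
  apply: le_lt_trans (ler_normB _ _) _.
  by rewrite (splitr e) ltrD//; exact: lt_trans ne.
rewrite bigcup_mkcond.
apply: countable_bigcupT_measurable => [|x]; first exact: countableP.
case: ifP => // _.
have -> : f @^-1` box x =
   \bigcap_(i in [set: 'I_d]) [set t | `|(f t : 'rV[R]_d) 0 i - ratr (x.1 0 i)| < x.2.+1%:R^-1].
  by apply/seteqP; split => t /=; [move=> h i _; exact: h|move=> h i; exact: h].
apply: fin_bigcap_measurable => // i _.
rewrite -[X in measurable X]setTI.
have := @measurable_funB _ _ _ setT _ _ (mf i) (measurable_cst (ratr (x.1 0 i) : R)).
move=> /(measurableT_comp (@normr_measurable R setT)) /(_ measurableT).
move=> /(_ `]-oo, x.2.+1%:R^-1[%classic) /(_ (measurable_itv _)).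
by congr (measurable (_ `&` _)); apply/seteqP; split => t /=; rewrite in_itv.
Qed.

Lemma measurable_dot (dT : measure_display) (T : measurableType dT)
    (f g : T -> V) : measurable_fun setT f -> measurable_fun setT g ->
  measurable_fun setT (fun t => dot (f t : 'rV[R]_d) (g t : 'rV[R]_d)).
Proof.
move=> mf mg; rewrite /dot; apply: measurable_sum => i.
by apply: measurable_funM; apply: measurableT_comp (measurable_coord i) _.
Qed.

Lemma measurable_enorm (dT : measure_display) (T : measurableType dT)
    (f : T -> V) : measurable_fun setT f ->
  measurable_fun setT (fun t => enorm (f t : 'rV[R]_d)).
Proof.
move=> mf; rewrite /enorm; apply: measurableT_comp (measurable_dot mf mf).
exact: continuous_measurable_fun (@sqrt_continuous R).
Qed.

Lemma measurable_sphere : measurable (@sphere R d).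
Proof.
have := @measurable_enorm _ V id (@measurable_id _ V setT) measurableT [set 1].
by rewrite setTI; apply; exact: measurable_set1.
Qed.

End BorelVectors.

Section LebesgueVectors.
Variable R : realType.

Lemma lebesgue_vec0 d : @lebesgue_vec R d set0 = 0%E.
Proof.
case: d => [|d] /=; first by rewrite /dirac indic0.
apply: integral0_eq => t _; elim: d => [|d IH]/=; first by rewrite /dirac indic0.
by apply: integral0_eq => u _; exact: IH.
Qed.

(** Sup-norm balls, the only sets whose volume has to be computed. *)
Definition cube d (c : 'rV[R]_d) (r : R) : set (vec R d) :=
  [set x | forall i, `|(x : 'rV[R]_d) 0 i - c 0 i| <= r].

Lemma row_mx0 d (t : R) (x : 'rV[R]_d) :
  (row_mx (const_mx t : 'rV[R]_1) x : 'rV[R]_d.+1) 0 ord0 = t.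
Proof.
have -> : (ord0 : 'I_d.+1) = lshift d (ord0 : 'I_1) by exact: val_inj.
by rewrite (row_mxEl (const_mx t : 'rV[R]_1) x) mxE.
Qed.

Lemma row_mxS d (t : R) (x : 'rV[R]_d) (j : 'I_d) :
  (row_mx (const_mx t : 'rV[R]_1) x : 'rV[R]_d.+1) 0 (lift ord0 j) = x 0 j.
Proof.
have -> : lift ord0 j = rshift 1 j :> 'I_d.+1 by exact: val_inj.
by rewrite (row_mxEr (const_mx t : 'rV[R]_1) x).
Qed.

Lemma cube_row_mx d (c : 'rV[R]_d.+1) r (t : R) (x : 'rV[R]_d) :
  cube c r (row_mx (const_mx t : 'rV[R]_1) x) <->
  `|t - c 0 ord0| <= r /\ cube (\row_j c 0 (lift ord0 j)) r x.
Proof.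
split => [H|[H1 H2] i].
  split; first by have := H ord0; rewrite row_mx0.
  by move=> j; have := H (lift ord0 j); rewrite row_mxS mxE.
case: (unliftP ord0 i) => [j ->|->]; last by rewrite row_mx0.
by have := H2 j; rewrite row_mxS mxE.
Qed.

Lemma lebesgue_vecS d (A : set (vec R d.+1)) :
  lebesgue_vec A = (@integral _ (measurableTypeR R) R lebesgue_measure setT (fun t =>
    lebesgue_vec [set x : vec R d |
      A (row_mx (const_mx t : 'rV[R]_1) (x : 'rV[R]_d))]))%E.
Proof. by []. Qed.

Lemma lebesgue_cube d (c : 'rV[R]_d) (r : R) : 0 <= r ->
  lebesgue_vec (cube c r) = ((2 * r) ^+ d)%:E.
Proof.
move=> r0; elim: d c => [|d IH] c.
  by rewrite /= /dirac indicE mem_set// => -[].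
rewrite lebesgue_vecS (eq_integral (fun t : measurableTypeR R =>
    (((2 * r) ^+ d)%:E * (\1_(`[c 0 ord0 - r, c 0 ord0 + r]%classic) t)%:E)%E)).
  rewrite ge0_integralZl//; first last.
  - by rewrite lee_fin exprn_ge0// mulr_ge0.
  - by apply/measurable_EFinP; exact: measurable_indic.
  rewrite integral_indic// setIT.
  have := lebesgue_measure_itv `[c 0 ord0 - r, c 0 ord0 + r].
  move=> /= ->; rewrite lte_fin.
  have [rp|] := ltP (c 0 ord0 - r) (c 0 ord0 + r).
    by rewrite -EFinB -EFinM exprSr; congr (_%:E); ring.
  move=> h; have -> : r = 0 by lra.
  by rewrite mule0 !mulr0 exprS mul0r.
move=> t _; rewrite indicE.
have [tc|tc] := boolP (`|t - c 0 ord0| <= r).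
  rewrite mem_set/=; last by rewrite in_itv/= -ler_distl.
  rewrite mule1 -(IH (\row_j c 0 (lift ord0 j))); congr lebesgue_vec.
  by apply/seteqP; split => x /=; rewrite cube_row_mx; [case|split].
rewrite memNset/=; last by rewrite in_itv/= -ler_distl; exact/negP.
rewrite mule0 -(lebesgue_vec0 d); congr lebesgue_vec.
by apply/seteqP; split => x //=; rewrite cube_row_mx (negbTE tc) => -[].
Qed.

Lemma measurable_row_mx d : measurable_fun setT
  (fun p : measurableTypeR R * vec R d => row_mx (const_mx p.1 : 'rV[R]_1) (p.2 : 'rV[R]_d)
     : vec R d.+1).
Proof.
apply: measurable_to_vec => i; case: (unliftP ord0 i) => [j ->|->].
  apply: (@eq_measurable_fun _ _ _ _ setT
    (fun p : measurableTypeR R * vec R d => (p.2 : 'rV[R]_d) 0 j)).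
    by move=> p _; rewrite row_mxS.
  by apply: measurableT_comp (measurable_coord j) _.
apply: (@eq_measurable_fun _ _ _ _ setT (fun p : measurableTypeR R * vec R d => p.1)).
  by move=> p _; rewrite row_mx0.
by move=> _ Y mY; exact: (measurable_fst measurableT Y mY).
Qed.

Lemma measurable_cube d (c : 'rV[R]_d) r : measurable (cube c r).
Proof.
have -> : cube c r = \bigcap_(i in [set: 'I_d]) [set x : vec R d |
    `|(x : 'rV[R]_d) 0 i - c 0 i| <= r].
  by apply/seteqP; split => t /=; [move=> h i _; exact: h|move=> h i; exact: h].
apply: fin_bigcap_measurable => // i _.
rewrite -[X in measurable X]setTI.
have := @measurable_funB _ _ _ setT _ _ (@measurable_coord R d i) (measurable_cst (c 0 i : R)).
move=> /(measurableT_comp (@normr_measurable R setT)) /(_ measurableT).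
move=> /(_ `]-oo, r]%classic) /(_ (measurable_itv _)).
by congr (measurable (_ `&` _)); apply/seteqP; split => t /=; rewrite in_itv.
Qed.

(** On Borel sets the iterated integral is a measure: at each step it is the
    image of a product measure, the factor on [R^d] being sigma-finite because
    cubes have finite volume. *)
Lemma lebesgue_vec_measure d : exists m : {measure set (vec R d) -> \bar R},
  forall A, measurable A -> lebesgue_vec A = m A.
Proof.
elim: d => [|d [m mE]].
  by exists (@dirac _ (vec R 0) (0 : 'rV[R]_0) R).
have sf : sigma_finite setT m.
  exists (fun n => cube (0 : 'rV[R]_d) n%:R).
    apply/esym/seteqP; split => // x _.
    exists (Num.bound (enorm (x : 'rV[R]_d))) => // i; rewrite mxE subr0.
    by rewrite (le_trans (le_coord_enorm _ _))// ltW// archi_boundP// enorm_ge0.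
  move=> n; split; first exact: measurable_cube.
  by rewrite -mE ?lebesgue_cube ?ltry//; exact: measurable_cube.
pose h1 := isSFinite.Build _ _ _ _ (sfinite_measure_sigma_finite sf).
pose h2 := isSigmaFinite.Build _ _ _ _ sf.
pose ms : {sigma_finite_measure set (vec R d) -> \bar R} :=
  HB.pack_for (SigmaFiniteMeasure.type (vec R d) R) (Measure.sort m) h1 h2.
pose prod : {measure set (measurableTypeR R * vec R d) -> \bar R} := (lebesgue_measure \x ms)%E.
exists (measure_function_pushforward__canonical__measure_function_Measure
  prod (@measurable_row_mx d)) => A mA.
rewrite lebesgue_vecS; apply: eq_integral => t _ /=.
have mB : measurable [set x : vec R d | A (row_mx (const_mx t : 'rV[R]_1) (x : 'rV[R]_d))].
  have /(_ measurableT _ mA) := measurableT_comp (@measurable_row_mx d) (pair1_measurable t).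
  by rewrite setTI.
rewrite mE//; congr (m _); apply/seteqP.
by split => x /=; rewrite /xsection/= inE.
Qed.

End LebesgueVectors.

(** * The surface measure of the sphere *)

(** Integrals only see a set function through its values on measurable sets,
    so they may be computed with any measure that agrees with it there. *)
Lemma eq_setfun_integral (dT : measure_display) (T : measurableType dT)
    (R : realType) (m1 m2 : set T -> \bar R) (D : set T) (f : T -> \bar R) :
  (forall A, measurable A -> m1 A = m2 A) ->
  integral m1 D f = integral m2 D f.
Proof.
move=> H; have E (h : {nnsfun T >-> R}) : sintegral m1 h = sintegral m2 h.
  by apply: eq_fsbigr => x _; rewrite H//; exact: measurable_sfunP.
rewrite /integral; congr (ereal_sup _ - ereal_sup _)%E;
  by apply: eq_imagel => h _; exact: E.
Qed.

Section SphereMeasure.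
Variables (R : realType) (d : nat).
Local Notation V := (vec R d).

Definition normalize (x : V) : V := (enorm (x : 'rV[R]_d))^-1 *: (x : 'rV[R]_d).

Lemma measurable_normalize : measurable_fun setT normalize.
Proof.
apply: measurable_to_vec => i.
apply: (@eq_measurable_fun _ _ _ _ setT
  (fun x : V => enorm (x : 'rV[R]_d) `^ (-1) * (x : 'rV[R]_d) 0 i)).
  by move=> x _; rewrite mxE powR_inv1// enorm_ge0.
apply: measurable_funM; last exact: measurable_coord.
by apply: measurableT_comp (measurable_powR _) _; exact: measurable_enorm.
Qed.

Definition punctured_ball : set V :=
  [set x | 0 < enorm (x : 'rV[R]_d) <= 1].

Lemma measurable_punctured_ball : measurable punctured_ball.
Proof.
have := @measurable_enorm R d _ V id (@measurable_id _ V setT) measurableT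
  `]0, 1]%classic (measurable_itv _).
by rewrite setTI; congr measurable; apply/seteqP; split => x /=; rewrite in_itv.
Qed.

Lemma surface_measure_def A :
  surface_measure A = (d%:R%:E *
    lebesgue_vec (punctured_ball `&` normalize @^-1` A))%E.
Proof. by []. Qed.

Lemma sphere_measure_exists : exists m : {measure set V -> \bar R},
  forall A, measurable A -> surface_measure A = m A.
Proof.
have [m mE] := @lebesgue_vec_measure R d.
pose m1 : {measure set V -> \bar R} := mrestr m measurable_punctured_ball.
pose m2 : {measure set V -> \bar R} := mscale (NngNum (ler0n R d)) m1.
exists (measure_function_pushforward__canonical__measure_function_Measure
  m2 measurable_normalize) => A mA.
have mB : measurable (normalize @^-1` A).
  by rewrite -[X in measurable X]setTI; exact: measurable_normalize.
rewrite surface_measure_def mE; last first.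
  exact: measurableI measurable_punctured_ball mB.
by rewrite /= /pushforward /mscale/= /mrestr setIC.
Qed.

Definition sphere_measure : {measure set V -> \bar R} :=
  sval (cid sphere_measure_exists).

Lemma surface_measureE A : measurable A -> surface_measure A = sphere_measure A.
Proof. exact: (svalP (cid sphere_measure_exists)). Qed.

Lemma integral_surface D f :
  integral (@surface_measure R d) D f = (\int[sphere_measure]_(x in D) f x)%E.
Proof. by apply: eq_setfun_integral => A; exact: surface_measureE. Qed.

Lemma measurable_dotl (k : 'rV[R]_d) :
  measurable_fun setT (fun s : V => dot (s : 'rV[R]_d) k).
Proof. by apply: (@measurable_dot R d _ V id (cst k)). Qed.

Lemma measurable_dot_preimage (k : 'rV[R]_d) (I : set R) : measurable I ->
  measurable [set s : V | I (dot (s : 'rV[R]_d) k)].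
Proof.
move=> mI; have := measurable_dotl k measurableT mI.
by rewrite setTI.
Qed.

(** The polar cap of directions at angle at most [arcsin r] from [k]. *)
Definition cap (k : 'rV[R]_d) (r : R) : set V :=
  [set s | 0 <= dot (s : 'rV[R]_d) k /\ 1 - dot (s : 'rV[R]_d) k ^+ 2 <= r ^+ 2].

Lemma measurable_cap k r : measurable (cap k r).
Proof.
have -> : cap k r = [set s : V | [set x : R | 0 <= x /\ 1 - x ^+ 2 <= r ^+ 2]
    (dot (s : 'rV[R]_d) k)] by [].
apply: measurable_dot_preimage.
have -> : [set x : R | 0 <= x /\ 1 - x ^+ 2 <= r ^+ 2] =
    `[0, +oo[%classic `&` ((fun x => 1 - x ^+ 2) @^-1` `]-oo, r ^+ 2]%classic).
  by apply/seteqP; split => x /=; rewrite !in_itv/= ?andbT.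
apply: measurableI => //; rewrite -[X in measurable X]setTI.
by apply: measurable_funB => //; apply: measurable_funX.
Qed.

(** The cone over a cap of radius [r] lies in a tube of radius [r] and length
    [1], hence in about [1/r] cubes of side [4r]. *)
Lemma cone_cover (k x : 'rV[R]_d) (n : nat) : enorm k = 1 ->
  punctured_ball x -> cap k (2^-1 ^+ n) (normalize x) ->
  exists2 j, (j < (2 ^ n).+1)%N &
    cube ((j%:R * 2^-1 ^+ n) *: k) (2 * 2^-1 ^+ n) x.
Proof.
move=> k1 /= /andP[x0 x1] [/=]; rewrite /normalize.
set r : R := 2^-1 ^+ n; set l := enorm x in x0 x1 *.
have r0 : 0 < r by rewrite exprn_gt0.
have rn : (2 ^ n)%:R * r = 1 by rewrite natrX /r exprVn divff// expf_neq0.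
rewrite dotZl => y0 yr.
(* [t] is the abscissa of [x] along the axis, and [j] its integer part in units
   of [r]. *)
set t := dot x k; have t0 : 0 <= t by rewrite pmulr_rge0 ?invr_gt0 in y0.
have tl : t <= l.
  by rewrite (le_trans (ler_norm _))// (le_trans (dot_le _ _))// k1 mulr1.
have perp : dot (x - t *: k) (x - t *: k) <= r ^+ 2.
  have -> : dot (x - t *: k) (x - t *: k) = l ^+ 2 - t ^+ 2.
    rewrite !dotE (dotC k x) -!enorm_sqr k1 -/t -/l; ring.
  have -> : l ^+ 2 - t ^+ 2 = l ^+ 2 * (1 - (l^-1 * t) ^+ 2).
    by field; rewrite gt_eqF.
  apply: le_trans (_ : l ^+ 2 * r ^+ 2 <= _); first by rewrite ler_wpM2l ?sqr_ge0.
  by rewrite ler_piMl ?sqr_ge0// expr_le1// ltW.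
have tr : 0 <= t / r by rewrite divr_ge0// ltW.
have /andP[j1 j2] := Num.Theory.truncn_itv tr.
set j := Num.truncn _ in j1 j2.
have jt : `|t - j%:R * r| <= r.
  have h1 : j%:R * r <= t by rewrite -ler_pdivlMr.
  have h2 : t < j.+1%:R * r by rewrite -ltr_pdivrMr.
  rewrite -natr1 mulrDl mul1r in h2.
  by rewrite ger0_norm ?subr_ge0//; lra.
exists j.
  rewrite ltnS -(ler_nat R) (le_trans j1)// ler_pdivrMr// rn.
  exact: le_trans tl x1.
move=> i; apply: le_trans (_ : enorm (x - (j%:R * r) *: k) <= _).
  apply: le_trans (le_coord_enorm (x - (j%:R * r) *: k) i).
  by rewrite !mxE.
have -> : x - (j%:R * r) *: k = (x - t *: k) + (t - j%:R * r) *: k.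
  by rewrite scalerBl addrA subrK.
apply: le_trans (enormD _ _) _; rewrite mulr2n mulrDl mul1r lerD//.
  rewrite -(ger0_norm (ltW r0)) -sqrtr_sqr /enorm ler_wsqrtr//.
by rewrite enormZ k1 mulr1.
Qed.

Definition cap_constant : R := d%:R * 2 * 4 ^+ d.

Lemma cap_measure (k : 'rV[R]_d) (n : nat) : enorm k = 1 -> (0 < d)%N ->
  (sphere_measure (cap k (2^-1 ^+ n)) <=
     (cap_constant * (2^-1 ^+ n) ^+ (d - 1))%:E)%E.
Proof.
move=> k1 d0; set r : R := 2^-1 ^+ n.
have r0 : 0 < r by rewrite exprn_gt0.
have rn : (2 ^ n)%:R * r = 1 by rewrite natrX /r exprVn divff// expf_neq0.
have [m mE] := @lebesgue_vec_measure R d.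
rewrite -surface_measureE; last exact: measurable_cap.
rewrite surface_measure_def mE; last first.
  apply: measurableI; first exact: measurable_punctured_ball.
  rewrite -[X in measurable X]setTI; apply: measurable_normalize => //.
  exact: measurable_cap.
pose F j := cube ((j%:R * r) *: k) (2 * r).
have mF j : measurable (F j) by exact: measurable_cube.
have mI : measurable (punctured_ball `&` normalize @^-1` cap k r).
  apply: measurableI; first exact: measurable_punctured_ball.
  rewrite -[X in measurable X]setTI; apply: measurable_normalize => //.
  exact: measurable_cap.
have le1 : (m (punctured_ball `&` normalize @^-1` cap k r) <=
    m (\big[setU/set0]_(j < (2 ^ n).+1) F j))%E.
  apply: le_measure; rewrite ?inE//; first exact: bigsetU_measurable.
  move=> x [xb xc]; rewrite -bigcup_mkord.
  by have [j jn jx] := cone_cover k1 xb xc; exists j.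
have le2 := Boole_inequality m (fun i (_ : (i < (2 ^ n).+1)%N) => mF i).
have le3 : (\sum_(j < (2 ^ n).+1) m (F j) = ((2 ^ n).+1%:R * (2 * (2 * r)) ^+ d)%:E)%E.
  rewrite (eq_bigr (fun=> ((2 * (2 * r)) ^+ d)%:E)); last first.
    by move=> j _; rewrite -mE// lebesgue_cube// mulr_ge0// ltW.
  by rewrite sumEFin big_const_ord iter_addr addr0 (mulr_natl ((2 * (2 * r)) ^+ d)).
apply: le_trans (_ : (d%:R%:E * ((2 ^ n).+1%:R * (2 * (2 * r)) ^+ d)%:E <= _)%E).
  rewrite lee_wpmul2l// -le3; exact: le_trans le1 le2.
rewrite -EFinM lee_fin /cap_constant.
have -> : 2 * (2 * r) = 4 * r by ring.
have rd : r ^+ d = r ^+ (d - 1) * r.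
  by have {1}-> : d = (d - 1).+1; rewrite ?exprSr// subn1 prednK.
rewrite exprMn rd.
have c1 : (2 ^ n).+1%:R * r <= 2.
  rewrite -natr1 mulrDl rn mul1r.
  have : r <= 1 by rewrite /r exprn_ile1//; lra.
  lra.
have -> : d%:R * ((2 ^ n).+1%:R * (4 ^+ d * (r ^+ (d - 1) * r))) =
  (d%:R * 4 ^+ d * r ^+ (d - 1)) * ((2 ^ n).+1%:R * r) by ring.
have -> : d%:R * 2 * 4 ^+ d * r ^+ (d - 1) =
   (d%:R * 4 ^+ d * r ^+ (d - 1)) * 2 by ring.
by rewrite ler_wpM2l// !mulr_ge0// ?exprn_ge0// ltW.
Qed.

Definition annulus (k : 'rV[R]_d) (x1 x2 : R) : set V :=
  [set s | x1 < dot (s : 'rV[R]_d) k < x2].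

Lemma measurable_annulus k x1 x2 : measurable (annulus k x1 x2).
Proof.
have -> : annulus k x1 x2 = [set s : V | `]x1, x2[%classic (dot (s : 'rV[R]_d) k)].
  by apply/seteqP; split => x /=; rewrite in_itv.
by apply: measurable_dot_preimage.
Qed.

Lemma unit_normal_exists (k : 'rV[R]_d) : (1 < d)%N ->
  exists2 e : 'rV[R]_d, enorm e = 1 & dot e k = 0.
Proof.
move=> d1; pose i0 := Ordinal (ltnW d1); pose i1 := Ordinal d1.
have i01 : i0 != i1 by [].
pose e : 'rV[R]_d := if (k 0 i0 == 0) && (k 0 i1 == 0) then delta_mx 0 i0
  else k 0 i1 *: delta_mx 0 i0 - k 0 i0 *: delta_mx 0 i1.
have dotd i u : dot (delta_mx 0 i : 'rV[R]_d) u = u 0 i.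
  rewrite /dot (bigD1 i)//= mxE !eqxx mul1r big1 ?addr0// => j ji.
  by rewrite mxE (negbTE ji) andbF mul0r.
have ek : dot e k = 0.
  rewrite /e; case: ifPn => [/andP[/eqP h _]|_]; first by rewrite dotd h.
  by rewrite !dotE !dotd mulrC subrr.
have e0 : e != 0.
  rewrite /e; case: ifPn => [_|H].
    apply/eqP => /rowP /(_ i0); rewrite !mxE !eqxx => /eqP; by rewrite oner_eq0.
  apply: contra H => /eqP /rowP H.
  have := H i0; rewrite !mxE !eqxx (negbTE i01) /= mulr1 mulr0 subr0 => ->.
  have := H i1; rewrite !mxE !eqxx eq_sym (negbTE i01) /= mulr1 mulr0 sub0r.
  by move/eqP; rewrite oppr_eq0 => ->.
exists ((enorm e)^-1 *: e); last by rewrite dotZl ek mulr0.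
by rewrite enormZ ger0_norm ?invr_ge0 ?enorm_ge0// mulVf// gt_eqF// enorm_gt0.
Qed.

(** A band of directions has a measure bounded below uniformly in its axis:
    the cone over it contains a cube whose size depends on the band only. *)
Lemma annulus_measure (x1 x2 : R) : (1 < d)%N -> 0 < x1 -> x1 < x2 -> x2 < 1 ->
  exists2 c : R, 0 < c & forall k : 'rV[R]_d, enorm k = 1 ->
    (c%:E <= sphere_measure (sphere (d := d) `&` annulus k x1 x2))%E.
Proof.
move=> d1 x10 x12 x21; have d0 : (0 < d%:R :> R) by rewrite ltr0n ltnW.
pose x := (x1 + x2) / 2; pose h := (x2 - x1) / 4.
have h0 : 0 < h by rewrite /h; lra.
have x01 : 0 < x < 1 by rewrite /x; apply/andP; split; lra.
pose r := (h / 4) / d%:R.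
have r0 : 0 < r by rewrite /r divr_gt0// divr_gt0.
exists (d%:R * (2 * r) ^+ d); first by rewrite mulr_gt0// exprn_gt0// mulr_gt0.
move=> k k1; have [e e1 ek] := unit_normal_exists k d1.
(* The centre of the cube lies halfway to the sphere, in the middle of the band. *)
pose z := 2^-1 *: (x *: k + Num.sqrt (1 - x ^+ 2) *: e).
have x2' : 0 <= 1 - x ^+ 2.
  by have /andP[? ?] := x01; rewrite subr_ge0 expr_le1// ltW.
have zn : enorm z = 2^-1.
  rewrite enormZ ger0_norm// -[RHS]mulr1; congr (_ * _).
  rewrite /enorm !dotE (dotC k e) ek -!enorm_sqr k1 e1.
  rewrite -[RHS](sqrtr1 R); congr Num.sqrt.
  by have := sqr_sqrtr x2'; rewrite !expr1n; lra.
have zk : dot z k = x / 2.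
  by rewrite /z !dotE ek -enorm_sqr k1; field.
have near (y : 'rV[R]_d) : cube z r y -> enorm (y - z) <= h / 4.
  move=> yz; apply: le_trans (@enorm_le_coord _ _ _ r (ltW r0) _) _.
    by move=> i; have := yz i; rewrite [(y - z) 0 i]mxE [(- z) 0 i]mxE.
  by rewrite /r mulrC divfK// gt_eqF.
have mS : measurable (sphere (d := d) `&` annulus k x1 x2).
  by apply: measurableI; [exact: measurable_sphere|exact: measurable_annulus].
have [m mE] := @lebesgue_vec_measure R d.
rewrite -surface_measureE// surface_measure_def.
have mI : measurable (punctured_ball `&`
    normalize @^-1` (sphere (d := d) `&` annulus k x1 x2)).
  apply: measurableI; first exact: measurable_punctured_ball.
  by rewrite -[X in measurable X]setTI; exact: measurable_normalize.
rewrite EFinM lee_wpmul2l ?lee_fin//.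
rewrite -(lebesgue_cube z (ltW r0)) !mE//; last exact: measurable_cube.
apply: le_measure; rewrite ?inE//; first exact: measurable_cube.
move=> y /near yz.
have y1 := enormB y z; rewrite zn in y1.
have {}y1 := le_trans y1 yz.
have h1 : h < 4^-1 by rewrite /h; lra.
rewrite ler_norml in y1; have /andP[ya yb] := y1.
have y0 : 0 < enorm (y : 'rV[R]_d) by lra.
have yk : `|dot (y - z) k| <= h / 4.
  by apply: le_trans (dot_le _ _) _; rewrite k1 mulr1.
have dyk : dot y k = x / 2 + dot (y - z) k by rewrite dotDl dotNl zk; ring.
rewrite ler_norml in yk; have /andP[yk1 yk2] := yk.
have xh1 : x1 = x - 2 * h by rewrite /x /h; field.
have xh2 : x2 = x + 2 * h by rewrite /x /h; field.
have /andP[xx0 xx1] := x01.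
split; first by rewrite /punctured_ball /= y0; lra.
split; rewrite /= /normalize.
  by rewrite /sphere/= enormZ ger0_norm ?invr_ge0 ?enorm_ge0// mulVf// gt_eqF.
rewrite /annulus/= dotZl mulrC ltr_pdivlMr// ltr_pdivrMr// dyk; apply/andP; split; nra.
Qed.

End SphereMeasure.

(** * The angular profile *)

Section AngularProfile.
Variable R : realType.
Implicit Types (x y nu theta : R) (b : R -> R).

Lemma sin_le_id theta : 0 <= theta -> sin theta <= theta.
Proof.
move=> t0.
have der y : y \in `]0, theta[ -> is_derive y 1 (@sin R) (cos y).
  by move=> _; exact: is_derive_sin.
have cont : {within `[0, theta], continuous (@sin R)}.
  apply: derivable_within_continuous => y _.
  by have [] := is_derive_sin y.
have [c _] := MVT_segment t0 der cont.
by rewrite sin0 !subr0 => ->; rewrite ler_piMl// cos_le1.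
Qed.

Lemma acos_itv01 x : 0 <= x < 1 -> acos x \in `[0, pi].
Proof.
move=> /andP[x0 x1].
by rewrite in_itv/= acos_ge0 ?acos_lepi//; apply/andP; split; lra.
Qed.

Lemma ltr_acos x y : 0 <= x < 1 -> 0 <= y < 1 -> (acos x < acos y) = (y < x).
Proof.
move=> x01 y01; rewrite -ltr_cos ?acos_itv01//.
have /andP[x0 x1] := x01; have /andP[y0 y1] := y01.
by rewrite !acosK// in_itv/=; apply/andP; split; lra.
Qed.

Lemma powR_le_neg x y nu : nu <= 0 -> 0 < x -> x <= y -> y `^ nu <= x `^ nu.
Proof.
move=> nu0 x0 xy; have y0 := lt_le_trans x0 xy.
rewrite -(opprK nu) powRN (powRN x) lef_pV2 ?posrE ?powR_gt0//.
by apply: le_powR2 => //; [rewrite oppr_ge0|exact: ltW].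
Qed.

Lemma profile_equiv nu b : angular_profile nu b ->
  exists2 e : R, 0 < e < pi / 2 & forall theta, 0 < theta < e ->
    2^-1 * theta `^ (-1 - nu) <= b (cos theta) <= 2 * theta `^ (-1 - nu).
Proof.
move=> [_ _ _ /eqaddoP /(_ 2^-1)]; rewrite invr_gt0 ltr0n => /(_ erefl).
rewrite /at_right => /nbhs_ballP[e /= e0 H].
have pi2 : 0 < (pi : R) / 4 by rewrite divr_gt0// pi_gt0.
exists (Num.min e (pi / 4)).
  rewrite lt_min e0 pi2/= gt_min; apply/orP; right.
  by have := pi_gt0 R; lra.
move=> t /andP[t0]; rewrite lt_min => /andP[te _].
have := H t; rewrite /ball/= sub0r normrN gtr0_norm// => /(_ te t0).
rewrite [`|t `^ _|]ger0_norm ?powR_ge0// ler_norml !fctE => /andP[h1 h2].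
by apply/andP; split; lra.
Qed.

(** For small angles this is the equivalent at the grazing direction, since
    [sin theta <= theta]; for the other angles a convex function is at most the
    larger of its values at the end points of an interval. *)
Lemma profile_le nu b : 0 <= nu -> angular_profile nu b ->
  exists2 C : R, 0 < C & forall x, 0 <= x < 1 ->
    b x <= C * Num.sqrt (1 - x ^+ 2) `^ (-1 - nu).
Proof.
move=> nu0 hb; have [e /andP[e0 epi] H] := profile_equiv hb.
have [b0 _ bc _] := hb.
have pi0 := pi_gt0 R.
pose e' := e / 2; have e'0 : 0 < e' by rewrite /e'; lra.
have ce0 : 0 < cos e' by apply: cos_gt0_pihalf; rewrite /e'; apply/andP; split; lra.
have ce1 : cos e' < 1.
  rewrite -(@cos0 R) ltr_cos// in_itv/= ?lexx ?(ltW pi0)// /e'.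
  by apply/andP; split; lra.
have bz : 0 <= b 0 by apply: b0; apply/andP; split; lra.
have be : 0 <= b (cos e') by apply: b0; apply/andP; split; lra.
exists (2 + b 0 + b (cos e')); first by lra.
move=> x /andP[x0 x1]; have x01 : 0 <= x < 1 by rewrite x0.
set S := Num.sqrt _; have S1 : S <= 1.
  by rewrite /S -[leRHS]sqrtr1 ler_wsqrtr// gerBl sqr_ge0.
have S0 : 0 < S by rewrite sqrtr_gt0 subr_gt0 expr_lt1.
have P1 : 1 <= S `^ (-1 - nu).
  rewrite -[leLHS](powRr0 S); apply: ger_powR; rewrite ?S0//; lra.
have [xe|xe] := leP x (cos e').
  have t01 : 0 <= x / cos e' <= 1.
    by rewrite divr_ge0// ?ler_pdivrMr ?mul1r ?(ltW ce0).
  have D0 : `[0, 1[%classic (0 : R) by rewrite /= in_itv/= lexx ltr01.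
  have D1 : `[0, 1[%classic (cos e') by rewrite /= in_itv/= (ltW ce0) ce1.
  have := convex_functionE bc D0 D1 t01.
  rewrite mulr0 add0r divfK ?gt_eqF// => bx.
  have /andP[t0 t1] := t01; nra.
set t := acos x.
have t0 : 0 < t by apply: acos_gt0; rewrite x1 andbT; lra.
have te' : t < e'.
  rewrite /t -[e']cosK; last by rewrite in_itv/= (ltW e'0)/= /e'; lra.
  by rewrite ltr_acos// ?(ltW ce0).
have te : 0 < t < e by rewrite t0/=; apply: lt_trans te' _; rewrite /e'; lra.
have cx : cos t = x by rewrite /t acosK// in_itv/=; apply/andP; split; lra.
have St : S <= t.
  rewrite /S -sin_acos; last by apply/andP; split; lra.
  exact: sin_le_id (ltW t0).
have /andP[_] := H t te; rewrite cx => /le_trans; apply.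
have : t `^ (-1 - nu) <= S `^ (-1 - nu) by apply: powR_le_neg => //; lra.
nra.
Qed.

Lemma profile_ge nu b : 0 <= nu -> angular_profile nu b ->
  exists x1 x2 b0 : R, [/\ 0 < x1, x1 < x2, x2 < 1, 0 < b0 &
    forall x, x1 < x < x2 -> b0 <= b x].
Proof.
move=> nu0 hb; have [e /andP[e0 epi] H] := profile_equiv hb.
have pi0 := pi_gt0 R.
have i1 : e \in `[0, pi] by rewrite in_itv/= (ltW e0)/=; lra.
have i2 : e / 2 \in `[0, pi] by rewrite in_itv/=; apply/andP; split; lra.
exists (cos e), (cos (e / 2)), (2^-1 * e `^ (-1 - nu)).
have ce0 : 0 < cos e by apply: cos_gt0_pihalf; apply/andP; split; lra.
have ce1 : cos (e / 2) < 1.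
  by rewrite -[ltRHS](@cos0 R) ltr_cos// ?in_itv/= ?lexx ?(ltW pi0)//; lra.
have ce2 : cos e < cos (e / 2) by rewrite ltr_cos//; lra.
split => //; first by rewrite mulr_gt0// powR_gt0.
move=> x /andP[x1 x2]; set t := acos x.
have x01 : 0 <= x < 1 by apply/andP; split; lra.
have t0 : 0 < t by apply: acos_gt0; apply/andP; split; lra.
have te : t < e.
  by rewrite /t -[e]cosK// ltr_acos// (ltW ce0)/=; lra.
have cx : cos t = x by rewrite /t acosK// in_itv/=; apply/andP; split; lra.
have /andP[+ _] := H t (introT andP (conj t0 te)).
rewrite cx; apply: le_trans; rewrite ler_wpM2l//.
by apply: powR_le_neg => //; [lra|exact: ltW].
Qed.

(** Sublevel sets of a convex function are intervals. *)
Lemma measurable_profile nu b : angular_profile nu b ->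
  measurable_fun (`[0, 1[%classic : set R) b.
Proof.
move=> [_ _ bc _].
apply: (@measurability _ _ R R _ b _ (RGenInftyO.measurableE R)).
move=> _ [_ [a ->] <-]; apply: is_interval_measurable => x y /= [] xD.
rewrite in_itv/= => xa [yD]; rewrite in_itv/= => ya z /andP[xz zy].
have [xy|xy] := eqVneq x y.
  have -> : z = x by apply: le_anti; rewrite xz xy zy.
  by split => //; rewrite in_itv.
have xy' : x < y by rewrite lt_neqAle xy (le_trans xz).
have t01 : 0 <= (z - x) / (y - x) <= 1.
  by rewrite divr_ge0 ?subr_ge0 ?(ltW xy')//= ler_pdivrMr ?subr_gt0// mul1r lerD2r.
have := convex_functionE bc xD yD t01.
have -> : (1 - (z - x) / (y - x)) * x + (z - x) / (y - x) * y = z.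
  by field; rewrite subr_eq0 eq_sym.
move=> bz; split.
  move: xD yD; rewrite /= !in_itv/= => /andP[h1 h2] /andP[h3 h4].
  by apply/andP; split; lra.
rewrite in_itv/=; apply: le_lt_trans bz _.
have /andP[t0 t1] := t01; set t := _ / _ in t0 t1 *.
have [ma mx my] : [/\ Num.max (b x) (b y) < a, b x <= Num.max (b x) (b y) &
    b y <= Num.max (b x) (b y)] by rewrite gt_max xa ya !le_max !lexx orbT.
nra.
Qed.

(** The angular factor of the kernel as a function of the cosine of the deviation
    angle, cleaned of the values of [b] outside [0, 1[, which the kernel only
    meets at the poles or at deviations larger than a right angle. *)
Definition weight (d : nat) b theta0 x : R :=
  if (0 <= x < 1) && (theta0 < acos x)
  then (Num.sqrt (1 - x ^+ 2)) ^- (d - 2) * b x else 0.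

Lemma weight_ge0 d nu b theta0 x : angular_profile nu b ->
  0 <= weight d b theta0 x.
Proof.
move=> [b0 _ _ _]; rewrite /weight; case: ifPn => // /andP[/andP[x0 x1] _].
by rewrite mulr_ge0 ?b0 ?invr_ge0 ?exprn_ge0 ?sqrtr_ge0//; apply/andP; split; lra.
Qed.

Lemma measurable_weight d nu b theta0 : angular_profile nu b ->
  measurable_fun setT (weight d b theta0).
Proof.
move=> hb; pose I : set R := [set x | 0 <= x < 1 /\ theta0 < acos x].
have mI : measurable I.
  apply: is_interval_measurable => x y /= [x01 xt] [y01 yt] z /andP[xz zy].
  have /andP[x0 x1] := x01; have /andP[y0 y1] := y01.
  have z01 : 0 <= z < 1 by apply/andP; split; lra.
  split => //; apply: lt_le_trans yt _; rewrite leNgt ltr_acos//.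
  by rewrite -leNgt.
pose f x := (Num.sqrt (1 - x ^+ 2)) ^- (d - 2) * b x.
have mf : measurable_fun I f.
  apply: measurable_funM.
    apply: measurable_funTS.
    apply: (@eq_measurable_fun _ _ _ _ setT
      (fun x => (Num.sqrt (1 - x ^+ 2) ^+ (d - 2)) `^ (-1))).
      by move=> x _; rewrite powR_inv1// exprn_ge0// sqrtr_ge0.
    apply: measurableT_comp (measurable_powR _) _.
    apply: measurable_funX; apply: measurableT_comp.
      exact: continuous_measurable_fun (@sqrt_continuous R).
    by apply: measurable_funB => //; exact: measurable_funX.
  apply: measurable_funS (measurable_itv _) _ (measurable_profile hb).
  by move=> x [x01 _]; rewrite /= in_itv.
have /measurable_restrictT := mf => /(_ mI).
apply: eq_measurable_fun => x _; rewrite patchE /weight.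
have [|] := boolP (x \in I).
  by rewrite inE => -[-> ->].
rewrite notin_setE /= => H; case: ifPn => // /andP[h1 h2].
by exfalso; exact: H.
Qed.

Lemma weight_le d nu b theta0 C x : (2 <= d)%N -> angular_profile nu b ->
  (forall x, 0 <= x < 1 -> b x <= C * Num.sqrt (1 - x ^+ 2) `^ (-1 - nu)) ->
  0 <= x < 1 ->
  Num.sqrt (1 - x ^+ 2) * weight d b theta0 x
  <= C * Num.sqrt (1 - x ^+ 2) `^ (2 - d%:R - nu).
Proof.
move=> d2 [b0 _ _ _] H x01; have bx := H x x01.
have /andP[x0 x1] := x01.
have bp : 0 <= b x by apply: b0; apply/andP; split; lra.
set S := Num.sqrt _ in bx *.
have S0 : 0 < S by rewrite sqrtr_gt0 subr_gt0 expr_lt1.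
have C0 : 0 <= C.
  by have := le_trans bp bx; rewrite pmulr_lge0// powR_gt0.
rewrite /weight x01/=; case: ifPn => _; last first.
  by rewrite mulr0 mulr_ge0// powR_ge0.
have Sd : S * S ^- (d - 2) * S `^ (-1 - nu) = S `^ (2 - d%:R - nu).
  rewrite -{1}(powRr1 (ltW S0)) -powR_mulrn ?(ltW S0)// -powRN.
  have SD u v : S `^ u * S `^ v = S `^ (u + v).
    by rewrite powRD// (gt_eqF S0) implybT.
  rewrite !SD; by congr (_ `^ _); rewrite natrB//; ring.
rewrite -Sd mulrA.
set P := S * S ^- (d - 2); have -> : C * (P * S `^ (-1 - nu)) =
  P * (C * S `^ (-1 - nu)) by ring.
by rewrite ler_wpM2l// mulr_ge0 ?invr_ge0 ?exprn_ge0// ltW.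
Qed.

Lemma kernel_cutE d gamma nu b theta0 (z s : 'rV[R]_d) : (3 <= d)%N ->
  angular_profile nu b -> z != 0 -> enorm s = 1 ->
  kernel_cut gamma b theta0 z s = enorm z `^ gamma * weight d b theta0 (cosd z s).
Proof.
move=> d3 [_ bneg _ _] z0 s1; rewrite /kernel_cut /kernel_B /deviation_angle.
rewrite -/(cosd z s) /weight.
have /andP[x0 x1] := cosd_itv z s1; set x := cosd z s in x0 x1 *.
case: ifPn => [tx|_]; last by rewrite andbF mulr0.
have xi : x \in `[-1, 1] by rewrite in_itv/= x0.
rewrite andbT acosK// sin_acos ?x0// -mulrA; congr (_ * _).
have d2 : (0 < d - 2)%N by rewrite subn_gt0.
have [x00|x00] := leP 0 x; last first.
  have [->|xn] := eqVneq x (-1); last by rewrite bneg ?mulr0// x00 lt_neqAle eq_sym xn x0.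
  by rewrite sqrrN expr1n subrr sqrtr0 expr0n gtn_eqF// invr0 mul0r.
have [//|x11] := ltP x 1.
have -> : x = 1 by apply: le_anti; rewrite x1 x11.
by rewrite expr1n subrr sqrtr0 expr0n gtn_eqF// invr0 mul0r.
Qed.

Lemma kernel_B_cut d gamma b (z s : 'rV[R]_d) : enorm s = 1 ->
  kernel_B gamma b z s = kernel_cut gamma b (-1) z s.
Proof.
move=> s1; rewrite /kernel_cut ifT// (lt_le_trans (_ : _ < 0))//.
exact/acos_ge0/cosd_itv.
Qed.

End AngularProfile.

(** * Grazing moments of the collision kernels *)

Section GrazingIntegral.
Variables (R : realType) (d : nat).
Local Notation V := (vec R d).

Lemma geometric_nneseries_le (a q : R) : 0 <= a -> 0 <= q < 1 ->
  (\sum_(0 <= n <oo) (a * q ^+ n)%:E <= (a / (1 - q))%:E)%E.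
Proof.
move=> a0 /andP[q0 q1]; apply: lime_le.
  by apply: is_cvg_nneseries => n _ _; rewrite lee_fin mulr_ge0// exprn_ge0.
apply: nearW => n; rewrite sumEFin lee_fin.
have := geometric_seriesE a (negbT (lt_eqF q1)) => /(congr1 (@^~ n)).
rewrite /series/= => ->; rewrite ler_wpM2r ?invr_ge0 ?subr_ge0 ?(ltW q1)//.
by rewrite ler_piMr// gerBl exprn_ge0.
Qed.

Lemma dyadic_scale (S : R) : 0 < S <= 1 ->
  exists n : nat, 2^-1 ^+ n.+1 < S <= 2^-1 ^+ n.
Proof.
move=> /andP[S0 S1].
have H : exists n : nat, 2^-1 ^+ n < S.
  have h1 : `|2^-1 : R| < 1 by rewrite ger0_norm//; lra.
  have := @cvg_geometric R 1 2^-1 h1 => /cvgrPdist_lt /(_ S S0) [N _ /(_ N (leqnn N))].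
  rewrite /geometric/= mul1r sub0r normrN ger0_norm ?exprn_ge0// => ?.
  by exists N.
pose n := ex_minn H; have : n = ex_minn H by [].
case: ex_minnP => m hm mmin nm.
case: m hm mmin nm => [|m] hm mmin nm.
  by move: hm; rewrite expr0 ltNge S1.
exists m; rewrite hm/= leNgt; apply/negP => h.
by have := mmin _ h; rewrite ltnn.
Qed.

(** Caps of radius [2^-n] have measure of order [2^(-n(d-1))], which beats the
    singularity [S^(2-d-nu)] with a margin [2^(-n(1-nu))]: this is where
    [nu < 1] is used. *)
Lemma grazing_integral (nu C : R) : (3 <= d)%N -> 0 <= nu < 1 -> 0 < C ->
  exists2 kappa : R, 0 < kappa &
  forall w : R -> R, measurable_fun setT w -> (forall x, 0 <= w x) ->
  (forall x, ~~ (0 <= x < 1) -> w x = 0) ->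
  (forall x, 0 <= x < 1 -> Num.sqrt (1 - x ^+ 2) * w x
     <= C * Num.sqrt (1 - x ^+ 2) `^ (2 - d%:R - nu)) ->
  forall k : 'rV[R]_d, enorm k = 1 ->
  (\int[sphere_measure R d]_(s in @sphere R d)
     (Num.sqrt (1 - dot (s : 'rV[R]_d) k ^+ 2) * w (dot (s : 'rV[R]_d) k))%:E
   <= kappa%:E)%E.
Proof.
move=> d3 /andP[nu0 nu1] C0.
have d0 : (0 < d)%N by apply: leq_trans d3.
pose h : R := 2^-1; have h0 : 0 < h by rewrite /h; lra.
pose e : R := 2 - d%:R - nu.
have d3R : (3 : R) <= d%:R by rewrite ler_nat.
have e0 : e <= 0 by rewrite /e; lra.
pose q : R := h `^ (1 - nu).
have q0 : 0 < q by rewrite powR_gt0.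
have q1 : q < 1.
  have p1 : 1 `^ (1 - nu) = 1 :> R by rewrite powR1.
  rewrite /q -[ltRHS]p1; apply: gt0_ltr_powR.
  - by rewrite subr_gt0.
  - by rewrite nnegrE ltW.
  - by rewrite nnegrE.
  - by rewrite /h; lra.
pose a : R := C * h `^ e * cap_constant R d.
have a0 : 0 < a.
  rewrite /a !mulr_gt0 ?powR_gt0// ?ltr0n// exprn_gt0//.
exists (a / (1 - q)); first by rewrite divr_gt0// subr_gt0.
move=> w mw w0 wsupp wle k k1.
(* [c n] bounds the integrand on the [n]-th dyadic shell, where the sine lies
   between [h ^+ n.+1] and [h ^+ n]. *)
pose c n : R := C * (h ^+ n.+1) `^ e.
have c0 n : 0 <= c n by rewrite mulr_ge0 ?powR_ge0// ltW.
have hn n : 0 < h ^+ n by rewrite exprn_gt0.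
pose f (s : V) : R := Num.sqrt (1 - dot (s : 'rV[R]_d) k ^+ 2) * w (dot (s : 'rV[R]_d) k).
have mf : measurable_fun setT f.
  apply: measurable_funM.
    apply: measurableT_comp.
      exact: continuous_measurable_fun (@sqrt_continuous R).
    apply: measurable_funB => //; apply: measurable_funX.
    exact: measurable_dotl.
  by apply: measurableT_comp mw _; exact: measurable_dotl.
pose g n (s : V) : \bar R := (c n * \1_(cap k (h ^+ n)) s)%:E.
have mg n : measurable_fun (@sphere R d) (g n).
  apply/measurable_EFinP; apply: measurable_funM => //.
  by apply: measurable_indic; exact: measurable_cap.
have g0 n s : (0 <= g n s)%E by rewrite lee_fin mulr_ge0// indicE.
have mS := @measurable_sphere R d.
apply: (@le_trans _ _ (\int[sphere_measure R d]_(s in @sphere R d)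
    (\sum_(0 <= n <oo) g n s))%E).
  apply: ge0_le_integral => //.
  - by move=> s _; rewrite lee_fin mulr_ge0// sqrtr_ge0.
  - by apply/measurable_EFinP; exact: measurable_funS (measurableT) _ mf.
  - by apply: ge0_emeasurable_sum => //.
  move=> s s1; set x := dot s k.
  have [x01|xn] := boolP (0 <= x < 1); last first.
    by rewrite wsupp// mulr0 nneseries_ge0.
  have /andP[x0 x1] := x01.
  set S := Num.sqrt (1 - x ^+ 2).
  have S0 : 0 < S by rewrite sqrtr_gt0 subr_gt0 expr_lt1.
  have S1 : S <= 1 by rewrite /S -[leRHS]sqrtr1 ler_wsqrtr// gerBl sqr_ge0.
  have [n /andP[n1 n2]] : exists n, h ^+ n.+1 < S <= h ^+ n.
    by apply: dyadic_scale; rewrite S0.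
  have gn : (g n s <= \sum_(0 <= n <oo) g n s)%E.
    by rewrite (nneseriesD1 (n := n))// leeDl// nneseries_ge0.
  apply: le_trans gn; rewrite /g lee_fin indicE mem_set ?mulr1; last first.
    split => //; rewrite -/x -(ler_sqrt (1 - x ^+ 2)) ?sqr_ge0// sqrtr_sqr.
    by rewrite ger0_norm// ltW.
  apply: le_trans (wle x x01) _; rewrite /c ler_wpM2l ?(ltW C0)//.
  by apply: powR_le_neg => //; exact: ltW.
rewrite integral_nneseries//.
apply: le_trans (geometric_nneseries_le (ltW a0) _); last by rewrite q1 ltW.
apply: lee_nneseries => [n _ _|n _]; first by apply: integral_ge0.
rewrite /g; under eq_integral do rewrite EFinM.
rewrite ge0_integralZl_EFin//; last first.
  by apply/measurable_EFinP; apply: measurable_indic; exact: measurable_cap.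
rewrite integral_indic//; last exact: measurable_cap.
apply: (@le_trans _ _ ((c n)%:E * (cap_constant R d * (h ^+ n) ^+ (d - 1))%:E)%E).
  rewrite lee_wpmul2l ?lee_fin//.
  apply: le_trans (cap_measure n k1 d0); apply: le_measure; rewrite ?inE//.
  - by apply: measurableI => //; exact: measurable_cap.
  - exact: measurable_cap.
rewrite -EFinM lee_fin /c /a.
have -> : (h ^+ n.+1) `^ e = h `^ e * (h ^+ n) `^ e.
  by rewrite exprS powRM// ltW.
have -> : q ^+ n = (h ^+ n) `^ e * (h ^+ n) ^+ (d - 1).
  rewrite -[(h ^+ n) ^+ (d - 1)]powR_mulrn ?(ltW (hn n))// -powRD; last first.
    by rewrite (gt_eqF (hn n)) implybT.
  have -> : e + (d - 1)%:R = 1 - nu by rewrite /e natrB//; ring.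
  by rewrite /q -(powR_mulrn n (powR_ge0 _ _)) -powRrM mulrC powRrM powR_mulrn// ltW.
by rewrite le_eqVlt; apply/orP; left; apply/eqP; ring.
Qed.

End GrazingIntegral.

Section CollisionKernel.
Variables (R : realType) (d : nat).
Local Notation V := (vec R d).

(** All that the dynamics needs to know of a kernel: it is carried by the
    deviations of at most a right angle, its first grazing moment is bounded
    and its second one is bounded below, uniformly in the relative velocity. *)
Definition collision_kernel (gamma kappa1 kappa2 : R)
    (B : 'rV[R]_d -> 'rV[R]_d -> R) : Prop :=
  [/\ forall z s, enorm s = 1 -> 0 <= B z s,
      forall z, z != 0 -> measurable_fun (@sphere R d) (B z : V -> R),
      forall z s, z != 0 -> enorm s = 1 -> cosd z s < 0 -> B z s = 0,
      forall z, z != 0 ->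
        (\int[sphere_measure R d]_(s in @sphere R d) (sind z s * B z s)%:E
          <= (kappa1 * enorm z `^ gamma)%:E)%E &
      forall z, z != 0 -> ((kappa2 * enorm z `^ gamma)%:E <=
        \int[sphere_measure R d]_(s in @sphere R d) (sind z s ^+ 2 * B z s)%:E)%E].

Lemma cosd_normalize (z s : 'rV[R]_d) : cosd z s = dot s ((enorm z)^-1 *: z).
Proof. by rewrite /cosd dotZr mulrC. Qed.

Lemma enorm_normalize (z : 'rV[R]_d) : z != 0 -> enorm ((enorm z)^-1 *: z) = 1.
Proof.
move=> z0; rewrite enormZ ger0_norm ?invr_ge0 ?enorm_ge0//.
by rewrite mulVf// gt_eqF// enorm_gt0.
Qed.

Lemma measurable_cosd (z : 'rV[R]_d) : measurable_fun setT (cosd z : V -> R).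
Proof. by apply: measurable_funM => //; exact: measurable_dotl. Qed.

Lemma measurable_sind (z : 'rV[R]_d) : measurable_fun setT (sind z : V -> R).
Proof.
apply: measurableT_comp.
  exact: continuous_measurable_fun (@sqrt_continuous R).
by apply: measurable_funB => //; apply: measurable_funX; exact: measurable_cosd.
Qed.

(** The upper bound is the grazing integral, which the cutoff only decreases. For
    the lower bound there are two cases. If the cutoff angle is small, the kernel
    is bounded below on a fixed band of directions. If it is not, all deviations
    are bounded away from zero, and the total rate is at least [|z|^gamma] because
    [K >= 1]. *)
Lemma kernel_bounds (gamma nu : R) (b : R -> R) : (3 <= d)%N -> 0 <= nu < 1 ->
  angular_profile nu b ->
  exists kappa1 kappa2 : R, [/\ 0 < kappa1, 0 < kappa2 &
    forall theta0,
      theta0 < 0 \/ (exists2 K, 1 <= K & cutoff_angle d gamma b K theta0) ->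
      collision_kernel gamma kappa1 kappa2 (kernel_cut gamma b theta0)].
Proof.
move=> d3 nu01 hb; have /andP[nu0 nu1] := nu01.
have d2 : (2 <= d)%N by exact: ltnW.
have [C C0 bC] := profile_le nu0 hb.
have [kappa1 k10 Hup] := grazing_integral d3 nu01 C0.
have [x1 [x2 [b0 [x10 x12 x21 b00 bb]]]] := profile_ge nu0 hb.
have [c c0 Hlow] := annulus_measure d2 x10 x12 x21.
have x20 : 0 < x2 by exact: lt_trans x12.
have m0 : 0 < 1 - x2 ^+ 2 by rewrite subr_gt0 expr_lt1// ltW.
have x2i : 0 <= x2 < 1 by rewrite ltW.
exists kappa1, (Num.min ((1 - x2 ^+ 2) * b0 * c) (1 - x2 ^+ 2)); split => //.
  by rewrite lt_min m0 andbT !mulr_gt0.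
move=> theta0 Htheta; pose w := weight d b theta0.
have w0 x : 0 <= w x by exact: weight_ge0 hb.
have mw : measurable_fun setT w by exact: measurable_weight hb.
have BE (z s : 'rV[R]_d) : z != 0 -> enorm s = 1 ->
    kernel_cut gamma b theta0 z s = enorm z `^ gamma * w (cosd z s).
  by move=> z0 s1; rewrite (kernel_cutE _ _ d3 hb).
have mS := @measurable_sphere R d.
have mB (z : 'rV[R]_d) : z != 0 -> measurable_fun (@sphere R d) (kernel_cut gamma b theta0 z : V -> R).
  move=> z0; apply: (@eq_measurable_fun _ _ _ _ _
    (fun s : V => enorm z `^ gamma * w (cosd z s))).
    by move=> s; rewrite inE => s1; rewrite BE.
  apply: measurable_funTS.
  apply: measurable_funM => //; apply: measurableT_comp mw _.
  exact: measurable_cosd.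
have B0 (z s : 'rV[R]_d) : enorm s = 1 -> 0 <= kernel_cut gamma b theta0 z s.
  move=> s1; have [->|z0] := eqVneq z 0; last by rewrite BE// mulr_ge0// powR_ge0.
  rewrite /kernel_cut; case: ifP => // _; rewrite /kernel_B /deviation_angle.
  rewrite enorm_eq0 invr0 mulr0 acos0 sin_pihalf cos_pihalf expr1n invr1 mulr1.
  by rewrite mulr_ge0 ?powR_ge0//; case: hb => + _ _ _; apply; lra.
have msB (z : 'rV[R]_d) n : z != 0 -> measurable_fun (@sphere R d)
    (fun s : V => (sind z s ^+ n * kernel_cut gamma b theta0 z s)%:E).
  move=> z0; apply/measurable_EFinP; apply: measurable_funM; last exact: mB.
  apply: measurable_funX; apply: measurable_funTS.
  exact: measurable_sind.
split => //.
- by move=> z s z0 s1 xn; rewrite BE// /w /weight leNgt xn mulr0.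
- move=> z z0; have z1 := enorm_normalize z0.
  rewrite (eq_integral (fun s : V => ((enorm z `^ gamma)%:E *
      (Num.sqrt (1 - dot (s : 'rV[R]_d) ((enorm z)^-1 *: z) ^+ 2) *
        w (dot (s : 'rV[R]_d) ((enorm z)^-1 *: z)))%:E)%E)); last first.
    move=> s; rewrite inE => s1; rewrite BE// /sind cosd_normalize -EFinM.
    by congr (_%:E); ring.
  rewrite ge0_integralZl_EFin ?powR_ge0//.
  + rewrite mulrC EFinM lee_wpmul2l ?lee_fin ?powR_ge0//; apply: Hup => //.
    * by move=> x xn; rewrite /w /weight (negbTE xn).
    * by move=> x x01; apply: weight_le.
  + by move=> s _; rewrite lee_fin mulr_ge0// sqrtr_ge0.
  + apply: (@eq_measurable_fun _ _ _ _ _ (fun s : V => (sind z s * w (cosd z s))%:E)).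
      by move=> s _; rewrite /sind cosd_normalize.
    apply/measurable_EFinP; apply: measurable_funTS.
    apply: measurable_funM; first exact: measurable_sind.
    by apply: measurableT_comp mw _; exact: measurable_cosd.
move=> z z0; have z1 := enorm_normalize z0.
(* [acos x2] is the smallest angle of the band where the profile is at least
   [b0]. *)
have [tx|tx] := ltP theta0 (acos x2).
  apply: (@le_trans _ _ (\int[sphere_measure R d]_(s in @sphere R d)
     (((1 - x2 ^+ 2) * b0 * enorm z `^ gamma)%:E *
      (\1_(annulus ((enorm z)^-1 *: z) x1 x2) s)%:E))%E).
    rewrite ge0_integralZl_EFin//; last 2 first.
    - by apply/measurable_EFinP; apply: measurable_indic; exact: measurable_annulus.
    - by rewrite !mulr_ge0 ?powR_ge0// ltW.
    rewrite integral_indic//; last exact: measurable_annulus.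
    rewrite setIC; apply: (@le_trans _ _
      (((1 - x2 ^+ 2) * b0 * enorm z `^ gamma)%:E * c%:E)%E); last first.
      by rewrite lee_wpmul2l ?Hlow// lee_fin !mulr_ge0 ?powR_ge0// ltW.
    rewrite -EFinM lee_fin.
    have -> : (1 - x2 ^+ 2) * b0 * enorm z `^ gamma * c =
      (1 - x2 ^+ 2) * b0 * c * enorm z `^ gamma by ring.
    by rewrite ler_wpM2r ?powR_ge0// ge_min lexx.
  apply: ge0_le_integral => //.
  - by move=> s _; rewrite -EFinM lee_fin indicE !mulr_ge0 ?powR_ge0// ltW.
  - apply: emeasurable_funM => //; apply/measurable_EFinP.
    by apply: measurable_indic; exact: measurable_annulus.
  - exact: msB.
  move=> s s1; rewrite -EFinM lee_fin indicE.
  have [|_] := boolP (_ \in _); last by rewrite mulr0 mulr_ge0 ?sqr_ge0 ?B0.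
  rewrite inE /annulus/= -cosd_normalize => xs; rewrite BE//= mulr1.
  have /andP[xs1 xs2] := xs; set x := cosd z s in xs xs1 xs2 *.
  have x01 : 0 <= x < 1 by apply/andP; split; lra.
  have S2 : 1 - x2 ^+ 2 <= 1 - x ^+ 2 by rewrite lerD2l lerN2 lerXn2r ?nnegrE//; lra.
  have P0 : 0 <= enorm z `^ gamma by exact: powR_ge0.
  have wx : b0 <= w x.
    rewrite /w /weight x01/= ifT; last by apply: lt_trans tx _; rewrite ltr_acos.
    apply: le_trans (bb x xs) _; rewrite ler_peMl ?(le_trans (ltW b00) (bb x xs))//.
    have S0 : 0 < Num.sqrt (1 - x ^+ 2) by rewrite sqrtr_gt0; lra.
    rewrite invf_ge1 ?exprn_gt0// exprn_ile1 ?(ltW S0)//.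
    by rewrite -[leRHS]sqrtr1 ler_wsqrtr// gerBl sqr_ge0.
  rewrite sind_sqr// -/x mulrCA mulrC ler_wpM2l//.
  by apply: ler_pM => //; exact: ltW.
have [K K1 HK] : exists2 K, 1 <= K & cutoff_angle d gamma b K theta0.
  case: Htheta => // t0; have := le_lt_trans tx t0.
  by rewrite ltNge acos_ge0//; apply/andP; split; lra.
have := HK z z0; rewrite integral_surface => HKz.
apply: (@le_trans _ _ (\int[sphere_measure R d]_(s in @sphere R d)
  ((1 - x2 ^+ 2)%:E * (kernel_cut gamma b theta0 z s)%:E))%E).
  rewrite ge0_integralZl_EFin ?(ltW m0)//.
  - rewrite HKz -EFinM lee_fin mulrA ler_wpM2r ?powR_ge0//.
    by rewrite ge_min; apply/orP; right; rewrite ler_peMr// ltW.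
  - by move=> s s1; rewrite lee_fin B0.
  - by apply/measurable_EFinP; exact: mB.
apply: ge0_le_integral => //.
- by move=> s s1; rewrite -EFinM lee_fin mulr_ge0 ?B0// ltW.
- by apply: emeasurable_funM => //; apply/measurable_EFinP; exact: mB.
- exact: msB.
move=> s s1; rewrite -EFinM lee_fin BE//.
have [->|wn0] := eqVneq (w (cosd z s)) 0; first by rewrite !mulr0.
rewrite ler_wpM2r ?mulr_ge0 ?powR_ge0// sind_sqr//.
move: wn0; rewrite /w /weight; case: ifPn => [/andP[x01 tx'] _|_]; last by rewrite eqxx.
have := le_lt_trans tx tx'; rewrite ltr_acos// => xx2.
rewrite lerD2l lerN2; have /andP[? ?] := x01; rewrite lerXn2r ?nnegrE//; lra.
Qed.

End CollisionKernel.

(** * Integration against empirical measures *)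

Section AtomicIntegral.
Local Open Scope ereal_scope.

(** For an arbitrary function, measurable or not, the integral of the positive
    part is a supremum over simple functions, and truncating these to [S] changes
    neither their integrals nor the constraint. *)
Lemma integral_carried (dT : measure_display) (T : measurableType dT)
    (R : realType) (m : {measure set T -> \bar R}) (S : set T)
    (f : T -> \bar R) : measurable S -> m (~` S) = 0 ->
  \int[m]_x f x = \int[m]_(x in S) f x.
Proof.
move=> mS mS0.
pose nn (g : T -> \bar R) := ereal_sup [set sintegral m h |
  h in [set h : {nnsfun T >-> R} | forall x, (h x)%:E <= g x]].
have K (g : T -> \bar R) : (forall x, 0 <= g x) -> nn g = nn (g \_ S).
  move=> g0; apply/eqP; rewrite eq_le; apply/andP; split.
    apply: ge_ereal_sup => _ [h hg <-].
    pose k := mul_nnsfun h (indic_nnsfun R mS).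
    have kE y : k y = (h y * \1_S y)%R by [].
    have -> : sintegral m h = sintegral m k.
      have SE (l : {nnsfun T >-> R}) : sintegral m l = \int[m]_x (l x)%:E.
        by rewrite integral_nnsfun// patch_setT.
      rewrite !SE.
      have mh (l : {nnsfun T >-> R}) : measurable_fun setT (fun x => (l x)%:E).
        by apply/measurable_EFinP; exact: measurable_funP.
      rewrite (ge0_negligible_integral (measurableC mS) measurableT (mh h) _ mS0);
        last by move=> x _; rewrite lee_fin.
      rewrite (ge0_negligible_integral (measurableC mS) measurableT (mh k) _ mS0);
        last by move=> x _; rewrite lee_fin.
      apply: eq_integral => x; rewrite inE setTD setCK => Sx.
      by rewrite kE indicE mem_set// mulr1.
    apply: ereal_sup_ubound; exists k => // x.
    rewrite kE indicE patchE; case: ifPn => _; first by rewrite mulr1.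
    by rewrite mulr0.
  apply: le_ereal_sup => _ [h hg <-]; exists h => // x.
  by apply: le_trans (hg x) _; rewrite patchE; case: ifPn.
rewrite /integral patch_setT; congr (_ - _).
- rewrite -[LHS]/(nn (f^\+)) K//; congr nn; apply/funext => x.
  by rewrite patchE !funeposE patchE; case: ifPn => // _; rewrite maxxx.
- rewrite -[LHS]/(nn (f^\-)) K//; congr nn; apply/funext => x.
  by rewrite patchE !funenegE patchE; case: ifPn => // _; rewrite oppe0 maxxx.
Qed.

Lemma measurable_vec1 (R : realType) d (v : vec R d) : measurable [set v].
Proof.
have -> : [set v] = cube (v : 'rV[R]_d) 0%R.
  apply/seteqP; split => x /=; first by move=> -> i; rewrite subrr normr0.
  by move=> xv; apply/rowP => i; have := xv i; rewrite normr_le0 subr_eq0 => /eqP.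
exact: measurable_cube.
Qed.
End AtomicIntegral.

Section EmpiricalMeasure.
Variables (R : realType) (d N : nat).
Local Notation V := (vec R d).
Hypothesis N0 : (0 < N)%N.
Implicit Type x : 'I_N -> V.

Lemma empirical_measure x : exists2 m : {measure set V -> \bar R},
  (forall A, empirical x A = m A) & m (~` range x) = 0%E /\
  forall (f : V -> \bar R), measurable_fun (range x) f ->
    (forall v, (0 <= f v)%E) ->
    (\int[m]_(v in range x) f v = (N%:R^-1)%:E * \sum_(i < N) f (x i))%E.
Proof.
pose o (k : nat) : 'I_N := insubd (Ordinal N0) k.
have oE (i : 'I_N) : o i = i by exact: valKd.
pose D k : {measure set V -> \bar R} := @dirac _ V (x (o k)) R.
have n0 : 0 <= (N%:R^-1 : R) by rewrite invr_ge0.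
pose m : {measure set V -> \bar R} := mscale (NngNum n0) (msum D N).
have mE A : empirical x A = m A.
  have -> : m A = ((N%:R^-1)%:E * \sum_(i < N) D i A)%E by [].
  congr (_ * _)%E.
  by apply: eq_bigr => i _; rewrite /D/= oE.
have mR : measurable (range x).
  rewrite -bigcup_imset1; apply: fin_bigcup_measurable => // i _.
  exact: measurable_vec1.
exists m => //; split.
  rewrite -mE /empirical big1 ?mule0// => i _.
  by rewrite /dirac indicE memNset//=; apply; exists i.
move=> f mf f0; rewrite ge0_integral_mscale//; congr (_ * _)%E.
rewrite ge0_integral_measure_sum//; apply: eq_bigr => i _.
rewrite integral_dirac// /dirac indicE mem_set ?mul1e ?oE//.
Qed.

Lemma measurable_fun_range x (f : V -> \bar R) : measurable_fun (range x) f.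
Proof.
have -> : range x = \bigcup_(i in setT) [set x i] by rewrite bigcup_imset1.
move=> _ Y mY; rewrite setI_bigcupl; apply: fin_bigcup_measurable => // i _.
have [fY|fY] := pselect (Y (f (x i))).
  have -> : [set x i] `&` f @^-1` Y = [set x i].
    by apply/seteqP; split => v /=; [case|move=> ->].
  exact: measurable_vec1.
have -> : [set x i] `&` f @^-1` Y = set0; last exact: measurable0.
by apply/seteqP; split => v //= [->].
Qed.

(** The measure is carried by finitely many points, on which every function is
    measurable. *)
Lemma integral_empirical x (f : V -> \bar R) :
  (forall i, f (x i) \is a fin_num) ->
  integral (empirical x) setT f = (N%:R^-1 * \sum_(i < N) fine (f (x i)))%:E.
Proof.
move=> ffin; have [m mE [m0 mI]] := empirical_measure x.
rewrite (@eq_setfun_integral _ _ _ _ m _ f (fun A _ => mE A)).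
have mR : measurable (range x).
  rewrite -bigcup_imset1; apply: fin_bigcup_measurable => // i _.
  exact: measurable_vec1.
have I (g : V -> \bar R) : (forall v, (0 <= g v)%E) ->
    (\int[m]_v g v = (N%:R^-1)%:E * \sum_(i < N) g (x i))%E.
  move=> g0; rewrite (integral_carried _ mR m0) mI//.
  exact: measurable_fun_range.
rewrite integralE !I//.
pose a i := fine (f (x i)); have fa i : f (x i) = (a i)%:E by rewrite fineK.
rewrite (eq_bigr (fun i => (Num.max (a i) 0)%:E)); last first.
  by move=> i _; rewrite funeposE fa -EFin_max.
rewrite [X in (_ - _ * X)%E](eq_bigr (fun i => (Num.max (- a i) 0)%:E)); last first.
  by move=> i _; rewrite funenegE fa -EFinN -EFin_max.
rewrite !sumEFin -!EFinM -EFinB; congr (_%:E); rewrite -mulrBr -sumrB.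
congr (_ * _); apply: eq_bigr => i _; rewrite -/(a i).
by have [] := leP 0 (a i); have [] := leP 0 (- a i); lra.
Qed.

Lemma bracket_empirical x (f : V -> R) :
  bracket f (empirical x) = N%:R^-1 * \sum_(i < N) f (x i).
Proof. by rewrite /bracket integral_empirical. Qed.

(** When the particles are atoms of the measure the jump exchanges atoms, and if
    [i = j] the collision has no effect; so the result is an empirical measure. *)
Lemma empirical_jump x i j (s : V) : exists y : 'I_N -> V,
  jump N (empirical x) (x i) (x j) s = empirical y /\
  forall f : V -> R, \sum_(k < N) f (y k) = \sum_(k < N) f (x k)
     + (f (post1 (x i) (x j) s) + f (post2 (x i) (x j) s) - f (x i) - f (x j)).
Proof.
have [->|ij] := eqVneq i j.
  have p1 : post1 (x j) (x j) s = x j.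
    rewrite /post1 subrr enorm_eq0 mul0r scale0r addr0 scalerDr -scalerDl.
    by rewrite -[RHS]scale1r; congr (_ *: _); field.
  have p2 : post2 (x j) (x j) s = x j.
    rewrite /post2 subrr enorm_eq0 mul0r scale0r subr0 scalerDr -scalerDl.
    by rewrite -[RHS]scale1r; congr (_ *: _); field.
  exists x; rewrite p1 p2; split => [|f]; last by ring.
  apply/funext => A; rewrite /jump p1 p2.
  have -> : (\d_(x j) A + \d_(x j) A - \d_(x j) A - \d_(x j) A = 0 :> \bar R)%E.
    by rewrite !diracE -!EFinN -!EFinD; congr (_%:E); ring.
  by rewrite mule0 adde0.
pose y k : V := if k == i then post1 (x i) (x j) s
  else if k == j then post2 (x i) (x j) s else x k.
have S (f : V -> R) : \sum_(k < N) f (y k) = \sum_(k < N) f (x k)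
     + (f (post1 (x i) (x j) s) + f (post2 (x i) (x j) s) - f (x i) - f (x j)).
  rewrite (bigD1 i)//= (bigD1 j) ?(eq_sym j)//= [in RHS](bigD1 i)//= [in RHS](bigD1 j) ?(eq_sym j)//=.
  rewrite {1 2}/y !eqxx eq_sym (negbTE ij).
  rewrite (eq_bigr (fun k => f (x k))); first by ring.
  by move=> k /andP[ki kj]; rewrite /y (negbTE ki) (negbTE kj).
exists y; split => //; apply/funext => A; rewrite /jump /empirical.
have e (z : 'I_N -> V) : (\sum_(k < N) \d_(z k) A = (\sum_(k < N) \1_A (z k))%:E :> \bar R)%E.
  by rewrite -sumEFin.
have -> : (\d_(post1 (x i) (x j) s) A + \d_(post2 (x i) (x j) s) A
    - \d_(x i) A - \d_(x j) A = (\1_A (post1 (x i) (x j) s) +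
    \1_A (post2 (x i) (x j) s) - \1_A (x i) - \1_A (x j))%:E :> \bar R)%E by [].
by rewrite !e (S (\1_A)) -!EFinM -EFinD [in RHS]mulrDr.
Qed.

Lemma bracket_jump x (f : V -> R) i j (s : V) :
  bracket f (jump N (empirical x) (x i) (x j) s) = bracket f (empirical x) +
  N%:R^-1 * (f (post1 (x i) (x j) s) + f (post2 (x i) (x j) s) - f (x i) - f (x j)).
Proof.
have [y [-> S]] := empirical_jump x i j s.
by rewrite !bracket_empirical S mulrDr.
Qed.

End EmpiricalMeasure.

(** * Collision rates integrated over the sphere *)

Section ScalarBounds.
Variable R : realType.
Implicit Types (a b n r p gamma delta x y : R).

Lemma powR_half_ge x gamma : 0 <= x -> 0 <= gamma <= 1 ->
  x `^ gamma <= 2 * (x / 2) `^ gamma.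
Proof.
move=> x0 /andP[g0 g1]; rewrite powRM ?invr_ge0//.
have h : 2^-1 <= (2^-1 : R) `^ gamma.
  rewrite -[leLHS]powRr1 ?invr_ge0//; apply: ger_powR => //.
  by rewrite invr_gt0 ltr0n/= invf_le1// ler1n.
by have := powR_ge0 x gamma; nra.
Qed.

Lemma powR_sum_le x y r : 0 <= r -> 0 <= x -> 0 <= y ->
  (x + y) `^ r <= 2 `^ r * (x `^ r + y `^ r).
Proof.
move=> r0; wlog yx : x y / y <= x.
  move=> H x0 y0; case: (leP y x) => [|/ltW] h; first exact: H.
  by rewrite addrC (addrC (x `^ _)); exact: H.
move=> x0 y0; apply: (@le_trans _ _ ((2 * x) `^ r)).
  by apply: le_powR2 => //; [exact: addr_ge0|lra].
by rewrite powRM// ler_wpM2l ?powR_ge0// lerDl powR_ge0.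
Qed.

Lemma sqr_powR x r : 0 <= x -> (x ^+ 2) `^ (r / 2) = x `^ r.
Proof.
move=> x0; rewrite -powR_mulrn// -powRrM.
by congr (_ `^ _); field.
Qed.

(** Either the two speeds are comparable, and then the mixed term is of top
    order, or the relative speed is at least half of the larger speed. *)
Lemma relative_speed_ge a b n p gamma : 0 <= a -> 0 <= b -> `|a - b| <= n ->
  2 <= p -> 0 <= gamma <= 1 ->
  4^-1 * (a `^ (p + gamma) + b `^ (p + gamma)) <=
  n `^ gamma * (a `^ p + b `^ p)
    + a * b * (a ^+ 2 + b ^+ 2) `^ ((p + gamma) / 2 - 1).
Proof.
move=> + + + p2 g01; wlog ba : a b / b <= a.
  move=> H a0 b0 abn; case: (leP b a) => [|/ltW] h; first exact: H.
  rewrite (addrC (a `^ _)) (addrC (a `^ p)) (mulrC a) (addrC (a ^+ 2)).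
  by apply: H => //; rewrite distrC.
move=> a0 b0 abn; have /andP[g0 g1] := g01.
set r := p + gamma; have r2 : 2 <= r by rewrite /r; lra.
have n0 : 0 <= n by exact: le_trans abn.
have [a00|an0] := eqVneq a 0.
  have -> : b = 0 by lra.
  have rn0 : r != 0 by apply: lt0r_neq0; lra.
  have pn0 : p != 0 by apply: lt0r_neq0; lra.
  by rewrite a00 !powR0// !mul0r !addr0 !mulr0.
have ap : 0 < a by rewrite lt_neqAle eq_sym an0.
have br : b `^ r <= a `^ r by apply: le_powR2 => //; lra.
have ar := powR_ge0 a r.
have cross0 : 0 <= a * b * (a ^+ 2 + b ^+ 2) `^ (r / 2 - 1).
  by rewrite !mulr_ge0 ?powR_ge0.
have T0 : 0 <= n `^ gamma * (a `^ p + b `^ p).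
  by rewrite mulr_ge0 ?addr_ge0 ?powR_ge0.
have aE : a `^ r = a `^ gamma * a `^ p.
  by rewrite -powRD ?(gt_eqF ap) ?implybT// addrC.
have [ba2|ba2] := leP b (a / 2).
  have an : a / 2 <= n by have := le_trans (ler_norm _) abn; lra.
  have h1 := powR_half_ge a0 g01.
  have h2 : (a / 2) `^ gamma <= n `^ gamma by apply: le_powR2 => //; lra.
  have h3 : a `^ r <= 2 * (n `^ gamma * a `^ p).
    rewrite aE mulrA ler_wpM2r ?powR_ge0//; lra.
  have h4 : n `^ gamma * a `^ p <= n `^ gamma * (a `^ p + b `^ p).
    by rewrite ler_wpM2l ?powR_ge0// lerDl powR_ge0.
  lra.
have h1 : a `^ r <= 2 * (a * b * (a ^+ 2 + b ^+ 2) `^ (r / 2 - 1)).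
  have h2 : (a ^+ 2) `^ (r / 2 - 1) <= (a ^+ 2 + b ^+ 2) `^ (r / 2 - 1).
    by apply: le_powR2; rewrite ?sqr_ge0 ?lerDl ?sqr_ge0//; lra.
  have h3 : a `^ r = a * a * (a ^+ 2) `^ (r / 2 - 1).
    rewrite -expr2 -{1}(powRr1 (sqr_ge0 a)) -powRD; last first.
      by rewrite expf_eq0 (gt_eqF ap) /= implybT.
    by rewrite addrC subrK sqr_powR.
  rewrite h3; have P0 := powR_ge0 (a ^+ 2) (r / 2 - 1).
  have ab : a * a <= 2 * (a * b) by nra.
  have ab0 : 0 <= a * b by exact: mulr_ge0.
  apply: (@le_trans _ _ (2 * (a * b) * (a ^+ 2) `^ (r / 2 - 1))).
    by rewrite ler_wpM2r.
  by rewrite -[leLHS]mulrA ler_wpM2l// ler_wpM2l.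
lra.
Qed.

Lemma relative_speed_le a b n gamma : 0 <= a -> 0 <= b -> 0 <= n <= a + b ->
  0 <= gamma <= 1 -> n `^ gamma <= 2 * (a ^+ 2 + b ^+ 2) `^ (gamma / 2).
Proof.
move=> a0 b0 /andP[n0 nab] /andP[g0 g1].
have E0 : 0 <= a ^+ 2 + b ^+ 2 by rewrite addr_ge0 ?sqr_ge0.
rewrite -sqr_powR//; apply: (@le_trans _ _ ((2 * (a ^+ 2 + b ^+ 2)) `^ (gamma / 2))).
  apply: le_powR2; rewrite ?sqr_ge0 ?divr_ge0//.
  by have := sqr_ge0 (a - b); nra.
rewrite powRM// ler_wpM2r ?powR_ge0//.
rewrite -[leRHS]powRr1//; apply: ler_powR; [by rewrite ler1n|lra].
Qed.

(** The mixed term has order [r] in total but order [r - 1] in the larger variable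
    and [1] in the other; Young splits the former into a small multiple of the
    [r]-th power and a constant, and the latter is bounded by an energy. *)
Lemma cross_le a b r delta : 0 <= a -> 0 <= b -> 2 <= r -> 0 < delta ->
  a * b * (a ^+ 2 + b ^+ 2) `^ (r / 2 - 1) <=
  2 `^ (r / 2 - 1) *
    ((delta * a `^ r + (delta^-1) `^ (r - 1)) * ((1 + b ^+ 2) / 2) +
     (delta * b `^ r + (delta^-1) `^ (r - 1)) * ((1 + a ^+ 2) / 2)).
Proof.
move=> a0 b0 r2 d0.
have H y : 0 <= y -> y `^ (r - 1) <= delta * y `^ r + (delta^-1) `^ (r - 1).
  move=> y0; have [yd|yd] := leP y delta^-1.
    rewrite -[leLHS]add0r lerD// ?mulr_ge0 ?powR_ge0 ?(ltW d0)//.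
    by apply: le_powR2 => //; lra.
  rewrite -[leLHS]addr0 lerD ?powR_ge0//.
  have yp : 0 < y by apply: lt_trans yd; rewrite invr_gt0.
  have -> : y `^ r = y * y `^ (r - 1).
    rewrite -{2}(powRr1 y0) -powRD ?(gt_eqF yp) ?implybT//.
    by congr (_ `^ _); ring.
  rewrite mulrA ler_peMl ?powR_ge0//.
  by rewrite -(mulfV (lt0r_neq0 d0)) ler_wpM2l ?(ltW d0)// ltW.
have H2 y : y <= (1 + y ^+ 2) / 2 by have := sqr_ge0 (y - 1); rewrite !expr2; nra.
have S1 y z : 0 <= y -> 0 <= z -> y `^ (r - 1) * z <=
    (delta * y `^ r + (delta^-1) `^ (r - 1)) * ((1 + z ^+ 2) / 2).
  by move=> y0 z0; apply: ler_pM; rewrite ?powR_ge0 ?H ?H2.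
have S2 y z : 0 <= z -> z <= y -> y * z * (y ^+ 2 + z ^+ 2) `^ (r / 2 - 1) <=
    2 `^ (r / 2 - 1) * (y `^ (r - 1) * z).
  move=> z0 zy; have y0 := le_trans z0 zy.
  have [->|yn0] := eqVneq y 0.
    by rewrite !mul0r !mulr_ge0// ?powR_ge0.
  have yp : 0 < y by rewrite lt_neqAle eq_sym yn0.
  have h : (y ^+ 2 + z ^+ 2) `^ (r / 2 - 1) <= 2 `^ (r / 2 - 1) * y `^ (r - 2).
    have -> : y `^ (r - 2) = (y ^+ 2) `^ (r / 2 - 1).
      by rewrite -(sqr_powR _ y0); congr (_ `^ _); field.
    rewrite -powRM ?sqr_ge0//; apply: le_powR2; [lra| |nra].
    by rewrite addr_ge0 ?sqr_ge0.
  have -> : y `^ (r - 1) = y * y `^ (r - 2).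
    rewrite -{2}(powRr1 y0) -powRD ?(gt_eqF yp) ?implybT//.
    by congr (_ `^ _); ring.
  have -> : 2 `^ (r / 2 - 1) * (y * y `^ (r - 2) * z) =
    y * z * (2 `^ (r / 2 - 1) * y `^ (r - 2)) by ring.
  by rewrite ler_wpM2l// mulr_ge0.
have P2 : 0 <= 2 `^ (r / 2 - 1) by move=> *; exact: powR_ge0.
have T y z : 0 <= y -> 0 <= z ->
  0 <= (delta * y `^ r + (delta^-1) `^ (r - 1)) * ((1 + z ^+ 2) / 2).
  move=> y0 z0; have := S1 y z y0 z0; apply: le_trans.
  by rewrite mulr_ge0 ?powR_ge0.
have [ba|/ltW ab] := leP b a.
  apply: le_trans (S2 a b b0 ba) _; rewrite ler_wpM2l//.
  by have := S1 a b a0 b0; have := T b a b0 a0; lra.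
rewrite (mulrC a) (addrC (a ^+ 2)).
apply: le_trans (S2 b a a0 ab) _; rewrite ler_wpM2l//.
by have := S1 b a b0 a0; have := T a b a0 b0; lra.
Qed.

End ScalarBounds.

Section PairIntegrals.
Variables (R : realType) (d : nat) (gamma kappa1 kappa2 : R).
Variable B : 'rV[R]_d -> 'rV[R]_d -> R.
Hypothesis HB : collision_kernel gamma kappa1 kappa2 B.
Local Notation V := (vec R d).
Local Notation sigma := (sphere_measure R d).
Local Notation S := (@sphere R d).
Implicit Types v w z : 'rV[R]_d.

Lemma measurable_post1 v w : measurable_fun setT (fun s : V => post1 v w s).
Proof.
apply: measurable_to_vec => i.
apply: (@eq_measurable_fun _ _ _ _ setT (fun s : V =>
  (2^-1 *: (v + w)) 0 i + enorm (v - w) / 2 * (s : 'rV[R]_d) 0 i)).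
  by move=> s _; rewrite /post1 !mxE.
apply: measurable_funD => //; apply: measurable_funM => //.
exact: measurable_coord.
Qed.

Lemma measurable_post2 v w : measurable_fun setT (fun s : V => post2 v w s).
Proof.
apply: measurable_to_vec => i.
apply: (@eq_measurable_fun _ _ _ _ setT (fun s : V =>
  (2^-1 *: (v + w)) 0 i - enorm (v - w) / 2 * (s : 'rV[R]_d) 0 i)).
  by move=> s _; rewrite /post2 !mxE.
apply: measurable_funB => //; apply: measurable_funM => //.
exact: measurable_coord.
Qed.

Lemma measurable_transfer p v w :
  measurable_fun setT (transfer p v w : V -> R).
Proof.
rewrite /transfer; do 2 apply: measurable_funB => //.
by apply: measurable_funD; apply: measurableT_comp (measurable_powR _) _;
  apply: measurable_enorm; [exact: measurable_post1|exact: measurable_post2].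
Qed.

Lemma transfer_diag p v (s : 'rV[R]_d) : transfer p v v s = 0.
Proof.
have e : 2^-1 *: (v + v) = v.
  by rewrite scalerDr -scalerDl -[RHS]scale1r; congr (_ *: _); field.
rewrite /transfer /post1 /post2 subrr enorm_eq0 mul0r scale0r addr0 subr0 e.
by ring.
Qed.

Lemma grazing_integrable n z : (0 < n)%N -> z != 0 ->
  sigma.-integrable S (fun s => (sind z s ^+ n * B z s)%:E).
Proof.
move=> n0 z0; have [B0 mB _ B1 _] := HB.
have msB k : measurable_fun S (fun s : V => (sind z s ^+ k * B z s)%:E).
  apply/measurable_EFinP; apply: measurable_funM; last exact: mB.
  apply: measurable_funX; apply: measurable_funTS.
  exact: measurable_sind.
apply: (@le_integrable _ _ _ _ _ (@measurable_sphere R d) _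
  (fun s => (sind z s * B z s)%:E)) => //.
  move=> s s1; rewrite !abse_EFin lee_fin !ger0_norm ?mulr_ge0 ?sind_ge0 ?B0//.
    rewrite ler_wpM2r ?B0//; case: n n0 {msB} => // n _.
    by rewrite exprS ler_piMr ?sind_ge0// exprn_ile1 ?sind_ge0 ?sind_le1.
  by rewrite exprn_ge0// sind_ge0.
apply/integrableP; split; first exact: (msB 1%N).
under eq_integral => s.
  rewrite inE => s1; rewrite abse_EFin ger0_norm; last first.
    by rewrite mulr_ge0 ?sind_ge0 ?B0.
  over.
by apply: le_lt_trans (B1 z z0) _; rewrite ltry.
Qed.

Definition grazing_moment n z : R :=
  fine (\int[sigma]_(s in S) (sind z s ^+ n * B z s)%:E).

Lemma grazing_momentE n z : (0 < n)%N -> z != 0 ->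
  (\int[sigma]_(s in S) (sind z s ^+ n * B z s)%:E = (grazing_moment n z)%:E)%E.
Proof.
move=> n0 z0; rewrite /grazing_moment fineK//.
apply: integrable_fin_num; first exact: measurable_sphere.
exact: grazing_integrable.
Qed.

Lemma grazing_moment1_le z : z != 0 ->
  grazing_moment 1 z <= kappa1 * enorm z `^ gamma.
Proof.
move=> z0; rewrite -lee_fin -grazing_momentE//.
by have [_ _ _ + _] := HB; apply.
Qed.

Lemma grazing_moment2_ge z : z != 0 ->
  kappa2 * enorm z `^ gamma <= grazing_moment 2 z.
Proof.
move=> z0; rewrite -lee_fin -grazing_momentE//.
by have [_ _ _ _] := HB; apply.
Qed.

Lemma grazing_moment2_le1 z : z != 0 -> grazing_moment 2 z <= grazing_moment 1 z.
Proof.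
move=> z0; rewrite -lee_fin -!grazing_momentE//.
have [B0 _ _ _ _] := HB.
apply: le_integral; [exact: measurable_sphere|exact: grazing_integrable..|].
move=> s; rewrite inE => s1; rewrite lee_fin ler_wpM2r ?B0// expr1 expr2.
by rewrite ler_piMr ?sind_ge0 ?sind_le1.
Qed.

(** Without cutoff the total rate is infinite, but the first grazing moment is
    finite: functions that vanish like the sine at grazing collisions are
    integrable. *)
Lemma collision_integrable z (f : V -> R) L : z != 0 -> measurable_fun S f ->
  (forall s, enorm (s : 'rV[R]_d) = 1 -> 0 <= cosd z s -> `|f s| <= L * sind z s) ->
  sigma.-integrable S (fun s => (f s * B z s)%:E).
Proof.
move=> z0 mf fL; have [B0 mB Bneg _ _] := HB.
apply: (@le_integrable _ _ _ _ _ (@measurable_sphere R d) _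
  (fun s => (L%:E * (sind z s ^+ 1 * B z s)%:E)%E)).
- by apply/measurable_EFinP; apply: measurable_funM => //; exact: mB.
- move=> s s1; rewrite -EFinM !abse_EFin lee_fin.
  have [x0|x0] := ltP (cosd z s) 0; first by rewrite Bneg// !mulr0 normr0.
  have Bs : 0 <= B z s by exact: B0.
  apply: le_trans (ler_norm _); rewrite mulrA expr1.
  by have := ler_wpM2r Bs (fL s s1 x0); rewrite -{1}(ger0_norm Bs) -normrM.
- by apply: integrableZl; [exact: measurable_sphere|exact: grazing_integrable].
Qed.

Definition pair_integral (f : V -> R) z : R :=
  fine (\int[sigma]_(s in S) (f s * B z s)%:E).

Lemma transfer_sind p v w (s : 'rV[R]_d) : 2 <= p -> enorm s = 1 ->
  0 <= cosd (v - w) s ->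
  `|transfer p v w s| <= p * (dot v v + dot w w) `^ (p / 2) * sind (v - w) s.
Proof.
move=> p2 s1 x0; apply: le_trans (transfer_bound p2 s1 x0) _.
by rewrite -!mulrA (mulrC (sind _ _)).
Qed.

Lemma pair_integralE (f : V -> R) z L : z != 0 -> measurable_fun S f ->
  (forall s, enorm (s : 'rV[R]_d) = 1 -> 0 <= cosd z s -> `|f s| <= L * sind z s) ->
  (\int[sigma]_(s in S) (f s * B z s)%:E = (pair_integral f z)%:E)%E.
Proof.
move=> z0 mf fL; rewrite /pair_integral fineK//.
apply: integrable_fin_num; first exact: measurable_sphere.
exact: collision_integrable fL.
Qed.

(** In the Povzner inequality the negative term comes with the square of the sine
    and the mixed term with the sine: they are integrated with the lower bound on
    the second grazing moment and with the upper bound on the first. *)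
Lemma pair_transfer_le p v w : 2 <= p -> v != w ->
  pair_integral (transfer p v w) (v - w) <=
  enorm (v - w) `^ gamma *
  (- (kappa2 / 2 * (1 - 2 `^ (1 - p / 2)) * (enorm v `^ p + enorm w `^ p))
   + 3 * (p / 2) * kappa1 * (enorm v * enorm w)
     * (dot v v + dot w w) `^ (p / 2 - 1)).
Proof.
move=> p2 vw; have z0 : v - w != 0 by rewrite subr_eq0.
have [B0 mB Bneg _ _] := HB.
set c1 := 1 - 2 `^ (1 - p / 2).
have c10 : 0 <= c1.
  rewrite subr_ge0 -[leRHS](powRr0 2); apply: ler_powR; [by rewrite ler1n|lra].
set A := enorm v `^ p + enorm w `^ p.
have A0 : 0 <= A by rewrite addr_ge0 ?powR_ge0.
set T := 3 * (p / 2) * (enorm v * enorm w) * (dot v v + dot w w) `^ (p / 2 - 1).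
have T0 : 0 <= T.
  by rewrite !mulr_ge0 ?enorm_ge0 ?powR_ge0//; lra.
have mt : measurable_fun S (transfer p v w : V -> R).
  exact: measurable_funTS (measurable_transfer _ _ _).
have tS s := @transfer_sind p v w s p2.
set z := v - w in z0 tS *; set n := enorm z `^ gamma.
have mS := @measurable_sphere R d.
have I1 := @grazing_integrable 1 z isT z0.
have I2 := @grazing_integrable 2 z isT z0.
apply: (@le_trans _ _ (- (c1 / 2 * A) * grazing_moment 2 z + T * grazing_moment 1 z)).
  rewrite -lee_fin -(pair_integralE z0 mt tS) EFinD !EFinM -!grazing_momentE//.
  rewrite -!integralZl// -integralD//; [|exact: integrableZl..].
  apply: le_integral => //; first exact: collision_integrable tS.
    by apply: integrableD => //; exact: integrableZl.
  move=> s; rewrite inE => s1; rewrite -!EFinM -EFinD lee_fin.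
  have [x0|x0] := ltP (cosd z s) 0; first by rewrite Bneg// !mulr0 addr0.
  rewrite !mulrA -mulrDl ler_wpM2r ?B0//.
  apply: le_trans (povzner p2 vw s1 x0) _; rewrite -/z -/c1 -/A /T expr1.
  by rewrite le_eqVlt; apply/orP; left; apply/eqP; field.
have h1 := grazing_moment1_le z0; have h2 := grazing_moment2_ge z0.
rewrite -/n in h1 h2 *.
have -> : n * (- (kappa2 / 2 * c1 * A) + 3 * (p / 2) * kappa1 * (enorm v * enorm w)
     * (dot v v + dot w w) `^ (p / 2 - 1)) =
  - (c1 / 2 * A) * (kappa2 * n) + T * (kappa1 * n) by rewrite /T; field.
apply: lerD; last by rewrite ler_wpM2l.
by rewrite !mulNr lerN2 ler_wpM2l// !mulr_ge0.
Qed.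

(** A collision preserves the energy. *)
Lemma pair_transfer2 v w : pair_integral (transfer 2 v w) (v - w) = 0.
Proof.
rewrite /pair_integral integral0_eq// => s s1.
rewrite transferE// divff ?pnatr_eq0// !powRr1 ?dot_ge0//.
- by rewrite [X in X * _](_ : _ = 0) ?mul0r//; field.
- by rewrite -dot_post2// dot_ge0.
- by rewrite -dot_post1// dot_ge0.
Qed.

Lemma pair_transfer_sqr_le p v w : 2 <= p -> v != w ->
  pair_integral (fun s => transfer p v w s ^+ 2) (v - w) <=
  p ^+ 2 * kappa1 * (enorm (v - w) `^ gamma * (dot v v + dot w w) `^ p).
Proof.
move=> p2 vw; have z0 : v - w != 0 by rewrite subr_eq0.
have [B0 mB Bneg _ _] := HB.
have tS s := @transfer_sind p v w s p2.
set z := v - w in z0 tS *.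
set E := dot v v + dot w w; have E0 : 0 <= E by rewrite addr_ge0 ?dot_ge0.
have EE : (E `^ (p / 2)) ^+ 2 = E `^ p.
  by rewrite -powR_mulrn ?powR_ge0// -powRrM; congr (_ `^ _); field.
have mt : measurable_fun S (fun s : V => transfer p v w s ^+ 2).
  apply: measurable_funX.
  exact: measurable_funTS (measurable_transfer _ _ _).
have tS2 (s : V) : enorm (s : 'rV[R]_d) = 1 -> 0 <= cosd z s ->
    `|transfer p v w s ^+ 2| <= p ^+ 2 * E `^ p * sind z s ^+ 2.
  move=> s1 x0; rewrite ger0_norm ?sqr_ge0// -real_normK ?num_real//.
  rewrite -EE -!exprMn lerXn2r ?nnegrE ?normr_ge0//; last exact: tS.
  by rewrite !mulr_ge0 ?sind_ge0 ?powR_ge0//; lra.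
have tS1 (s : V) : enorm (s : 'rV[R]_d) = 1 -> 0 <= cosd z s ->
    `|transfer p v w s ^+ 2| <= p ^+ 2 * E `^ p * sind z s.
  move=> s1 x0; apply: le_trans (tS2 s s1 x0) _; rewrite ler_wpM2l//.
    by rewrite mulr_ge0 ?sqr_ge0 ?powR_ge0.
  by rewrite expr2 ler_piMr ?sind_ge0 ?sind_le1.
apply: (@le_trans _ _ (p ^+ 2 * E `^ p * grazing_moment 2 z)).
  rewrite -lee_fin -(pair_integralE z0 mt tS1) [in leRHS]EFinM -grazing_momentE//.
  have mS := @measurable_sphere R d.
  have I2 := @grazing_integrable 2 z isT z0.
  rewrite -integralZl//; apply: le_integral => //.
    exact: collision_integrable tS1.
    exact: integrableZl.
  move=> s; rewrite inE => s1; rewrite -EFinM lee_fin.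
  have [x0|x0] := ltP (cosd z s) 0; first by rewrite Bneg// !mulr0.
  rewrite mulrA ler_wpM2r ?B0//; apply: le_trans (ler_norm _) _; exact: tS2.
have h := le_trans (grazing_moment2_le1 z0) (grazing_moment1_le z0).
apply: le_trans (ler_wpM2l _ h) _; first by rewrite mulr_ge0 ?sqr_ge0 ?powR_ge0.
by rewrite le_eqVlt; apply/orP; left; apply/eqP; ring.
Qed.

End PairIntegrals.

(** * Drift estimates for the generator *)

Section GeneratorBounds.
Variables (R : realType) (d N : nat).
Hypothesis N0 : (0 < N)%N.
Local Notation V := (vec R d).
Local Notation S := (@sphere R d).
Implicit Types (x : 'I_N -> V) (B : 'rV[R]_d -> 'rV[R]_d -> R).

(** The factor [N] of the generator and one of the two factors [1/N] of the
    product measure cancel. *)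
Lemma generator_empirical B (F : setfun R d -> R) x :
  (forall i j, (\int[sphere_measure R d]_(s in S)
     ((F (jump N (empirical x) (x i) (x j) s) - F (empirical x)) *
       B ((x i : 'rV[R]_d) - (x j : 'rV[R]_d)) s)%:E)%E \is a fin_num) ->
  generator N B F (empirical x) = N%:R^-1 * \sum_(i < N) \sum_(j < N)
    fine (\int[sphere_measure R d]_(s in S)
     ((F (jump N (empirical x) (x i) (x j) s) - F (empirical x)) *
       B ((x i : 'rV[R]_d) - (x j : 'rV[R]_d)) s)%:E)%E.
Proof.
move=> fin; rewrite /generator.
have E i : integral (empirical x) setT (fun w : V =>
    integral (@surface_measure R d) S (fun s : V =>
      ((F (jump N (empirical x) (x i) w s) - F (empirical x)) *
       B ((x i : 'rV[R]_d) - (w : 'rV[R]_d)) s)%:E)) =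
  (N%:R^-1 * \sum_(j < N) fine (\int[sphere_measure R d]_(s in S)
     ((F (jump N (empirical x) (x i) (x j) s) - F (empirical x)) *
       B ((x i : 'rV[R]_d) - (x j : 'rV[R]_d)) s)%:E)%E)%:E.
  rewrite integral_empirical//; last by move=> j; rewrite integral_surface.
  by congr (_ * _)%:E; apply: eq_bigr => j _; rewrite integral_surface.
rewrite integral_empirical//; last by move=> i; rewrite E.
rewrite /= (eq_bigr _ (fun i _ => congr1 fine (E i))) /=.
rewrite -mulr_sumr; set T := \sum_(i < N) _.
by field; rewrite pnatr_eq0 -lt0n.
Qed.

Lemma moment_jump k x i j (s : V) :
  moment k (jump N (empirical x) (x i) (x j) s) =
  moment k (empirical x) + N%:R^-1 * transfer k (x i) (x j) s.
Proof. by rewrite /moment bracket_jump. Qed.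

Lemma moment_empirical k x : moment k (empirical x) =
  N%:R^-1 * \sum_(i < N) enorm (x i : 'rV[R]_d) `^ k.
Proof. by rewrite /moment bracket_empirical. Qed.

Lemma pair_integral_diag B k v :
  pair_integral B (transfer k v v : V -> R) (v - v) = 0.
Proof.
rewrite /pair_integral integral0_eq// => s _.
by rewrite transfer_diag mul0r.
Qed.

Lemma pair_integral_diag2 B k v :
  pair_integral B (fun s : V => transfer k v v s ^+ 2) (v - v) = 0.
Proof.
rewrite /pair_integral integral0_eq// => s _.
by rewrite transfer_diag expr0n mul0r.
Qed.

(** A collision changes a moment by [1/N] times the transfer, so a quadratic upper
    bound on the increments of [psi] bounds the generator by the first two moments
    of the transfer. The Lipschitz condition makes the increments integrable
    against a kernel with infinite total rate. *)
Lemma generator_taylor gamma kappa1 kappa2 B k (psi : R -> R) x (l q : R) :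
  collision_kernel gamma kappa1 kappa2 B -> 2 <= k ->
  measurable_fun setT psi ->
  let M := moment k (empirical x) in
  (forall r, exists2 L, 0 <= L & forall delta, `|delta| <= r ->
     `|psi (M + delta) - psi M| <= L * `|delta|) ->
  (forall delta, psi (M + delta) - psi M <= l * delta + q * delta ^+ 2) ->
  generator N B (fun mu => psi (moment k mu)) (empirical x) <=
  N%:R^-1 * \sum_(i < N) \sum_(j < N)
   (l * N%:R^-1 * pair_integral B (transfer k (x i) (x j)) ((x i : 'rV[R]_d) - x j) +
    q * N%:R^-1 ^+ 2 * pair_integral B (fun s => transfer k (x i) (x j) s ^+ 2)
        ((x i : 'rV[R]_d) - x j)).
Proof.
move=> HB k2 mpsi M lip tay.
have [B0 mB Bneg _ _] := HB.
have mS := @measurable_sphere R d.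
have Ni0 : 0 <= (N%:R^-1 : R) by rewrite invr_ge0.
pose D (v w : 'rV[R]_d) (s : V) : R := psi (M + N%:R^-1 * transfer k v w s) - psi M.
have mD v w : measurable_fun S (D v w).
  apply: measurable_funTS.
  apply: measurable_funB => //; apply: measurableT_comp mpsi _.
  apply: measurable_funD => //; apply: measurable_funM => //.
  exact: measurable_transfer.
have DL v w : v != w -> exists L, forall s, enorm (s : 'rV[R]_d) = 1 ->
    0 <= cosd (v - w) s -> `|D v w s| <= L * sind (v - w) s.
  move=> vw; set E := k * (dot v v + dot w w) `^ (k / 2).
  have E0 : 0 <= E by rewrite mulr_ge0 ?powR_ge0//; lra.
  have [L L0 HL] := lip (N%:R^-1 * E).
  exists (L * (N%:R^-1 * E)) => s s1 x0.
  have ts := transfer_sind k2 s1 x0; rewrite -/E in ts.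
  have ts' : `|N%:R^-1 * transfer k v w s| <= N%:R^-1 * E * sind (v - w) s.
    by rewrite normrM ger0_norm// -mulrA ler_wpM2l.
  apply: (@le_trans _ _ (L * `|N%:R^-1 * transfer k v w s|)).
    apply: HL; apply: le_trans ts' _.
    by rewrite ler_piMr ?sind_le1// mulr_ge0.
  by rewrite -mulrA ler_wpM2l.
have I i j : ((\int[sphere_measure R d]_(s in S)
    (D (x i) (x j) s * B ((x i : 'rV[R]_d) - x j) s)%:E)%E \is a fin_num) /\
    fine (\int[sphere_measure R d]_(s in S)
      (D (x i) (x j) s * B ((x i : 'rV[R]_d) - x j) s)%:E)%E <=
    l * N%:R^-1 * pair_integral B (transfer k (x i) (x j)) ((x i : 'rV[R]_d) - x j) +
    q * N%:R^-1 ^+ 2 * pair_integral B (fun s => transfer k (x i) (x j) s ^+ 2)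
        ((x i : 'rV[R]_d) - x j).
  move: (x i : 'rV[R]_d) (x j : 'rV[R]_d) => v w.
  have [->|vw] := eqVneq v w.
    rewrite pair_integral_diag pair_integral_diag2 !mulr0 addr0.
    rewrite integral0_eq//; last first.
      by move=> s _; rewrite /D transfer_diag mulr0 addr0 subrr mul0r.
  have z0 : v - w != 0 by rewrite subr_eq0.
  have [L DLs] := DL v w vw.
  have ID := collision_integrable HB z0 (mD v w) DLs.
  have finD : (\int[sphere_measure R d]_(s in S) (D v w s * B (v - w) s)%:E)%E \is a fin_num.
    exact: integrable_fin_num.
  split => //.
  have mt : measurable_fun S (transfer k v w : V -> R).
    exact: measurable_funTS (measurable_transfer _ _ _).
  have mt2 : measurable_fun S (fun s : V => transfer k v w s ^+ 2).
    exact: measurable_funX.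
  have tS s := @transfer_sind _ _ k v w s k2.
  set E := k * _ in tS; have E0 : 0 <= E by rewrite mulr_ge0 ?powR_ge0//; lra.
  have tS2 (s : V) : enorm (s : 'rV[R]_d) = 1 -> 0 <= cosd (v - w) s ->
      `|transfer k v w s ^+ 2| <= E ^+ 2 * sind (v - w) s.
    move=> s1 x0; rewrite ger0_norm ?sqr_ge0// -real_normK ?num_real//.
    apply: (@le_trans _ _ (E ^+ 2 * sind (v - w) s ^+ 2)).
      rewrite -exprMn; have T := tS s s1 x0.
      by apply: lerXn2r => //; rewrite nnegrE ?normr_ge0// mulr_ge0 ?sind_ge0.
    by rewrite ler_wpM2l ?sqr_ge0// expr2 ler_piMr ?sind_ge0 ?sind_le1.
  have I1 := collision_integrable HB z0 mt tS.
  have I2 := collision_integrable HB z0 mt2 tS2.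
  rewrite -lee_fin fineK// EFinD [in leRHS]EFinM [X in (_ + X)%E]EFinM.
  rewrite -(pair_integralE HB z0 mt tS) -(pair_integralE HB z0 mt2 tS2).
  rewrite -!integralZl// -integralD//; [|exact: integrableZl..].
  apply: le_integral => //; first by apply: integrableD => //; exact: integrableZl.
  move=> s; rewrite inE => s1; rewrite -!EFinM -EFinD lee_fin !mulrA -mulrDl.
  rewrite ler_wpM2r ?B0//; apply: le_trans (tay _) _.
  by rewrite le_eqVlt; apply/orP; left; apply/eqP; ring.
rewrite generator_empirical.
  rewrite ler_wpM2l//; apply: ler_sum => i _; apply: ler_sum => j _.
  have [_] := I i j; apply: le_trans; rewrite le_eqVlt; apply/orP; left.
  by apply/eqP; congr fine; apply: eq_integral => s _; rewrite moment_jump.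
move=> i j; have [+ _] := I i j.
congr (_ \is a fin_num).
by apply: eq_integral => s _; rewrite moment_jump.
Qed.

End GeneratorBounds.

Section MomentGenerator.
Variables (R : realType) (d : nat).
Variables (gamma kappa1 kappa2 : R).
Hypotheses (g01 : 0 <= gamma <= 1) (k10 : 0 < kappa1) (k20 : 0 < kappa2).
Local Notation V := (vec R d).

(** The rate carries the factor [|v - w|^gamma], which degenerates for nearby
    velocities; but then the two speeds are comparable, so that the missing part
    of the negative term is absorbed in the mixed term. *)
Lemma pair_transfer_speeds k : 2 < k ->
  exists alpha beta : R, [/\ 0 < alpha, 0 < beta &
    forall B, collision_kernel gamma kappa1 kappa2 B ->
    forall v w : 'rV[R]_d,
    pair_integral B (transfer k v w) (v - w) <=
    - alpha * (enorm v `^ (k + gamma) + enorm w `^ (k + gamma)) +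
    beta * (enorm v * enorm w *
      (enorm v ^+ 2 + enorm w ^+ 2) `^ ((k + gamma) / 2 - 1))].
Proof.
move=> k2; have /andP[g0 g1] := g01.
have k00 : 0 <= k by lra.
pose c1 : R := 1 - 2 `^ (1 - k / 2).
have c10 : 0 < c1.
  rewrite /c1; have -> : 1 - k / 2 = - (k / 2 - 1) by ring.
  rewrite subr_gt0 powRN invf_lt1 ?powR_gt0//.
  have p1 : 1 `^ (k / 2 - 1) = 1 :> R by rewrite powR1.
  by rewrite -[ltLHS]p1; apply: gt0_ltr_powR; rewrite ?nnegrE ?ler01//; lra.
pose alpha := kappa2 / 2 * c1 / 4; pose beta := kappa2 / 2 * c1 + 3 * k * kappa1.
have a0 : 0 < alpha by rewrite !mulr_gt0.
have b0 : 0 < beta by rewrite addr_gt0 ?mulr_gt0//; lra.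
have ab : alpha * 2 <= beta.
  rewrite /beta /alpha; have : 0 < 3 * k * kappa1 by rewrite !mulr_gt0//; lra.
  have : 0 < kappa2 / 2 * c1 by rewrite !mulr_gt0.
  lra.
exists alpha, beta; split => // B HB v w.
set r := k + gamma; have r2 : 2 <= r by rewrite /r; lra.
set a := enorm v; set b := enorm w.
have av : 0 <= a := enorm_ge0 v; have bw : 0 <= b := enorm_ge0 w.
have [vw|vw] := eqVneq v w.
  have ba : b = a by rewrite /b -vw.
  rewrite -vw pair_integral_diag ba.
  have h : a `^ r <= a * a * (a ^+ 2 + a ^+ 2) `^ (r / 2 - 1).
    have [a00|an0] := eqVneq a 0.
      rewrite a00 powR0; first by rewrite !mul0r.
      by apply: lt0r_neq0; lra.
    have ap : 0 < a by rewrite lt_neqAle eq_sym an0.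
    apply: (@le_trans _ _ (a * a * (a ^+ 2) `^ (r / 2 - 1))).
      rewrite -expr2 -{1}(powRr1 (sqr_ge0 a)) -powRD; last first.
        by rewrite expf_eq0 (gt_eqF ap) /= implybT.
      by rewrite addrC subrK sqr_powR.
    rewrite ler_wpM2l ?mulr_ge0//; apply: le_powR2; rewrite ?sqr_ge0//; first lra.
    by rewrite lerDl sqr_ge0.
  have P0 := powR_ge0 a r.
  set X := a * a * _ in h *.
  have : alpha * 2 * a `^ r <= beta * X.
    apply: le_trans (_ : beta * a `^ r <= _); first by rewrite ler_wpM2r.
    by rewrite ler_wpM2l// ltW.
  lra.
apply: le_trans (pair_transfer_le HB (ltW k2) vw) _.
rewrite -/c1 -!enorm_sqr -/a -/b; set n := enorm (v - w).
have nab : `|a - b| <= n := enormB v w.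
have n0 : 0 <= n <= a + b.
  by rewrite enorm_ge0/= /n (le_trans (enormD v (- w)))// enormN.
have L1 := relative_speed_ge av bw nab (ltW k2) g01; rewrite -/r in L1.
have L2 := relative_speed_le av bw n0 g01.
set E := a ^+ 2 + b ^+ 2 in L1 L2 *.
have E0 : 0 <= E by rewrite addr_ge0 ?sqr_ge0.
set X := a * b * E `^ (r / 2 - 1) in L1 *.
have X0 : 0 <= X by rewrite !mulr_ge0 ?powR_ge0.
have L3 : n `^ gamma * (a * b * E `^ (k / 2 - 1)) <= 2 * X.
  have [E00|En0] := eqVneq E 0.
    have a00 : a = 0.
      apply/eqP; rewrite -sqrf_eq0; apply/eqP; apply: le_anti.
      by rewrite sqr_ge0 andbT -E00 /E lerDl sqr_ge0.
    by rewrite a00 !mul0r mulr0 mulr_ge0.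
  have -> : 2 * X = 2 * E `^ (gamma / 2) * (a * b * E `^ (k / 2 - 1)).
    have -> : E `^ (gamma / 2) = E `^ (r / 2 - 1 - (k / 2 - 1)).
      by congr (_ `^ _); rewrite /r; field.
    rewrite powRB; last by rewrite En0 implybT.
    by rewrite /X; field; rewrite gt_eqF// powR_gt0// lt_neqAle eq_sym En0.
  by rewrite ler_wpM2r// !mulr_ge0 ?powR_ge0.
have n1 := powR_ge0 n gamma.
have -> : n `^ gamma * (- (kappa2 / 2 * c1 * (a `^ k + b `^ k)) +
     3 * (k / 2) * kappa1 * (a * b) * E `^ (k / 2 - 1)) =
  - (kappa2 / 2 * c1) * (n `^ gamma * (a `^ k + b `^ k)) +
     3 * (k / 2) * kappa1 * (n `^ gamma * (a * b * E `^ (k / 2 - 1))) by ring.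
have K0 : 0 <= kappa2 / 2 * c1 by rewrite ltW// !mulr_gt0.
have M1 := ler_wpM2l K0 L1.
have K1 : 0 <= 3 * (k / 2) * kappa1 by rewrite !mulr_ge0 ?invr_ge0// ltW.
have M2 := ler_wpM2l K1 L3.
rewrite /alpha /beta; move: M1 M2; set P := a `^ r + b `^ r.
move: (X) (P) (n `^ gamma * (a `^ k + b `^ k)).
move: (n `^ gamma * (a * b * E `^ (k / 2 - 1))).
by clear; move=> U X P W; lra.
Qed.

Lemma sum_pair (N : nat) (f g : 'I_N -> R) :
  \sum_(i < N) \sum_(j < N) (f i * g j) = (\sum_(i < N) f i) * (\sum_(j < N) g j).
Proof.
by rewrite mulr_suml; apply: eq_bigr => i _; rewrite mulr_sumr.
Qed.

Lemma stateset_empirical N mu : stateset N mu -> exists2 x : 'I_N -> V,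
  mu = empirical x & (0 < N)%N ->
  N%:R^-1 * \sum_(i < N) enorm (x i : 'rV[R]_d) ^+ 2 = 1.
Proof.
move=> [[x ->] _ E]; exists x => // N0.
by rewrite -[RHS]E bracket_empirical.
Qed.

(** The drift of a moment is negative when the moment is large, uniformly in
    the number of particles: the mixed terms of the Povzner inequality are
    absorbed thanks to the normalisation of the energy. *)
Lemma mean_transfer_le k : 2 <= k ->
  exists c C : R, [/\ 0 < c, 0 <= C &
    forall N B (x : 'I_N -> V), (0 < N)%N -> collision_kernel gamma kappa1 kappa2 B ->
    N%:R^-1 * \sum_(i < N) enorm (x i : 'rV[R]_d) ^+ 2 = 1 ->
    N%:R^-1 * (N%:R^-1 * \sum_(i < N) \sum_(j < N)
      pair_integral B (transfer k (x i) (x j)) ((x i : 'rV[R]_d) - x j))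
    <= C - c * moment k (empirical x)].
Proof.
rewrite le_eqVlt => /orP[/eqP <-|k2].
  (* For [k = 2] the transfer vanishes and the moment equals [1]. *)
  exists 1, 1; split => // N B x N0 HB E1.
  rewrite big1 ?mulr0; last first.
    by move=> i _; rewrite big1// => j _; exact: pair_transfer2.
  rewrite mul1r moment_empirical//.
  have -> : \sum_(i < N) enorm (x i : 'rV[R]_d) `^ 2 =
      \sum_(i < N) enorm (x i : 'rV[R]_d) ^+ 2.
    by apply: eq_bigr => i _; rewrite powR_mulrn// enorm_ge0.
  by rewrite E1 subrr.
have [alpha [beta [a0 b0 HJ]]] := pair_transfer_speeds k2.
have /andP[g0 g1] := g01.
set r := k + gamma; have r2 : 2 <= r by rewrite /r; lra.
pose rho : R := 2 `^ (r / 2 - 1); have rho0 : 0 < rho by rewrite powR_gt0.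
(* Small enough for the mixed terms to take at most half of the negative one. *)
pose delta := alpha / (2 * beta * rho).
have d0 : 0 < delta by rewrite divr_gt0// !mulr_gt0.
pose D := delta^-1 `^ (r - 1); have D0 : 0 <= D by exact: powR_ge0.
exists alpha, (alpha + 2 * beta * rho * D); split => //.
  by rewrite addr_ge0// ?mulr_ge0// ltW// ?mulr_gt0.
move=> N B x N0 HB E1; set iN := N%:R^-1 in E1 *.
have iN0 : 0 <= iN by rewrite /iN invr_ge0.
have iNN : iN * N%:R = 1 by rewrite mulVf// pnatr_eq0 -lt0n.
pose e i := enorm (x i : 'rV[R]_d).
have e0 i : 0 <= e i by exact: enorm_ge0.
pose F := iN * \sum_(i < N) e i `^ r.
pose g i := delta * e i `^ r + D; pose h i := (1 + e i ^+ 2) / 2.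
have gF : iN * \sum_(i < N) g i = delta * F + D.
  rewrite big_split/= -mulr_sumr sumr_const card_ord -mulr_natr.
  have -> : iN * (delta * (\sum_(i < N) e i `^ r) + D * N%:R) =
    delta * (iN * \sum_(i < N) e i `^ r) + (iN * N%:R) * D by ring.
  by rewrite iNN mul1r.
have hF : iN * \sum_(i < N) h i = 1.
  rewrite -mulr_suml big_split/= sumr_const card_ord -/e.
  have -> : iN * ((N%:R + \sum_(i < N) e i ^+ 2) / 2) =
    (iN * N%:R + iN * \sum_(i < N) e i ^+ 2) / 2 by ring.
  by rewrite iNN E1; field.
have FM : moment k (empirical x) <= F + 1.
  rewrite moment_empirical// /F -[X in _ <= _ + X]iNN -mulrDr ler_wpM2l//.
  have -> : N%:R = \sum_(i < N) (1 : R) by rewrite sumr_const card_ord.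
  rewrite -big_split/=; apply: ler_sum => i _; rewrite -/(e i).
  have [e1|e1] := leP 1 (e i).
    apply: (@le_trans _ _ (e i `^ r)); last by rewrite lerDl.
    by apply: ler_powR => //; rewrite /r; lra.
  rewrite -[leLHS]add0r lerD ?powR_ge0//.
  rewrite -[leRHS](_ : 1 `^ k = 1); last by rewrite powR1.
  by apply: le_powR2 => //; [lra|exact: ltW].
have PJ i j : pair_integral B (transfer k (x i) (x j)) ((x i : 'rV[R]_d) - x j) <=
   - alpha * (e i `^ r * 1) + - alpha * (1 * e j `^ r) +
   beta * rho * (g i * h j) + beta * rho * (h i * g j).
  apply: le_trans (HJ B HB (x i) (x j)) _.
  have := cross_le (e0 i) (e0 j) r2 d0.
  rewrite -/D -/rho -/(g i) -/(g j) -/(h i) -/(h j) -/(e i) -/(e j) -/r => H.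
  have := ler_wpM2l (ltW b0) H.
  move: (e i * e j * _) (g i) (h j) (g j) (h i) (e i `^ r) (e j `^ r).
  by clear; move=> X gi hj gj hi ei ej; lra.
apply: (@le_trans _ _ (- alpha * F + - alpha * F +
    beta * rho * (delta * F + D) + beta * rho * (delta * F + D))).
  apply: (@le_trans _ _ (iN * (iN * \sum_(i < N) \sum_(j < N)
    (- alpha * (e i `^ r * 1) + - alpha * (1 * e j `^ r) +
     beta * rho * (g i * h j) + beta * rho * (h i * g j))))).
    do 2 rewrite ler_wpM2l//.
    by apply: ler_sum => i _; apply: ler_sum => j _; exact: PJ.
  have S1 : \sum_(i < N) (1 : R) = N%:R by rewrite sumr_const card_ord.
  have -> : \sum_(i < N) \sum_(j < N)
    (- alpha * (e i `^ r * 1) + - alpha * (1 * e j `^ r) +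
     beta * rho * (g i * h j) + beta * rho * (h i * g j)) =
    - alpha * ((\sum_(i < N) e i `^ r) * N%:R) +
    - alpha * (N%:R * (\sum_(i < N) e i `^ r)) +
    beta * rho * ((\sum_(i < N) g i) * (\sum_(i < N) h i)) +
    beta * rho * ((\sum_(i < N) h i) * (\sum_(i < N) g i)).
    rewrite -!S1 -!sum_pair !mulr_sumr -!big_split/=; apply: eq_bigr => i _.
    by rewrite !mulr_sumr -!big_split/=.
  rewrite le_eqVlt; apply/orP; left; apply/eqP.
  set s := \sum_(i < N) e i `^ r; set sg := \sum_(i < N) g i in gF *.
  set sh := \sum_(i < N) h i in hF *.
  have -> : iN * (iN * (- alpha * (s * N%:R) + - alpha * (N%:R * s) +
     beta * rho * (sg * sh) + beta * rho * (sh * sg))) =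
    - alpha * (iN * s) * (iN * N%:R) + - alpha * (iN * s) * (iN * N%:R) +
    beta * rho * (iN * sg) * (iN * sh) + beta * rho * (iN * sg) * (iN * sh) by ring.
  by rewrite iNN hF gF !mulr1.
have bd : beta * rho * delta = alpha / 2.
  by rewrite /delta; field; rewrite !gt_eqF.
have -> : - alpha * F + - alpha * F + beta * rho * (delta * F + D) +
    beta * rho * (delta * F + D) =
  - alpha * F + - alpha * F + 2 * (beta * rho * delta) * F + 2 * beta * rho * D.
  by ring.
rewrite bd; have := ler_wpM2l (ltW a0) FM; lra.
Qed.

Lemma generator_moment_le k : 2 <= k ->
  exists c C : R, [/\ 0 < c, 0 <= C &
    forall N B (mu : setfun R d), (0 < N)%N ->
    collision_kernel gamma kappa1 kappa2 B -> stateset N mu ->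
    generator N B (moment k) mu <= C - c * moment k mu].
Proof.
move=> k2; have [c [C [c0 C0 H]]] := mean_transfer_le k2.
exists c, C; split => // N B mu N0 HB /stateset_empirical[x -> /(_ N0) E1].
have lip r : exists2 L : R, 0 <= L & forall delta : R, `|delta| <= r ->
    `|(moment k (empirical x) + delta) - moment k (empirical x)| <= L * `|delta|.
  by exists 1 => // delta _; rewrite addrAC subrr add0r mul1r.
have := @generator_taylor _ _ _ N0 _ _ _ _ k id x 1 0 HB k2 (@measurable_id _ _ _) lip.
move=> /(_ (fun delta => _)) H1.
apply: le_trans (H1 _) _.
  by move=> delta; rewrite addrAC subrr add0r mul1r mul0r addr0.
apply: le_trans (H N B x N0 HB E1); rewrite ler_wpM2l ?invr_ge0// mulr_sumr.
apply: ler_sum => i _; rewrite mulr_sumr; apply: ler_sum => j _.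
by rewrite mul1r !mul0r addr0.
Qed.

(** The square makes the excess differentiable at the level, so that its expansion
    there has no first-order term. *)
Definition excess (m y : R) : R := Num.max (y - m) 0 ^+ 2.

(** For an excess over a level where the drift is negative, only the quadratic
    variation contributes, and it carries a factor [1/N]. *)
Lemma generator_excess_le p : 2 <= p ->
  exists C1 C2 : R, [/\ 0 <= C1, 0 < C2 &
    forall N B (mu : setfun R d) m, (0 < N)%N ->
    collision_kernel gamma kappa1 kappa2 B -> stateset N mu -> C1 <= m ->
    generator N B (fun mu => excess m (moment p mu)) mu <=
      C2 * N%:R^-1 * moment (2 * p + gamma) mu].
Proof.
move=> p2; have [c [C [c0 C0 H]]] := mean_transfer_le p2.
have /andP[g0 g1] := g01.
set r := 2 * p + gamma; have r2 : 2 <= r by rewrite /r; lra.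
have rh0 : 0 < r / 2 by lra.
have p0 : 0 < p by lra.
pose K : R := p ^+ 2 * kappa1 * (2 * 2 `^ (r / 2)).
have K0 : 0 < K by rewrite /K !mulr_gt0 ?powR_gt0//; lra.
exists (C / c), (2 * K); split; [by rewrite divr_ge0// ltW|by rewrite mulr_gt0|].
move=> N B mu m N0 HB /stateset_empirical[x -> /(_ N0) E1] mC.
set M := moment p (empirical x); pose y0 := Num.max (M - m) 0.
have y00 : 0 <= y0 by rewrite le_max lexx orbT.
have My0 : M - m <= y0 by rewrite le_max lexx.
have max_tri delta : 0 <= Num.max (M + delta - m) 0 <= y0 + `|delta|.
  rewrite le_max lexx orbT/= ge_max; apply/andP; split.
    by have := ler_norm delta; lra.
  by rewrite addr_ge0.
have max_lip delta : `|Num.max (M + delta - m) 0 - y0| <= `|delta|.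
  rewrite /y0 ler_norml; have := ler_norm delta; have := ler_norm (- delta).
  rewrite normrN => h1 h2.
  by have [] := leP (M + delta - m) 0; have [] := leP (M - m) 0; move=> *;
    apply/andP; split; lra.
have tay delta : excess m (M + delta) - excess m M <=
    2 * y0 * delta + 1 * delta ^+ 2.
  rewrite /excess -/y0.
  have h : Num.max (M + delta - m) 0 ^+ 2 <= (y0 + delta) ^+ 2.
    have [h|h] := leP (M + delta - m) 0; first by rewrite expr0n sqr_ge0.
    by rewrite lerXn2r ?nnegrE; lra.
  by move: h; rewrite sqrrD; lra.
have lip r0 : exists2 L : R, 0 <= L & forall delta : R, `|delta| <= r0 ->
    `|excess m (M + delta) - excess m M| <= L * `|delta|.
  exists (2 * y0 + `|r0|); first by rewrite addr_ge0// mulr_ge0.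
  move=> delta dr; rewrite /excess -/y0 subr_sqr normrM mulrC.
  apply: ler_pM => //; rewrite ger0_norm.
    have /andP[_ h] := max_tri delta; have := le_trans dr (ler_norm r0); lra.
  by have /andP[h _] := max_tri delta; rewrite addr_ge0.
have mex : measurable_fun setT (excess m).
  apply: measurable_funX; apply: measurable_maxr => //.
  exact: measurable_funB.
apply: le_trans (generator_taylor N0 HB p2 mex lip tay) _.
set iN := N%:R^-1 in E1 *.
have iN0 : 0 <= iN by rewrite /iN invr_ge0.
have iNN : iN * N%:R = 1 by rewrite mulVf// pnatr_eq0 -lt0n.
pose P1 i j := pair_integral B (transfer p (x i) (x j)) ((x i : 'rV[R]_d) - x j).
pose P2 i j := pair_integral B (fun s => transfer p (x i) (x j) s ^+ 2)
  ((x i : 'rV[R]_d) - x j).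
have -> : iN * (\sum_(i < N) \sum_(j < N) (2 * y0 * iN * P1 i j + 1 * iN ^+ 2 * P2 i j)) =
  2 * y0 * (iN * (iN * \sum_(i < N) \sum_(j < N) P1 i j)) +
  iN * (iN * (iN * \sum_(i < N) \sum_(j < N) P2 i j)).
  have -> : 2 * y0 * (iN * (iN * \sum_(i < N) \sum_(j < N) P1 i j)) +
    iN * (iN * (iN * \sum_(i < N) \sum_(j < N) P2 i j)) =
    iN * (2 * y0 * iN * (\sum_(i < N) \sum_(j < N) P1 i j) +
      iN ^+ 2 * (\sum_(i < N) \sum_(j < N) P2 i j)) by ring.
  congr (_ * _); rewrite !mulr_sumr -big_split/=; apply: eq_bigr => i _.
  by rewrite !mulr_sumr -big_split/=; apply: eq_bigr => j _; rewrite mul1r.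
have T1 : 2 * y0 * (iN * (iN * \sum_(i < N) \sum_(j < N) P1 i j)) <= 0.
  have [Mm|Mm] := leP M m.
    by have -> : y0 = 0; [rewrite /y0; apply: max_r; lra|rewrite mulr0 mul0r].
  have := H N B x N0 HB E1; rewrite -/iN -/M => H1.
  apply: mulr_ge0_le0; first exact: mulr_ge0.
  apply: le_trans H1 _; have : C <= M * c; last by lra.
  by rewrite -ler_pdivrMr//; lra.
pose e i := enorm (x i : 'rV[R]_d).
have e0 i : 0 <= e i by exact: enorm_ge0.
have Q i j : P2 i j <= K * (e i `^ r * 1) + K * (1 * e j `^ r).
  rewrite mulr1 mul1r -mulrDr.
  have e2 : 0 <= e i `^ r + e j `^ r by rewrite addr_ge0 ?powR_ge0.
  have [xij|xij] := eqVneq (x i : 'rV[R]_d) (x j).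
    rewrite /P2 xij pair_integral_diag2; exact: mulr_ge0 (ltW K0) e2.
  apply: le_trans (pair_transfer_sqr_le HB p2 xij) _.
  have pk : 0 <= p ^+ 2 * kappa1.
    by apply: mulr_ge0; [exact: sqr_ge0|exact: ltW].
  rewrite /K -[leRHS]mulrA ler_wpM2l// -!enorm_sqr -/(e i) -/(e j).
  have n0 : 0 <= enorm ((x i : 'rV[R]_d) - x j) <= e i + e j.
    by rewrite enorm_ge0/= (le_trans (enormD _ _))// enormN.
  have L2 := relative_speed_le (e0 i) (e0 j) n0 g01.
  set E := e i ^+ 2 + e j ^+ 2 in L2 *.
  have E0 : 0 <= E by rewrite addr_ge0 ?sqr_ge0.
  apply: (@le_trans _ _ (2 * E `^ (r / 2))).
    have [E00|En0] := eqVneq E 0.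
      by rewrite E00 !powR0 ?gt_eqF// !mulr0.
    have -> : E `^ (r / 2) = E `^ (gamma / 2) * E `^ p.
      rewrite -powRD; last by rewrite En0 implybT.
      by congr (_ `^ _); rewrite /r; field.
    by rewrite mulrA ler_wpM2r ?powR_ge0.
  rewrite -mulrA ler_wpM2l//.
  have := @powR_sum_le R (e i ^+ 2) (e j ^+ 2) (r / 2).
  by rewrite !sqr_powR//; apply; rewrite ?sqr_ge0// ltW.
have T2 : iN * (iN * \sum_(i < N) \sum_(j < N) P2 i j) <= 2 * K * moment r (empirical x).
  rewrite moment_empirical// -/iN.
  apply: (@le_trans _ _ (iN * (iN * \sum_(i < N) \sum_(j < N)
     (K * (e i `^ r * 1) + K * (1 * e j `^ r))))).
    do 2 rewrite ler_wpM2l//.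
    by apply: ler_sum => i _; apply: ler_sum => j _; exact: Q.
  have S1 : \sum_(i < N) (1 : R) = N%:R by rewrite sumr_const card_ord.
  have -> : \sum_(i < N) \sum_(j < N) (K * (e i `^ r * 1) + K * (1 * e j `^ r)) =
    K * ((\sum_(i < N) e i `^ r) * N%:R) + K * (N%:R * (\sum_(i < N) e i `^ r)).
    rewrite -!S1 -!sum_pair !mulr_sumr -!big_split/=; apply: eq_bigr => i _.
    by rewrite !mulr_sumr -!big_split/=.
  rewrite le_eqVlt; apply/orP; left; apply/eqP.
  set s := \sum_(i < N) e i `^ r.
  have -> : iN * (iN * (K * (s * N%:R) + K * (N%:R * s))) =
    2 * K * (iN * s) * (iN * N%:R) by ring.
  by rewrite iNN mulr1.
have := ler_wpM2l iN0 T2; rewrite -/iN; lra.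
Qed.

End MomentGenerator.

(** * Lipschitz functionals on the state space *)

Section StateSpaceFacts.
Variables (R : realType) (d N : nat).
Hypothesis N0 : (0 < N)%N.
Local Notation V := (vec R d).
Implicit Types mu nu : setfun R d.

Lemma state_speed_le (x : 'I_N -> V) i :
  N%:R^-1 * \sum_(j < N) enorm (x j : 'rV[R]_d) ^+ 2 = 1 ->
  enorm (x i : 'rV[R]_d) <= Num.sqrt N%:R.
Proof.
move=> E; rewrite -[leLHS](ger0_norm (enorm_ge0 _)) -sqrtr_sqr ler_wsqrtr//.
have -> : N%:R = \sum_(j < N) enorm (x j : 'rV[R]_d) ^+ 2.
  have n0 : N%:R != 0 :> R by rewrite pnatr_eq0 -lt0n.
  by apply: (mulfI (invr_neq0 n0)); rewrite E mulVf.
by rewrite (bigD1 i)//= lerDl sumr_ge0// => j _; rewrite sqr_ge0.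
Qed.

Lemma bracket_state_ge (g : R -> R) (b : R) mu : stateset N mu ->
  (forall y, 0 <= y <= Num.sqrt N%:R -> b <= g y) ->
  b <= bracket (fun v => g (enorm (v : 'rV[R]_d))) mu.
Proof.
move=> /stateset_empirical[x -> /(_ N0) E] gb; rewrite bracket_empirical//.
have -> : b = N%:R^-1 * (b *+ N).
  have n0 : N%:R != 0 :> R by rewrite pnatr_eq0 -lt0n.
  by rewrite -[b *+ N]mulr_natr mulrCA mulVf// mulr1.
rewrite ler_wpM2l ?invr_ge0// -[X in _ *+ X](card_ord N) -sumr_const.
by apply: ler_sum => i _; apply: gb; rewrite enorm_ge0 state_speed_le.
Qed.

Lemma bracket_state_le (g : R -> R) (b : R) mu : stateset N mu ->
  (forall y, 0 <= y <= Num.sqrt N%:R -> g y <= b) ->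
  bracket (fun v => g (enorm (v : 'rV[R]_d))) mu <= b.
Proof.
move=> Smu gb; rewrite -lerN2; have [x E _] := stateset_empirical Smu.
have -> : - bracket (fun v => g (enorm (v : 'rV[R]_d))) mu =
    bracket (fun v => - g (enorm (v : 'rV[R]_d))) mu.
  by rewrite E !bracket_empirical// sumrN mulrN.
by apply: (@bracket_state_ge (fun y => - g y)) => // y /gb; rewrite lerN2.
Qed.

Lemma w1_ge0 mu nu : (0 <= w1 mu nu)%E.
Proof.
apply: le_ereal_inf_tmp => _ [m _ <-]; apply: integral_ge0 => z _.
by rewrite lee_fin enorm_ge0.
Qed.

(** On [S_N] all speeds are at most [sqrt N], so a function of the speed may be
    truncated there, which makes it globally Lipschitz. *)
Lemma bracket_lipschitz (g : R -> R) (L : R) : 0 < L ->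
  measurable_fun setT g ->
  (forall y z, 0 <= y <= Num.sqrt N%:R -> 0 <= z <= Num.sqrt N%:R ->
    `|g y - g z| <= L * `|y - z|) ->
  w1_lipschitz N (@bracket R d (fun v => g (enorm (v : 'rV[R]_d)))).
Proof.
move=> L0 mg gL; exists L => mu nu Smu Snu.
rewrite -lee_pdivrMl//; apply: le_ereal_inf_tmp => _ [m cm <-].
rewrite lee_pdivrMl//.
pose M : R := Num.sqrt N%:R; have M0 : 0 <= M by exact: sqrtr_ge0.
pose f (v : V) : R := g (Num.min (enorm (v : 'rV[R]_d)) M).
have cl (v : V) : 0 <= Num.min (enorm (v : 'rV[R]_d)) M <= M.
  by rewrite le_min enorm_ge0 M0/= ge_min lexx orbT.
have mf : measurable_fun setT f.
  apply: measurableT_comp mg _; apply: measurable_minr => //.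
  exact: measurable_enorm.
have fb v : `|f v| <= `|g 0| + L * M.
  rewrite -[f v](subrK (g 0)) addrC; apply: le_trans (ler_normD _ _) _.
  rewrite lerD2l; have z0M : 0 <= (0 : R) <= M by rewrite lexx.
  apply: le_trans (gL _ _ (cl v) z0M) _; rewrite subr0 ler_wpM2l ?(ltW L0)//.
  by have /andP[h1 h2] := cl v; rewrite ger0_norm.
have marginal (pr : V * V -> V) (la : setfun R d) : measurable_fun setT pr ->
    (forall A, measurable A -> m (pr @^-1` A) = la A) -> stateset N la ->
    (\int[m]_z (f (pr z))%:E =
     (bracket (fun v => g (enorm (v : 'rV[R]_d))) la)%:E)%E /\
    m.-integrable setT (EFin \o (f \o pr)).
  move=> mpr mla /stateset_empirical[x lax /(_ N0) E].
  have I : m.-integrable setT (EFin \o (f \o pr)).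
    apply: measurable_bounded_integrable => //.
    - by apply: le_lt_trans (probability_le1 _ measurableT) _; exact: ltry.
    - exact: measurableT_comp.
    - exists (`|g 0| + L * M); split => [|y yb z _ /=]; first exact: num_real.
      by apply: le_trans (fb _) _; exact: ltW.
  split => //.
  rewrite -(@integral_pushforward _ _ _ _ _ _ mpr m setT (EFin \o f))//; last first.
    by apply/measurable_EFinP.
  transitivity (integral la setT (EFin \o f)).
    by apply: eq_setfun_integral => A mA; rewrite -mla.
  rewrite lax integral_empirical// bracket_empirical//; congr (_ * _)%:E.
  apply: eq_bigr => i _ /=; rewrite /f; congr g; apply: min_l.
  exact: state_speed_le.
have cm1 A : measurable A -> m (fst @^-1` A) = mu A.
  move=> mA; have [<- _] := cm A mA; congr (m _).
  by apply/seteqP; split => z //= [].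
have cm2 A : measurable A -> m (snd @^-1` A) = nu A.
  move=> mA; have [_ <-] := cm A mA; congr (m _).
  by apply/seteqP; split => z //= [].
have [E1 I1] := marginal fst mu measurable_fst cm1 Smu.
have [E2 I2] := marginal snd nu measurable_snd cm2 Snu.
have mD : measurable_fun setT (fun z : V * V =>
    enorm ((z.1 : 'rV[R]_d) - (z.2 : 'rV[R]_d))).
  apply: (@measurable_enorm R d _ _ (fun z : V * V => (z.1 : 'rV[R]_d) - z.2 : V)).
  apply: measurable_to_vec => i.
  apply: (@eq_measurable_fun _ _ _ _ setT
    (fun z : V * V => (z.1 : 'rV[R]_d) 0 i - (z.2 : 'rV[R]_d) 0 i)).
    by move=> z _; rewrite !mxE.
  by apply: measurable_funB; apply: measurableT_comp (measurable_coord i) _.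
rewrite -abse_EFin EFinB -E1 -E2 -integralB_EFin//.
apply: le_trans (le_abse_integral _ _ _) _ => //.
  by apply/measurable_EFinP; apply: measurable_funB; exact: measurableT_comp.
rewrite -ge0_integralZl_EFin ?(ltW L0)//; last 2 first.
- by move=> z _; rewrite lee_fin enorm_ge0.
- exact/measurable_EFinP.
apply: ge0_le_integral => //.
- apply: measurableT_comp => //; apply/measurable_EFinP.
  by apply: measurable_funB; exact: measurableT_comp.
- by apply: emeasurable_funM => //; exact/measurable_EFinP.
move=> z _; rewrite -EFinB abse_EFin -EFinM lee_fin /f.
apply: le_trans (gL _ _ (cl _) (cl _)) _; rewrite ler_wpM2l ?(ltW L0)//.
apply: le_trans (enormB z.1 z.2); rewrite !ler_norml.
set a := enorm z.1; set b := enorm z.2; have := ler_norm (a - b).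
have := ler_norm (b - a); rewrite distrC => h1 h2.
by have [] := leP a M; have [] := leP b M => *; apply/andP; split; lra.
Qed.

Lemma moment_w1_lipschitz p : 1 <= p -> w1_lipschitz N (@moment R d p).
Proof.
move=> p1; have M0 : 0 < Num.sqrt N%:R :> R by rewrite sqrtr_gt0 ltr0n.
apply: (@bracket_lipschitz (fun y => y `^ p) (p * Num.sqrt N%:R `^ (p - 1))).
- by rewrite mulr_gt0 ?powR_gt0// (lt_le_trans ltr01).
- exact: measurable_powR.
- by move=> y z; exact: powR_lipschitz.
Qed.

Lemma Lambda_w1_lipschitz p : 2 <= p -> w1_lipschitz N (@Lambda R d p).
Proof.
move=> p2; pose M : R := Num.sqrt N%:R.
have M0 : 0 < M by rewrite sqrtr_gt0 ltr0n.
apply: (@bracket_lipschitz (fun y => (1 + y ^+ 2) `^ (p / 2))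
  (p / 2 * (1 + M ^+ 2) `^ (p / 2 - 1) * (2 * M))).
- by rewrite !mulr_gt0 ?powR_gt0 ?addr_gt0 ?exprn_gt0//; lra.
- apply: measurableT_comp (measurable_powR _) _.
  by apply: measurable_funD => //; exact: measurable_funX.
move=> y z /andP[y0 yM] /andP[z0 zM].
have yi : 0 <= 1 + y ^+ 2 <= 1 + M ^+ 2.
  by rewrite addr_ge0 ?sqr_ge0//= lerD2l lerXn2r ?nnegrE// ltW.
have zi : 0 <= 1 + z ^+ 2 <= 1 + M ^+ 2.
  by rewrite addr_ge0 ?sqr_ge0//= lerD2l lerXn2r ?nnegrE// ltW.
apply: le_trans (powR_lipschitz _ yi zi) _; first lra.
rewrite -[leRHS]mulrA ler_wpM2l ?mulr_ge0 ?powR_ge0//; first lra.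
have -> : 1 + y ^+ 2 - (1 + z ^+ 2) = (y + z) * (y - z) by ring.
rewrite normrM ler_wpM2r// ger0_norm ?addr_ge0//.
by move: yM zM; rewrite -/M; lra.
Qed.

Lemma excess_lipschitz (m a b c : R) : 0 <= c -> `|a| <= c -> `|b| <= c ->
  `|excess m a - excess m b| <= 2 * (c + `|m|) * `|a - b|.
Proof.
move=> c0 ac bc; rewrite /excess subr_sqr normrM mulrC.
have h y : `|y| <= c -> 0 <= Num.max (y - m) 0 <= c + `|m|.
  move=> yc; rewrite le_max lexx orbT/= ge_max addr_ge0// andbT.
  apply: le_trans (ler_norm _) _; apply: le_trans (ler_normB _ _) _.
  by rewrite lerD2r.
apply: ler_pM => //.
  have /andP[h1 h2] := h a ac; have /andP[h3 h4] := h b bc.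
  by rewrite ger0_norm ?addr_ge0//; lra.
rewrite ler_norml; have := ler_norm (a - b); have := ler_norm (b - a).
rewrite distrC => h1 h2.
by have [] := leP (a - m) 0; have [] := leP (b - m) 0 => *; apply/andP; split; lra.
Qed.

Lemma moment_state p mu : 0 <= p -> stateset N mu ->
  0 <= moment p mu <= Num.sqrt N%:R `^ p.
Proof.
move=> p0 Smu; apply/andP; split.
  by apply: (@bracket_state_ge (fun y => y `^ p)) => // y _; exact: powR_ge0.
apply: (@bracket_state_le (fun y => y `^ p)) => // y /andP[y0 yM].
exact: le_powR2.
Qed.

Lemma excess_w1_lipschitz m p : 1 <= p ->
  w1_lipschitz N (fun mu : setfun R d => excess m (moment p mu)).
Proof.
move=> p1; have p0 : 0 <= p by exact: le_trans p1.
have [L H] := moment_w1_lipschitz p1.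
pose c : R := Num.sqrt N%:R `^ p; have c0 : 0 <= c by exact: powR_ge0.
exists (2 * (c + `|m|) * L) => mu nu Smu Snu.
have cb (la : setfun R d) : stateset N la -> `|moment p la| <= c.
  by move=> Sla; have /andP[h1 h2] := moment_state p0 Sla; rewrite ger0_norm.
apply: (@le_trans _ _ (2 * (c + `|m|) * `|moment p mu - moment p nu|)%:E).
  by rewrite lee_fin; apply: excess_lipschitz; rewrite ?cb.
rewrite EFinM [in leRHS]EFinM -muleA lee_wpmul2l ?H//.
by rewrite lee_fin mulr_ge0// addr_ge0.
Qed.

Lemma measurable_stateset : measurable (stateset N : set (state R d N)).
Proof.
apply: sub_sigma_algebra; split => // mu _; exists 1 => //.
Qed.

(** The sigma-algebra on [S_N] is the Borel one, so functions that are Lipschitz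
    for [w1] are measurable. *)
Lemma lipschitz_measurable (F : setfun R d -> R) : w1_lipschitz N F ->
  measurable_fun (stateset N : set (state R d N)) (F : state R d N -> R).
Proof.
move=> [L HL]; apply: (@measurability _ _ _ _ _ _ _ (RGenOInfty.measurableE R)).
move=> _ [_ [a ->] <-]; apply: sub_sigma_algebra; split => [mu []//|mu].
move=> [Smu]; rewrite /= in_itv/= andbT => aF.
pose L' := `|L| + 1; have L'0 : 0 < L' by rewrite ltr_wpDl.
exists ((F mu - a) / L'); first by rewrite divr_gt0// subr_gt0.
move=> nu Snu wnu; split => //; rewrite /= in_itv/= andbT.
have : (`|F mu - F nu|%:E <= L'%:E * w1 mu nu)%E.
  apply: le_trans (HL mu nu Smu Snu) _; apply: lee_wpmul2r; first exact: w1_ge0.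
  by rewrite lee_fin (le_trans (ler_norm L))// lerDl.
move=> h; have : (`|F mu - F nu|%:E < (F mu - a)%:E)%E.
  apply: le_lt_trans h _; rewrite -lte_pdivlMl//.
  by rewrite -EFinM mulrC.
rewrite lte_fin => h2; have := le_lt_trans (ler_norm _) h2; lra.
Qed.

End StateSpaceFacts.

(** * One step of the Markov process *)

Section Disintegration.
Local Open Scope ereal_scope.
Context d1 d2 (T : measurableType d1) (U : measurableType d2) (R : realType).
Variables (P : {measure set T -> \bar R}) (D : set T) (Y : T -> U).
Variable k : T -> {measure set U -> \bar R}.
Hypotheses (mD : measurable D) (mY : measurable_fun setT Y).
Hypothesis mk : forall A, measurable A -> measurable_fun setT (k ^~ A).
Hypothesis PYk : forall A, measurable A ->
  P (D `&` Y @^-1` A) = \int[P]_(x in D) k x A.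

Lemma nnsfun_disintegration (h : {nnsfun U >-> R}) :
  \int[P]_(x in D) (h (Y x))%:E = \int[P]_(x in D) \int[k x]_y (h y)%:E.
Proof.
have mh r : measurable (h @^-1` [set r]).
  by [].
transitivity (\sum_(r \in range h) (r%:E * P (D `&` Y @^-1` (h @^-1` [set r])))).
  under eq_integral do rewrite fimfunE -fsumEFin//.
  rewrite ge0_integral_fsum//; last 2 first.
  - move=> r; apply: measurable_funTS; apply/measurable_EFinP.
    by apply: measurable_funM => //; exact: measurableT_comp.
  - by move=> r z _; rewrite EFinM nnfun_muleindic_ge0.
  apply: eq_fsbigr => r; rewrite inE => -[u _ hu].
  have r0 : (0 <= r)%R by rewrite -hu.
  have mi : measurable_fun D (fun x => (\1_(h @^-1` [set r]) (Y x))%:E : \bar R).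
    apply: measurable_funTS; apply/measurable_EFinP.
    exact: measurableT_comp.
  under eq_integral do rewrite EFinM.
  rewrite ge0_integralZl//.
  congr (_ * _).
  rewrite -[X in integral _ _ X]/(fun x => (\1_(Y @^-1` (h @^-1` [set r])) x)%:E).
  rewrite integral_indic//; first by rewrite setIC.
  by rewrite -[X in measurable X]setTI; exact: mY.
under [RHS]eq_integral.
  move=> x _.
  rewrite integral_nnsfun// patch_setT sintegralE.
  over.
rewrite ge0_integral_fsum//; last 2 first.
- by move=> r; apply: measurable_funTS; apply: measurable_funeM; exact: mk.
- move=> r x _; have [r0|r0] := leP 0%R r; first exact: mule_ge0.
  by rewrite preimage_nnfun0// measure0 mule0.
apply: eq_fsbigr => r; rewrite inE => -[u _ hu].
have r0 : (0 <= r)%R by rewrite -hu.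
rewrite ge0_integralZl//; first by rewrite PYk.
by apply: measurable_funTS; exact: mk.
Qed.

(** The Markov property is stated for events; simple functions and monotone
    convergence extend it to expectations. *)
Lemma ge0_disintegration (f : U -> \bar R) :
  (forall y, 0 <= f y) -> measurable_fun setT f ->
  \int[P]_(x in D) f (Y x) = \int[P]_(x in D) \int[k x]_y f y.
Proof.
move=> f0 mf; pose h := nnsfun_approx measurableT mf.
have fE y : f y = lim ((h n y)%:E @[n --> \oo]).
  by apply/esym/cvg_lim => //; exact: cvg_nnsfun_approx.
have nd y : nondecreasing_seq (fun n => (h n y)%:E).
  by move=> a b ab; rewrite lee_fin; exact/lefP/nd_nnsfun_approx.
have mhY n : measurable_fun D (fun x => (h n (Y x))%:E).
  by apply: measurable_funTS; apply/measurable_EFinP; exact: measurableT_comp.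
under eq_integral do rewrite fE.
rewrite monotone_convergence//; last by move=> n x _; rewrite lee_fin.
under [X in lim (X @ _)]funext do rewrite nnsfun_disintegration.
rewrite -monotone_convergence//; last 3 first.
- move=> n; apply: measurable_funTS; apply: measurable_fun_integral_kernel => //.
    by move=> z; rewrite lee_fin.
  exact/measurable_EFinP.
- by move=> n x _; apply: integral_ge0 => y _; rewrite lee_fin.
- move=> x _ a b ab; apply: ge0_le_integral => //.
  + by move=> y _; rewrite lee_fin.
  + exact/measurable_EFinP.
  + exact/measurable_EFinP.
  + by move=> y _; exact: nd.
apply: eq_integral => x _; rewrite -monotone_convergence//.
- by apply: eq_integral => y _; rewrite -fE.
- by move=> n; exact/measurable_EFinP.
- by move=> n y _; rewrite lee_fin.
Qed.

End Disintegration.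

Section MarkovStep.
Variables (R : realType) (d N : nat).
Variables (dO : measure_display) (Omega : measurableType dO).
Variables (P : probability Omega R) (X : R -> Omega -> state R d N).
Local Notation E := (state R d N).
Local Notation SN := (@stateset R d N : set E).

Lemma history_measurable s (H : set Omega) :
  (forall t, 0 <= t -> measurable_fun setT (X t)) -> history X s H -> measurable H.
Proof.
move=> mX; apply: smallest_sub; first exact: sigma_algebra_measurable.
move=> _ [r [A [/andP[r0 _] mA ->]]].
by rewrite -[X in measurable X]setTI; exact: mX.
Qed.

Lemma history_le s t : s <= t -> history X s `<=` history X t.
Proof.
move=> st; apply: smallest_sub; first exact: smallest_sigma_algebra.
move=> _ [r [A [/andP[r0 rs] mA ->]]]; apply: sub_sigma_algebra.
by exists r, A; split => //; rewrite r0 (le_trans rs st).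
Qed.

Lemma historyI s (H K : set Omega) :
  history X s H -> history X s K -> history X s (H `&` K).
Proof.
exact: (@measurableI _ (g_sigma_algebraType [set H | exists (r : R) (A : set E),
         [/\ 0 <= r <= s, measurable A & H = X r @^-1` A]])).
Qed.

Lemma history_bigcap s (D : set nat) (F : nat -> set Omega) : finite_set D ->
  (forall i, D i -> history X s (F i)) -> history X s (\bigcap_(i in D) F i).
Proof.
exact: (@fin_bigcap_measurable _ (g_sigma_algebraType [set H | exists (r : R) (A : set E),
         [/\ 0 <= r <= s, measurable A & H = X r @^-1` A]])).
Qed.

Hypothesis mX : forall t, 0 <= t -> measurable_fun setT (X t).
Hypothesis cX : forall om, cadlag (X ^~ om).
Variable p : R -> R.-pker E ~> E.
Hypotheses (sgp : transition_semigroup p) (mkX : markov_with P p X).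

Lemma path_state t om : 0 <= t -> SN (X t om).
Proof. by move=> t0; have [h _ _] := cX om; exact: h. Qed.

(** Lipschitz functionals inherit the right-continuity of the paths. *)
Lemma path_above (F : setfun R d -> R) om t lev : w1_lipschitz N F -> 0 <= t ->
  lev < F (X t om) -> \forall s \near t^'+, lev < F (X s om).
Proof.
move=> [L HL] t0 lt; have [_ cr _] := cX om.
pose L' := `|L| + 1; have L'0 : 0 < L' by rewrite ltr_wpDl.
have e0 : 0 < (F (X t om) - lev) / L' by rewrite divr_gt0// subr_gt0.
near=> s; have ts : t < s by [].
have s0 : 0 <= s by rewrite (le_trans t0)// ltW.
have w : (w1 (X t om) (X s om) < ((F (X t om) - lev) / L')%:E)%E.
  near: s; apply: (cr t t0 [set y | (y < ((F (X t om) - lev) / L')%:E)%E]).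
  by apply: open_nbhs_nbhs; split => //=; exact: open_ereal_lt_ereal.
have := HL _ _ (path_state om t0) (path_state om s0).
have : (L%:E * w1 (X t om) (X s om) <= L'%:E * w1 (X t om) (X s om))%E.
  apply: lee_wpmul2r; first exact: w1_ge0.
  by rewrite lee_fin (le_trans (ler_norm L))// lerDl.
move=> h1 /le_trans/(_ h1) h2.
have : (`|F (X t om) - F (X s om)|%:E < (F (X t om) - lev)%:E)%E.
  apply: le_lt_trans h2 _; rewrite -lte_pdivlMl//.
  by rewrite -EFinM mulrC.
rewrite lte_fin => h; have := le_lt_trans (ler_norm _) h; lra.
Unshelve. all: by end_near.
Qed.

Lemma path_measurable (F : E -> R) t : 0 <= t -> measurable_fun SN F ->
  measurable_fun setT (F \o X t).
Proof.
move=> t0 mF; apply: (measurable_comp (@measurable_stateset R d N) _ mF (mX t0)).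
by move=> _ [om _ <-]; exact: path_state.
Qed.

Lemma history_path (F : E -> R) (V : set R) r s : 0 <= r <= s ->
  measurable_fun SN F -> measurable V -> history X s ((F \o X r) @^-1` V).
Proof.
move=> /andP[r0 rs] mF mV; apply: sub_sigma_algebra; exists r, (SN `&` F @^-1` V).
split; first by rewrite r0.
  by apply: mF => //; exact: measurable_stateset.
apply/seteqP; split => om /=; last by case.
by split => //; exact: path_state.
Qed.

Lemma markov_expectation s t H (F : E -> R) : 0 <= s -> 0 <= t ->
  history X s H -> (forall mu, SN mu -> 0 <= F mu) -> measurable_fun SN F ->
  (\int[P]_(om in H) (F (X (s + t) om))%:E =
   \int[P]_(om in H) \int[p t (X s om)]_(nu in SN) (F nu)%:E)%E.
Proof.
move=> s0 t0 hH F0 mF; have mS := @measurable_stateset R d N.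
pose G : E -> \bar R := (EFin \o F) \_ SN.
have G0 mu : (0 <= G mu)%E.
  by rewrite /G patchE; case: ifPn => // /set_mem Smu; rewrite lee_fin F0.
have mG : measurable_fun setT G.
  by apply/(measurable_restrictT _ mS)/measurable_EFinP.
have mk A : measurable A -> measurable_fun setT (fun om => p t (X s om) A).
  by move=> mA; apply: measurableT_comp (measurable_kernel (p t) A mA) (mX s0).
transitivity (\int[P]_(om in H) G (X (s + t) om))%E.
  apply: eq_integral => om _; rewrite /G patchE mem_set//.
  by apply: path_state; exact: addr_ge0.
rewrite (@ge0_disintegration _ _ _ _ _ P H (X (s + t)) (fun om => p t (X s om)))//.
- by apply: eq_integral => om _; rewrite [RHS]integral_mkcond.
- exact: history_measurable hH.
- by apply: mX; exact: addr_ge0.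
- by move=> A mA; exact: mkX.
Qed.

Lemma markov_step s t H (F U : E -> R) b : 0 <= s -> 0 <= t -> history X s H ->
  measurable_fun SN F -> measurable_fun SN U ->
  (forall mu, SN mu -> 0 <= F mu <= b) ->
  (forall mu, SN mu -> fine (\int[p t mu]_(nu in SN) (F nu)%:E)%E <= U mu) ->
  (\int[P]_(om in H) (F (X (s + t) om))%:E <= \int[P]_(om in H) (U (X s om))%:E)%E.
Proof.
move=> s0 t0 hH mF mU Fb FU; have mS := @measurable_stateset R d N.
have F0 mu : SN mu -> 0 <= F mu by move=> /Fb/andP[].
rewrite markov_expectation//.
have I0 mu : (0 <= \int[p t mu]_(nu in SN) (F nu)%:E)%E.
  by apply: integral_ge0 => nu Snu; rewrite lee_fin F0.
have IU mu : SN mu -> (\int[p t mu]_(nu in SN) (F nu)%:E <= (U mu)%:E)%E.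
  move=> Smu; rewrite -[leLHS]fineK ?lee_fin ?FU//.
  rewrite ge0_fin_numE//; apply: (@le_lt_trans _ _ (\int[p t mu]_(nu in SN) b%:E)%E).
    apply: ge0_le_integral => //.
    - exact/measurable_EFinP.
    - by move=> nu /Fb/andP[_]; rewrite lee_fin.
  have [p1 _ _] := sgp.
  by rewrite integral_cst// p1// mule1 ltry.
have mH := history_measurable mX hH.
apply: ge0_le_integral => //.
- apply: measurable_funTS.
  have mI : measurable_fun setT (fun mu => \int[p t mu]_(nu in SN) (F nu)%:E)%E.
    have -> : (fun mu : E => \int[p t mu]_(nu in SN) (F nu)%:E)%E =
        (fun mu : E => \int[p t mu]_nu ((EFin \o F) \_ SN) nu)%E.
      by apply/funext => mu; rewrite integral_mkcond.
    apply: measurable_fun_integral_kernel.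
    + by move=> A mA; exact: measurable_kernel.
    + move=> mu; rewrite patchE; case: ifPn => // /set_mem Smu.
      by rewrite lee_fin F0.
    + by apply/(measurable_restrictT _ mS)/measurable_EFinP.
  exact: measurableT_comp mI (mX s0).
- by apply: measurable_funTS; apply/measurable_EFinP; exact: path_measurable.
- by move=> om _; apply: IU; exact: path_state.
Qed.

(** The limit that defines the generator is uniform in the starting state, so the
    error of a time step is [e h] with [e] as small as wanted. *)
Lemma generates_le (F GF : E -> R) e : generates p F GF -> 0 < e ->
  \forall h \near 0^'+, forall mu, SN mu ->
    fine (\int[p h mu]_(nu in SN) (F nu)%:E)%E <= F mu + h * (GF mu + e).
Proof.
move=> gF e0; near=> h => mu Smu.
have h0 : 0 < h by [].
have := (near (gF e e0) h) _ mu Smu; rewrite ler_norml => /(_ _)/andP[]//.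
move=> _; rewrite lerBlDr ler_pdivrMr// mulrC lerBlDr addrC [e + _]addrC.
by [].
Unshelve. all: by end_near.
Qed.

End MarkovStep.

(** * Maximal inequality *)

Section DiscreteMaximal.
Local Open Scope ereal_scope.
Context dO (Omega : measurableType dO) (R : realType).
Variable P : probability Omega R.
Variables (B : nat -> set Omega) (e : nat -> Omega -> R) (lvl l : R).
Hypotheses (mB : forall k, measurable (B k)) (Bdec : forall k, B k.+1 `<=` B k).
Hypotheses (me : forall k, measurable_fun setT (e k))
  (e_ge0 : forall k om, (0 <= e k om)%R) (lvl_ge0 : (0 <= lvl)%R).
Hypothesis estart : forall om, B 0 om -> e 0 om = 0%R.
Hypothesis ejump : forall k om, B k om -> ~ B k.+1 om -> (lvl <= e k.+1 om)%R.
Hypothesis edrift : forall k,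
  \int[P]_(om in B k) (e k.+1 om)%:E <= \int[P]_(om in B k) (e k om)%:E + l%:E.

(** [B k] is the event that the level has not been exceeded by the time [k]. What
    leaves it carries a mass at least [lvl] times its probability, so the mass of
    [e] on [B k] and the weighted probability of having left grow together by at
    most [l] per step. *)
Lemma discrete_maximal k : lvl%:E * P (B 0 `\` B k) <= (k%:R * l)%:E.
Proof.
suff : \int[P]_(om in B k) (e k om)%:E + lvl%:E * P (B 0 `\` B k) <= (k%:R * l)%:E.
  by apply: le_trans; apply: leeDr; apply: integral_ge0 => om _; rewrite lee_fin.
have mD j i : measurable (B j `\` B i) by exact: measurableD.
have mE i (D : set Omega) : measurable_fun D (fun om => (e i om)%:E).
  by apply: measurable_funTS; exact/measurable_EFinP.
have B0k j : B j `<=` B 0.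
  by elim: j => // j IH; apply: subset_trans IH.
elim: k => [|k IH].
  rewrite setDv measure0 mule0 adde0 mul0r integral0_eq// => om B0.
  by rewrite estart.
have split : P (B 0 `\` B k.+1) = P (B 0 `\` B k) + P (B k `\` B k.+1).
  rewrite -measureU//.
    congr (P _); apply/seteqP; split => om /=.
      by move=> [b0 bk]; have [|] := pselect (B k om); [right|left].
    move=> [[b0 bk]|[bk bk1]]; split => //; last exact: B0k bk.
    by move=> /Bdec.
  by apply/seteqP; split => om //= [[_ ?] []].
have jump : lvl%:E * P (B k `\` B k.+1) <=
    \int[P]_(om in B k `\` B k.+1) (e k.+1 om)%:E.
  rewrite -integral_cst//; apply: ge0_le_integral => //.
  by move=> om [bk bk1]; rewrite lee_fin ejump.
have part : \int[P]_(om in B k) (e k.+1 om)%:E =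
    \int[P]_(om in B k.+1) (e k.+1 om)%:E +
    \int[P]_(om in B k `\` B k.+1) (e k.+1 om)%:E.
  rewrite -ge0_integral_setU//.
  + by rewrite setDUK//.
  + by move=> om _; rewrite lee_fin.
  + by apply/disj_setPS => om /= [? []].
rewrite split ge0_muleDr//.
apply: le_trans (_ : \int[P]_(om in B k) (e k.+1 om)%:E +
    lvl%:E * P (B 0 `\` B k) <= _).
  rewrite part -[leRHS]addeA [X in _ <= _ + X]addeC.
  by apply: leeD => //; exact: leeD.
apply: le_trans (_ : \int[P]_(om in B k) (e k om)%:E + l%:E +
    lvl%:E * P (B 0 `\` B k) <= _); first exact: leeD.
by rewrite addeAC -natr1 mulrDl mul1r EFinD; apply: leeD.
Qed.

End DiscreteMaximal.

Lemma near_dyadic (R : realType) (Q : R -> Prop) (T : R) : 0 < T ->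
  (\forall h \near 0^'+, Q h) ->
  exists l0, forall l, (l0 <= l)%N -> Q (T / 2 ^+ l).
Proof.
move=> T0 /nbhs_ballP[/= e e0 eQ].
exists (Num.bound (T / e)) => l ll.
have h0 : 0 < T / 2 ^+ l by rewrite divr_gt0// exprn_gt0.
apply: eQ => //=; rewrite /ball/= sub0r normrN gtr0_norm//.
rewrite ltr_pdivrMr ?exprn_gt0// mulrC -ltr_pdivrMr//.
apply: (@lt_le_trans _ _ (Num.bound (T / e))%:R).
  by apply: archi_boundP; rewrite divr_ge0 ?ltW.
by rewrite -natrX ler_nat (leq_trans ll)// ltnW// ltn_expl.
Qed.

Lemma dyadic_dense (R : realType) (Q : R -> Prop) (t T : R) : 0 <= t -> t < T ->
  (\forall s \near t^'+, Q s) ->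
  exists l, exists2 j : nat, (j <= 2 ^ l)%N & Q (j%:R * (T / 2 ^+ l)).
Proof.
move=> t0 tT /nbhs_ballP[/= e e0 eQ]; have T0 : 0 < T by exact: le_lt_trans tT.
have me : 0 < Num.min e (T - t) by rewrite lt_min e0 subr_gt0.
have [l /(_ l (leqnn l))] := near_dyadic T0 (nbhs_right_lt me).
set h := T / 2 ^+ l; rewrite lt_min => /andP[he hT].
have h0 : 0 < h by rewrite divr_gt0// exprn_gt0.
have /truncn_itv/andP[] : 0 <= t / h by rewrite divr_ge0// ltW.
set j := Num.truncn _; rewrite ler_pdivlMr// ltr_pdivrMr// => jt tj.
have jh : j.+1%:R * h <= t + h by rewrite -natr1 mulrDl mul1r lerD2r.
exists l, j.+1.
  rewrite -(ler_nat R) natrX -(ler_pM2r h0).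
  have -> : 2 ^+ l * h = T by rewrite /h mulrC divfK// expf_neq0.
  by apply: le_trans jh _; rewrite -lerBrDl ltW.
apply: eQ => //=; rewrite /ball/= ltr0_norm; last by rewrite subr_lt0.
by rewrite opprB ltrBlDl (le_lt_trans jh)// ltrD2l.
Qed.

Lemma le_sqr_limit (R : realType) (y k eps : R) : 0 <= k -> 0 < eps ->
  (forall delta, 0 < delta -> delta < eps -> y <= k / (eps - delta) ^+ 2) ->
  y <= k / eps ^+ 2.
Proof.
move=> k0 ep0 H; have ep2 : 0 < eps ^+ 2 by rewrite exprn_gt0.
rewrite ler_pdivlMr// leNgt; apply/negP => ky.
have y0 : 0 < y by rewrite -(pmulr_lgt0 _ ep2); exact: le_lt_trans ky.
pose delta := (y * eps ^+ 2 - k) / (4 * y * eps).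
have d0 : 0 < delta by rewrite divr_gt0 ?subr_gt0// !mulr_gt0.
have dE : 2 * y * eps * delta = (y * eps ^+ 2 - k) / 2.
  by rewrite /delta; field; rewrite !gt_eqF.
have de : delta < eps.
  rewrite /delta ltr_pdivrMr ?mulr_gt0//.
  have -> : eps * (4 * y * eps) = 4 * (y * eps ^+ 2) by ring.
  have : 0 < y * eps ^+ 2 by rewrite mulr_gt0.
  lra.
have := H delta d0 de; rewrite ler_pdivlMr ?exprn_gt0 ?subr_gt0//.
have -> : y * (eps - delta) ^+ 2 =
  y * eps ^+ 2 - 2 * y * eps * delta + y * delta ^+ 2 by ring.
have : 0 < y * delta ^+ 2 by rewrite mulr_gt0// exprn_gt0.
rewrite dE; lra.
Qed.

Section KacMaximal.
Variables (R : realType) (d N : nat).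
Hypothesis N0 : (0 < N)%N.
Variables (dO : measure_display) (Omega : measurableType dO).
Variables (P : probability Omega R) (X : R -> Omega -> state R d N).
Local Notation E := (state R d N).
Local Notation SN := (@stateset R d N : set E).
Hypothesis mX : forall t, 0 <= t -> measurable_fun setT (X t).
Hypothesis cX : forall om, cadlag (X ^~ om).
Variable sg : R -> R.-pker E ~> E.
Hypotheses (sgp : transition_semigroup sg) (mkX : markov_with P sg X).
Variables (p r : R).
Hypotheses (p1 : 1 <= p) (r1 : 1 <= r).
(** [G] and [Gex m] stand for the generator applied to the moment of order [r] and
    to the excess of the moment of order [p] over [m]; only their upper bounds
    matter. *)
Variables (G : E -> R) (c C C1 C2 : R).
Hypotheses (c0 : 0 < c) (C0 : 0 <= C) (C20 : 0 <= C2).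
Variable Gex : R -> E -> R.
Hypothesis genr : generates sg (@moment R d r : E -> R) G.
Hypothesis driftr : forall mu, SN mu -> G mu <= C - c * moment r mu.
Hypothesis genx : forall m,
  generates sg ((fun mu => excess m (moment p mu)) : E -> R) (Gex m).
Hypothesis driftx : forall m mu, SN mu -> C1 <= m ->
  Gex m mu <= C2 * moment r mu.

Let X_state t om : 0 <= t -> SN (X t om) := path_state cX om (t := t).

Let measurable_moment k t : 1 <= k -> 0 <= t ->
  measurable_fun setT (fun om => moment k (X t om)).
Proof.
move=> k1 t0; apply: (path_measurable mX cX t0 (F := @moment R d k : E -> R)).
by apply: lipschitz_measurable => //; exact: moment_w1_lipschitz.
Qed.

Let moment_ge0 k t om : 0 <= k -> 0 <= t -> 0 <= moment k (X t om).
Proof.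
by move=> k0 t0; have /andP[] := moment_state N0 k0 (X_state om t0).
Qed.

(** Each step multiplies the moment by at most [1 - h c] and adds [h (C + 1)], so
    it cannot rise above the initial bound by more than the equilibrium value
    [(C + 1) / c]. *)
Lemma moment_grid H a : 0 <= a -> history X 0 H ->
  (\int[P]_(om in H) (moment r (X 0 om))%:E <= a%:E * P H)%E ->
  \forall h \near 0^'+, forall k : nat,
    (\int[P]_(om in H) (moment r (X (k%:R * h) om))%:E <=
      (a + (C + 1) / c)%:E * P H)%E.
Proof.
move=> a0 hH H0; have r0 : 0 <= r by exact: le_trans r1.
have mH := history_measurable mX hH.
set x := fine (P H); have PH : P H = x%:E by rewrite fineK ?fin_num_measure.
have x0 : 0 <= x by exact: fine_ge0.
near=> h; have h0 : 0 < h by [].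
have hc : h * c <= 1.
  rewrite -ler_pdivlMr// div1r; near: h; apply: nbhs_right_le.
  by rewrite invr_gt0.
have step : forall mu, SN mu ->
    fine (\int[sg h mu]_(nu in SN) (moment r nu)%:E)%E <=
    (1 - h * c) * moment r mu + h * (C + 1).
  move=> mu Smu; apply: (@le_trans _ _ (moment r mu + h * (G mu + 1))).
    by move: mu Smu; near: h; exact: generates_le.
  have := ler_wpM2l (ltW h0) (driftr Smu); lra.
have hc0 : 0 <= 1 - h * c by lra.
have hC0 : 0 <= h * (C + 1) by rewrite mulr_ge0 ?addr_ge0// ltW.
have mlip : measurable_fun SN (@moment R d r : E -> R).
  by apply: lipschitz_measurable => //; exact: moment_w1_lipschitz.
elim=> [|k IH].
  rewrite mul0r; apply: le_trans H0 _; rewrite PH -!EFinM lee_fin.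
  by rewrite ler_wpM2r// lerDl divr_ge0 ?addr_ge0// ltW.
have s0 : 0 <= k%:R * h by rewrite mulr_ge0// ltW.
rewrite -natr1 mulrDl mul1r.
have hHs : history X (k%:R * h) H by exact: history_le hH.
apply: le_trans (markov_step mX cX sgp mkX s0 (ltW h0) hHs mlip _ _ step) _.
- apply: measurable_funD => //; exact: measurable_funM.
- by move=> mu; exact: moment_state.
under eq_integral do rewrite EFinD EFinM.
have mQ : measurable_fun H (fun om => (moment r (X (k%:R * h) om))%:E).
  by apply: measurable_funTS; apply/measurable_EFinP; exact: measurable_moment.
rewrite ge0_integralD//; last 2 first.
- by move=> om _; rewrite mule_ge0// lee_fin ?moment_ge0.
- exact: measurable_funeM.
rewrite ge0_integralZl_EFin//; last by move=> om _; rewrite lee_fin moment_ge0.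
have -> : (\int[P]_(om in H) (h * (C + 1))%:E = (h * (C + 1) * x)%:E)%E.
  by rewrite integral_cst// [RHS](EFinM _ x) -PH.
rewrite PH -EFinM.
apply: (@le_trans _ _ ((1 - h * c)%:E * ((a + (C + 1) / c)%:E * x%:E) +
    (h * (C + 1) * x)%:E)%E).
  by apply: leeD => //; apply: lee_wpmul2l; rewrite ?lee_fin// -PH.
rewrite -!EFinM -EFinD lee_fin.
have -> : (1 - h * c) * ((a + (C + 1) / c) * x) + h * (C + 1) * x =
    (a + (C + 1) / c - h * c * a) * x by field; rewrite gt_eqF.
rewrite ler_wpM2r// gerBl !mulr_ge0// ltW//.
Unshelve. all: by end_near.
Qed.

(** Until the moment exceeds [m + eps] the expected excess over [m] grows at a rate
    at most [C2 b + e]; when it does so, the excess is at least [eps ^+ 2]. *)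
Lemma maximal_grid H m b e eps : history X 0 H ->
  (forall om, H om -> moment p (X 0 om) <= m) -> C1 <= m ->
  0 <= b -> 0 < e -> 0 < eps ->
  (\forall h \near 0^'+, forall k : nat,
    (\int[P]_(om in H) (moment r (X (k%:R * h) om))%:E <= b%:E * P H)%E) ->
  \forall h \near 0^'+, forall k : nat,
    ((eps ^+ 2)%:E * P (H `&` [set om | exists2 j : nat, (j <= k)%N &
        (m + eps <= moment p (X (j%:R * h) om))%R])
     <= (k%:R * (h * (C2 * b + e)))%:E * P H)%E.
Proof.
move=> hH Hm mC b0 e0 ep0 Hb; have r0 : 0 <= r by exact: le_trans r1.
have p0 : 0 <= p by exact: le_trans p1.
have mH := history_measurable mX hH.
set x := fine (P H); have PH : P H = x%:E by rewrite fineK ?fin_num_measure.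
have x0 : 0 <= x by exact: fine_ge0.
near=> h => k; have h0 : 0 < h by [].
have hQ j : (\int[P]_(om in H) (moment r (X (j%:R * h) om))%:E <= (b * x)%:E)%E.
  by rewrite EFinM -PH; move: j; near: h.
have step : forall mu, SN mu ->
    fine (\int[sg h mu]_(nu in SN) (excess m (moment p nu))%:E)%E <=
    excess m (moment p mu) + h * (C2 * moment r mu + e).
  move=> mu Smu.
  apply: (@le_trans _ _ (excess m (moment p mu) + h * (Gex m mu + e))).
    by move: mu Smu; near: h; exact: generates_le.
  by rewrite lerD2l ler_wpM2l ?(ltW h0)// lerD2r driftx.
have jh0 j : 0 <= j%:R * h by rewrite mulr_ge0// ltW.
pose Bk j := H `&` [set om | forall i, (i <= j)%N -> moment p (X (i%:R * h) om) < m + eps].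
have hB j : history X (j%:R * h) (Bk j).
  have -> : Bk j = H `&` \bigcap_(i in `I_j.+1)
      ((@moment R d p : E -> R) \o X (i%:R * h)) @^-1` `]-oo, (m + eps)[.
    by congr (_ `&` _); apply/seteqP; split => om /= Hi i ij;
      have := Hi i ij; rewrite /= in_itv.
  apply: historyI; first exact: history_le hH.
  apply: history_bigcap => // i ij; apply: history_path => //.
    by rewrite jh0/= ler_wpM2r ?(ltW h0)// ler_nat -ltnS.
  by apply: lipschitz_measurable => //; exact: moment_w1_lipschitz.
have mB j : measurable (Bk j) by exact: history_measurable (hB j).
have mlx : measurable_fun SN (fun mu : E => excess m (moment p mu)).
  by apply: lipschitz_measurable => //; exact: excess_w1_lipschitz.
have mlr : measurable_fun SN (@moment R d r : E -> R).
  by apply: lipschitz_measurable => //; exact: moment_w1_lipschitz.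
have ex0 y : 0 <= excess m y by exact: sqr_ge0.
have B0 : Bk 0 `<=` H by move=> om [].
have BH j : Bk j `<=` H by move=> om [].
have mQ j (D : set Omega) : measurable_fun D (fun om => (moment r (X (j%:R * h) om))%:E).
  by apply: measurable_funTS; apply/measurable_EFinP; exact: measurable_moment.
have mEx j (D : set Omega) :
    measurable_fun D (fun om => (excess m (moment p (X (j%:R * h) om)))%:E).
  by apply: measurable_funTS; apply/measurable_EFinP; exact: path_measurable mlx.
have -> : H `&` [set om | exists2 j : nat, (j <= k)%N &
        m + eps <= moment p (X (j%:R * h) om)] = Bk 0 `\` Bk k.
  apply/seteqP; split => om /=; last first.
    move=> [[Hom _] nB]; split => //; apply: contrapT => nE; apply: nB.
    split => // i ik; rewrite ltNge; apply/negP => mi; apply: nE.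
    by exists i.
  move=> [Hom [j jk mj]]; split; last first.
    by move=> [_ /(_ j jk)]; rewrite ltNge mj.
  split => // i; rewrite leqn0 => /eqP ->; rewrite mul0r.
  by have := Hm om Hom; lra.
rewrite PH -[leRHS]EFinM -mulrA.
apply: (@discrete_maximal _ _ _ P Bk
  (fun j om => excess m (moment p (X (j%:R * h) om))) (eps ^+ 2)
  (h * (C2 * b + e) * x) mB) => //.
- move=> j om [Hom Hj]; split => // i ij; apply: Hj; exact: leqW.
- by move=> j; have /measurable_EFinP := mEx j setT.
- exact: sqr_ge0.
- move=> om /B0 Hom; rewrite mul0r /excess max_r ?expr0n// subr_le0; exact: Hm.
- move=> j om [Hom Hj] nB.
  have : m + eps <= moment p (X (j.+1%:R * h) om).
    rewrite leNgt; apply/negP => mi; apply: nB; split => // i.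
    by rewrite leq_eqVlt ltnS => /orP[/eqP ->//|]; exact: Hj.
  move=> mj; rewrite /excess max_l; last by lra.
  by rewrite lerXn2r ?nnegrE ?(ltW ep0)//; lra.
move=> j; rewrite -natr1 mulrDl mul1r.
apply: le_trans (markov_step mX cX sgp mkX (jh0 j) (ltW h0) (hB j) mlx _ _ step) _.
- apply: measurable_funD => //; apply: measurable_funM => //.
  by apply: measurable_funD => //; exact: measurable_funM.
- move=> mu Smu; rewrite ex0/=.
  have /andP[m0 mb] := moment_state N0 p0 Smu.
  have mx0 : 0 <= Num.max (moment p mu - m) 0 by rewrite le_max lexx orbT.
  suff : Num.max (moment p mu - m) 0 <= Num.sqrt N%:R `^ p + `|m|.
    by move=> h1; apply: (_ : _ <= (Num.sqrt N%:R `^ p + `|m|) ^+ 2);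
      rewrite lerXn2r ?nnegrE// (le_trans mx0).
  rewrite ge_max addr_ge0 ?powR_ge0// andbT.
  by have := ler_norm (- m); rewrite normrN => h1; lra.
have d0 om : (0 <= (h * (C2 * moment r (X (j%:R * h) om) + e))%:E)%E.
  by rewrite lee_fin mulr_ge0 ?(ltW h0)// addr_ge0 ?(ltW e0)// mulr_ge0 ?moment_ge0.
have md (D : set Omega) :
    measurable_fun D (fun om => (h * (C2 * moment r (X (j%:R * h) om) + e))%:E).
  apply: measurable_funTS; apply/measurable_EFinP; apply: measurable_funM => //.
  apply: measurable_funD => //; apply: measurable_funM => //.
  exact: measurable_moment.
under eq_integral do rewrite EFinD.
rewrite ge0_integralD//; last first.
  by move=> om _; rewrite lee_fin.
apply: leeD => //.
apply: (@le_trans _ _ (\int[P]_(om in H)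
    (h * (C2 * moment r (X (j%:R * h) om) + e))%:E)%E).
  by apply: ge0_subset_integral => //; exact: BH.
under eq_integral do rewrite mulrDr mulrA EFinD EFinM.
rewrite ge0_integralD//; last 3 first.
- by move=> om _; rewrite mule_ge0// lee_fin ?moment_ge0// mulr_ge0// ltW.
- exact: measurable_funeM.
- by move=> om _; rewrite lee_fin mulr_ge0// ltW.
rewrite ge0_integralZl_EFin//; last 2 first.
- by move=> om _; rewrite lee_fin moment_ge0.
- by rewrite mulr_ge0// ltW.
have -> : (\int[P]_(om in H) (h * e)%:E = (h * e * x)%:E)%E.
  by rewrite integral_cst// [RHS](EFinM _ x) -PH.
apply: (@le_trans _ _ ((h * C2)%:E * (b * x)%:E + (h * e * x)%:E)%E).
  by apply: leeD => //; apply: lee_wpmul2l; rewrite ?lee_fin ?mulr_ge0// ltW.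
rewrite -EFinM -EFinD lee_fin le_eqVlt; apply/orP; left; apply/eqP; ring.
Unshelve. all: by end_near.
Qed.

Let K a : R := C2 * (a + (C + 1) / c).

Let K_ge0 a : 0 <= a -> 0 <= K a.
Proof. by move=> a0; rewrite mulr_ge0// addr_ge0// divr_ge0 ?addr_ge0// ltW. Qed.

Let dyadic (T : R) (l : nat) (lev : Omega -> R) : set Omega :=
  [set om | exists2 j : nat, (j <= 2 ^ l)%N &
     lev om <= moment p (X (j%:R * (T / 2 ^+ l)) om)].

Let dyadic_le T lev : {homo (fun l => dyadic T l lev) : l n / (l <= n)%N >-> l `<=` n}.
Proof.
move=> l n /subnK <-; elim: (n - l)%N => // k IH om /IH[j jl jm].
exists (2 * j)%N; first by rewrite addSn expnS leq_mul2l.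
rewrite addSn exprS natrM; have -> : 2 * j%:R * (T / (2 * 2 ^+ (k + l))) =
  j%:R * (T / 2 ^+ (k + l)) by field; rewrite expf_neq0.
by [].
Qed.

Let measurable_dyadic T l lev : 0 <= T -> measurable_fun setT lev ->
  measurable (dyadic T l lev).
Proof.
move=> T0 mlev; have -> : dyadic T l lev = \bigcup_(j in `I_(2 ^ l).+1)
   (fun om => moment p (X (j%:R * (T / 2 ^+ l)) om) - lev om) @^-1` `[0, +oo[.
  apply/seteqP; split => om /= [j jl jm]; exists j => //; move: jm => /=;
    by rewrite in_itv/= andbT subr_ge0.
apply: fin_bigcup_measurable => // j _; rewrite -[X in measurable X]setTI.
suff : measurable_fun setT (fun om => moment p (X (j%:R * (T / 2 ^+ l)) om) - lev om).
  by apply.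
apply: measurable_funB => //; apply: measurable_moment => //.
by rewrite mulr_ge0// divr_ge0// exprn_ge0.
Qed.

(** Refining the grid both lets the error [e] of a time step tend to zero and
    exhausts the dyadic times. *)
Lemma maximal_dyadic H m a eps T : history X 0 H ->
  (forall om, H om -> moment p (X 0 om) <= m) -> C1 <= m ->
  0 <= a -> (\int[P]_(om in H) (moment r (X 0 om))%:E <= a%:E * P H)%E ->
  0 < eps -> 0 < T ->
  (P (H `&` \bigcup_l dyadic T l (fun=> (m + eps)%R))
   <= (T * K a / eps ^+ 2)%:E * P H)%E.
Proof.
move=> hH Hm mC a0 Ha ep0 T0; have mH := history_measurable mX hH.
have mDl l : measurable (H `&` dyadic T l (fun=> m + eps)).
  by apply: measurableI => //; apply: measurable_dyadic => //; exact: ltW.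
have ep2 : 0 < eps ^+ 2 by rewrite exprn_gt0.
set x := fine (P H); have PH : P H = x%:E by rewrite fineK ?fin_num_measure.
have x0 : 0 <= x by exact: fine_ge0.
have b0 : 0 <= a + (C + 1) / c by rewrite addr_ge0// divr_ge0 ?addr_ge0// ltW.
have bd l : (P (H `&` dyadic T l (fun=> (m + eps)%R))
    <= (T * K a / eps ^+ 2)%:E * P H)%E.
  set y := fine (P (H `&` dyadic T l (fun=> m + eps))).
  have Py : P (H `&` dyadic T l (fun=> m + eps)) = y%:E.
    by rewrite fineK ?fin_num_measure.
  rewrite Py PH -EFinM lee_fin mulrAC ler_pdivlMr//.
  apply/ler_addgt0Pr => e e0; set e1 := e / (T * (x + 1)).
  have Tx : 0 < T * (x + 1) by rewrite mulr_gt0// ltr_wpDl.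
  have e10 : 0 < e1 by rewrite divr_gt0.
  have := near_dyadic T0 (maximal_grid hH Hm mC b0 e10 ep0 (moment_grid a0 hH Ha)).
  move=> [l0 /(_ (maxn l l0) (leq_maxr _ _) (2 ^ maxn l l0)%N)].
  set A := H `&` _; have -> : A = H `&` dyadic T (maxn l l0) (fun=> m + eps) by [].
  have sub : (P (H `&` dyadic T l (fun=> (m + eps)%R)) <=
      P (H `&` dyadic T (maxn l l0) (fun=> (m + eps)%R)))%E.
    apply: le_measure; rewrite ?inE//.
    by apply: setIS; apply: dyadic_le; exact: leq_maxl.
  move=> H1; have {H1 sub} : ((eps ^+ 2)%:E * P (H `&` dyadic T l (fun=> (m + eps)%R)) <=
      (T * (K a + e1) * x)%:E)%E.
    apply: le_trans (_ : (eps ^+ 2)%:E * P (H `&` dyadic T (maxn l l0) (fun=> (m + eps)%R)) <= _)%E.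
      by apply: lee_wpmul2l => //; rewrite lee_fin ltW.
    apply: le_trans H1 _; rewrite PH -EFinM lee_fin le_eqVlt; apply/orP; left.
    apply/eqP; rewrite natrX /K; set bb := a + (C + 1) / c.
    have : (2 : R) ^+ maxn l l0 != 0 by rewrite expf_neq0.
    by move: (2 ^+ maxn l l0) => q q0; field.
  rewrite Py -EFinM lee_fin mulrC => /le_trans; apply.
  rewrite mulrDr mulrDl lerD2l.
  have -> : T * e1 * x = e * (x / (x + 1)).
    by rewrite /e1; field; rewrite !gt_eqF// ltr_wpDl.
  by rewrite -[leRHS]mulr1 ler_wpM2l ?(ltW e0)// ler_pdivrMr ?ltr_wpDl// mul1r lerDl.
rewrite setI_bigcupr.
have := @nondecreasing_cvg_mu _ _ _ P (fun l => H `&` dyadic T l (fun=> m + eps)) mDl.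
move=> /(_ (bigcupT_measurable _ mDl))/(_ _)/cvg_lim <- //; last first.
  by move=> l n ln; apply/subsetPset; apply: setIS; exact: dyadic_le.
apply: lime_le; last by near=> l; exact: bd.
apply: ereal_nondecreasing_is_cvgn => l n ln; apply: le_measure; rewrite ?inE//.
by apply: setIS; exact: dyadic_le.
Unshelve. all: by end_near.
Qed.

(** The random level of the maximal inequality, above which the drift is
    negative. *)
Let start om := Num.max (moment p (X 0 om)) C1.

Let measurable_start : measurable_fun setT start.
Proof. by apply: measurable_maxr => //; exact: measurable_moment. Qed.

Let measurable_dyadicU T lev : 0 <= T -> measurable_fun setT lev ->
  measurable (\bigcup_l dyadic T l lev).
Proof. by move=> T0 mlev; apply: bigcupT_measurable => l; exact: measurable_dyadic. Qed.

(** Slicing the initial data into events where the initial moment varies by at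
    most [delta] replaces the deterministic level by a random one. *)
Lemma maximal_start a eps delta T : 0 <= a ->
  {ae P, forall om, moment r (X 0 om) <= a} ->
  0 < delta -> delta < eps -> 0 < T ->
  (P (\bigcup_l dyadic T l (fun om => start om + eps)%R) <=
    (T * K a / (eps - delta) ^+ 2)%:E)%E.
Proof.
move=> a0 Qa d0 de T0; have T1 := ltW T0.
set D := \bigcup_l _; set k := T * K a / _.
have k0 : 0 <= k by rewrite divr_ge0 ?sqr_ge0// mulr_ge0// K_ge0.
have mD : measurable D.
  by apply: measurable_dyadicU => //; exact: measurable_funD.
have mstart : measurable_fun SN (fun mu : E => Num.max (moment p mu) C1).
  apply: measurable_maxr => //.
  by apply: lipschitz_measurable => //; exact: moment_w1_lipschitz.
have hlev (V : set R) : measurable V -> history X 0 (start @^-1` V).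
  by move=> mV; apply: (history_path cX (r := 0) _ mstart mV); rewrite lexx.
have mlev (V : set R) : measurable V -> measurable (start @^-1` V).
  by move=> mV; exact: history_measurable (hlev V mV).
pose Sl n : set R := `[C1 + n%:R * delta, C1 + n.+1%:R * delta[%classic.
pose Lo n : set R := `]-oo, (C1 + n%:R * delta)[%classic.
have mSl n : measurable (start @^-1` Sl n) by apply: mlev; exact: measurable_itv.
have mLo n : measurable (start @^-1` Lo n) by apply: mlev; exact: measurable_itv.
have slice n : (P (D `&` start @^-1` Sl n) <=
    k%:E * P (start @^-1` Sl n))%E.
  set V : set R := Sl n; have mV : measurable V by exact: measurable_itv.
  have Qi : (\int[P]_(om in start @^-1` V) (moment r (X 0 om))%:E <=
      a%:E * P (start @^-1` V))%E.
    rewrite -integral_cst//; last exact: mlev.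
    apply: ae_ge0_le_integral => //.
    - exact: mlev.
    - by move=> om _; rewrite lee_fin moment_ge0// (le_trans _ r1).
    - by apply: measurable_funTS; apply/measurable_EFinP; exact: measurable_moment.
    by move: Qa; apply: filterS => om h _; rewrite lee_fin.
  have ep0 : 0 < eps - delta by rewrite subr_gt0.
  have Hm om : (start @^-1` V) om -> moment p (X 0 om) <= C1 + n.+1%:R * delta.
    rewrite /V /Sl /= in_itv/= => /andP[_ /ltW]; apply: le_trans.
    by rewrite le_max lexx.
  have mC : C1 <= C1 + n.+1%:R * delta by rewrite lerDl mulr_ge0// ltW.
  apply: le_trans (maximal_dyadic (hlev V mV) Hm mC a0 Qi ep0 T0).
  apply: le_measure; rewrite ?inE; [exact: measurableI (mlev _ _)| |].
    apply: measurableI; [exact: mlev|exact: measurable_dyadicU].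
  move=> om [[l _ [j jl jm]] Vom]; split => //; exists l => //; exists j => //.
  apply: le_trans jm; move: Vom; rewrite /V /Sl /= in_itv/= => /andP[+ _].
  by rewrite -natr1 mulrDl mul1r; lra.
have below n : (P (D `&` start @^-1` Lo n) <=
    k%:E * P (start @^-1` Lo n))%E.
  elim: n => [|n IH].
    have -> : start @^-1` Lo 0%N = set0.
      apply/seteqP; split => om //=; rewrite /Lo/= in_itv/= mul0r addr0.
      by rewrite gt_max ltxx andbF.
    by rewrite setI0 measure0 mule0.
  have E1 : start @^-1` Lo n.+1 =
      start @^-1` Lo n `|`
      start @^-1` Sl n.
    have lt_step : C1 + n%:R * delta < C1 + n.+1%:R * delta.
      by rewrite ltrD2l ltr_pM2r// ltr_nat.
    apply/seteqP; split => om /=; rewrite /Lo /Sl/= !in_itv/=.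
      by move=> h; have [?|?] := ltP (start om) (C1 + n%:R * delta); [left|right].
    by move=> [h|/andP[]//]; exact: lt_trans h lt_step.
  have dis : start @^-1` Lo n `&`
      start @^-1` Sl n = set0.
    apply/seteqP; split => om //=; rewrite /Lo /Sl/= !in_itv/= => -[h /andP[h2 _]].
    by move: h; rewrite ltNge h2.
  rewrite E1 setIUr measureU; last 3 first.
  - exact: measurableI.
  - exact: measurableI.
  - by rewrite setIACA dis setI0.
  rewrite measureU//.
  by rewrite ge0_muleDr//; apply: leeD; [exact: IH|exact: slice].
have p0 : 0 <= p by exact: le_trans p1.
(* All the initial moments are below this bound, so finitely many slices suffice. *)
pose top := Num.max (Num.sqrt N%:R `^ p) C1 - C1.
have [n nt] : exists n : nat, top < n%:R * delta.
  exists (Num.bound (top / delta)); rewrite -ltr_pdivrMr//; apply: archi_boundP.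
  by rewrite divr_ge0 ?(ltW d0)// subr_ge0 le_max lexx orbT.
have := below n; have -> : start @^-1` Lo n = setT.
  apply/seteqP; split => om //= _; rewrite /Lo/= in_itv/=.
  have : start om <= Num.max (Num.sqrt N%:R `^ p) C1.
    rewrite ge_max !le_max lexx orbT andbT.
    by have /andP[_ ->] := moment_state N0 p0 (X_state om (lexx 0)).
  by move: nt; rewrite /top; lra.
by rewrite setIT probability_setT mule1.
Qed.

(** Right-continuity of the paths reduces the supremum to dyadic times, up to an
    arbitrarily small loss in the level. *)
Let sup_moment_dyadic T (lev : Omega -> R) : 0 < T ->
  [set om | ((lev om)%:E <= sup_moment p T X om)%E] =
  \bigcap_n \bigcup_l dyadic T l (fun om => lev om - n.+1%:R^-1).
Proof.
move=> T0; apply/seteqP; split => om.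
  move=> /= Som n _.
  have : ((lev om - n.+1%:R^-1)%:E < sup_moment p T X om)%E.
    by apply: lt_le_trans Som; rewrite lte_fin gtrBl invr_gt0.
  move=> /ereal_sup_gt[_ [t + <-]].
  rewrite /= in_itv/= lte_fin => /andP[t0 tT] above.
  move: tT; rewrite le_eqVlt => /orP[/eqP tT|tT].
    exists 0%N => //; exists 1%N => //.
    by rewrite expr0 divr1 mul1r -tT ltW.
  have := path_above cX (moment_w1_lipschitz d N0 p1) t0 above.
  move=> /(dyadic_dense t0 tT)[l [j jl jm]]; exists l => //; exists j => //.
  exact: ltW.
move=> /= Dom; rewrite leNgt; apply/negP => lt.
have ub s : 0 <= s <= T -> ((moment p (X s om))%:E <= sup_moment p T X om)%E.
  by move=> sT; apply: ereal_sup_ubound; exists s => //=; rewrite in_itv.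
have := ub 0; rewrite lexx (ltW T0) => /(_ isT) ub0.
have yE : sup_moment p T X om = (fine (sup_moment p T X om))%:E.
  by rewrite fineK// fin_numE; apply/andP; split;
    [rewrite gt_eqF// (lt_le_trans (ltNyr _) ub0)|rewrite lt_eqF// (lt_trans lt (ltry _))].
move: lt; rewrite yE lte_fin => /ltr_add_invr[n nlt].
have [l _ [j jl jm]] := Dom n I.
have := ub (j%:R * (T / 2 ^+ l)); rewrite yE lee_fin.
have -> /= : 0 <= j%:R * (T / 2 ^+ l) <= T.
  rewrite mulr_ge0 ?divr_ge0 ?(ltW T0) ?exprn_ge0//= mulrCA ger_pMr//.
  by rewrite ler_pdivrMr ?exprn_gt0// mul1r -natrX ler_nat.
move=> /(_ isT); move: jm nlt; move: (n.+1%:R^-1) (lev om).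
move: (fine _) (moment _ _) => y z u v.
move=> h1 h2 h3; lra.
Qed.

Lemma measurable_sup_moment T (lev : Omega -> R) : 0 < T -> measurable_fun setT lev ->
  measurable [set om | ((lev om)%:E <= sup_moment p T X om)%E].
Proof.
move=> T0 mlev; rewrite sup_moment_dyadic//; apply: bigcapT_measurable => n.
by apply: measurable_dyadicU; [exact: ltW|exact: measurable_funB].
Qed.

(** The supremum is controlled by dyadic times at a level lowered by [1 / (n + 1)],
    and the slices cost another part of [eps]; both losses are at most [delta]
    together, and [delta] tends to zero. *)
Lemma maximal_moment a eps T : 0 <= a ->
  {ae P, forall om, moment r (X 0 om) <= a} -> 0 < eps -> 0 <= T ->
  (P [set om | ((Num.max (moment p (X 0 om)) C1 + eps)%:E <= sup_moment p T X om)%E]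
   <= (T * (C2 * (a + (C + 1) / c)) / eps ^+ 2)%:E)%E.
Proof.
move=> a0 Qa ep0; rewrite le_eqVlt => /orP[/eqP <-|T0].
  rewrite [X in P X](_ : _ = set0) ?measure0 ?lee_fin ?mul0r//.
  apply/seteqP; split => om //=; rewrite leNgt => /negP; apply.
  apply: (@le_lt_trans _ _ (start om)%:E); last by rewrite lte_fin ltrDl.
  apply: ge_ereal_sup => _ [t] + <-; rewrite /= in_itv/= => /le_anti <-.
  by rewrite lee_fin le_max lexx.
rewrite -/(K a) -[X in P X]/[set om | ((start om + eps)%:E <= sup_moment p T X om)%E].
set S := [set om | _].
have mlev : measurable_fun setT (fun om => start om + eps) by exact: measurable_funD.
have mS : measurable S by exact: measurable_sup_moment.
have Py : P S = (fine (P S))%:E by rewrite fineK ?fin_num_measure.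
rewrite Py lee_fin; apply: le_sqr_limit => //.
  by rewrite mulr_ge0 ?(ltW T0)// K_ge0.
move=> delta d0 de; rewrite -lee_fin -Py.
have [n nd] : exists n : nat, n.+1%:R^-1 < delta.
  by have [n] := ltr_add_invr d0; exists n; rewrite -[ltLHS]add0r.
have e1 : 0 < delta - n.+1%:R^-1 by rewrite subr_gt0.
have e2 : delta - n.+1%:R^-1 < eps - n.+1%:R^-1 by rewrite ltrD2r.
have := maximal_start a0 Qa e1 e2 T0.
have -> : eps - n.+1%:R^-1 - (delta - n.+1%:R^-1) = eps - delta by ring.
apply: le_trans; apply: le_measure; rewrite ?inE//.
  by apply: measurable_dyadicU; [exact: ltW|exact: measurable_funD].
rewrite /S sup_moment_dyadic// => om /(_ n I)[l _ [j jl jm]].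
by exists l => //; exists j => //; rewrite addrA.
Qed.

End KacMaximal.

(** * Kac processes *)

Section MomentComparison.
Variables (R : realType) (d N : nat).
Hypothesis N0 : (0 < N)%N.
Implicit Types mu : setfun R d.

Lemma moment_le_Lambda (r q : R) mu : 0 <= r -> r <= q -> stateset N mu ->
  moment r mu <= Lambda q mu.
Proof.
move=> r0 rq /stateset_empirical[x -> _].
rewrite moment_empirical// /Lambda bracket_empirical// ler_wpM2l ?invr_ge0//.
apply: ler_sum => i _; set y := enorm _; have y0 : 0 <= y := enorm_ge0 _.
have y1 : 1 <= 1 + y ^+ 2 by rewrite lerDl sqr_ge0.
apply: (@le_trans _ _ ((1 + y ^+ 2) `^ (r / 2))); last first.
  by apply: ler_powR => //; lra.
rewrite -[y `^ r](sqr_powR _ y0).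
by apply: le_powR2; rewrite ?sqr_ge0 ?lerDr//; lra.
Qed.

Lemma Lambda_le_moment (p : R) mu : 0 <= p -> stateset N mu ->
  Lambda p mu <= 2 `^ (p / 2) * (1 + moment p mu).
Proof.
move=> p0 /stateset_empirical[x -> _].
rewrite moment_empirical// /Lambda bracket_empirical//.
rewrite [X in X + _](_ : 1 = N%:R^-1 * \sum_(i < N) 1); last first.
  by rewrite sumr_const card_ord mulVf// pnatr_eq0 -lt0n.
rewrite -mulrDr -big_split/= mulrCA ler_wpM2l ?invr_ge0// mulr_sumr.
apply: ler_sum => i _; set y := enorm _; have y0 : 0 <= y := enorm_ge0 _.
have yp := powR_ge0 y p; have p2 : 0 <= p / 2 by lra.
have [y1|y1] := leP y 1.
  apply: (@le_trans _ _ (2 `^ (p / 2))); last by rewrite ler_peMr ?powR_ge0// lerDl.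
  apply: le_powR2 => //; first by rewrite addr_ge0 ?sqr_ge0.
  have : y ^+ 2 <= 1 by rewrite expr_le1.
  lra.
apply: (@le_trans _ _ (2 `^ (p / 2) * y `^ p)); last first.
  by rewrite ler_wpM2l ?powR_ge0// lerDr.
rewrite -[y `^ p](sqr_powR _ y0) -powRM ?sqr_ge0//; apply: le_powR2 => //.
  by rewrite addr_ge0 ?sqr_ge0.
by have := exprn_ege1 2 (ltW y1); lra.
Qed.

Lemma Lambda_ge1 (p : R) mu : 0 <= p -> stateset N mu -> 1 <= Lambda p mu.
Proof.
move=> p0 Smu; apply: (@bracket_state_ge _ _ _ N0 (fun y => (1 + y ^+ 2) `^ (p / 2))) => //.
move=> y _; rewrite -[leLHS](powRr0 (1 + y ^+ 2)).
by apply: ler_powR; rewrite ?lerDl ?sqr_ge0//; lra.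
Qed.

End MomentComparison.

(** On the unit sphere a negative cutoff angle removes nothing, so the noncutoff
    kernel has the bounds of the cutoff ones. *)
Lemma kernel_B_bounds (R : realType) (d : nat) (gamma kappa1 kappa2 : R) (b : R -> R) :
  collision_kernel gamma kappa1 kappa2 (@kernel_cut R d gamma b (-1)) ->
  collision_kernel gamma kappa1 kappa2 (@kernel_B R d gamma b).
Proof.
have E z : {in sphere (d := d), forall s, kernel_cut gamma b (-1) z s = kernel_B gamma b z s}.
  by move=> s; rewrite inE => s1; rewrite -kernel_B_cut.
move=> [h1 h2 h3 h4 h5]; split.
- by move=> z s s1; rewrite kernel_B_cut//; exact: h1.
- by move=> z z0; exact: eq_measurable_fun (E z) (h2 z z0).
- by move=> z s z0 s1 c0; rewrite kernel_B_cut//; exact: h3.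
- move=> z z0; have := h4 z z0; congr (_ <= _)%E.
  by apply: eq_integral => s sS; rewrite (E z s sS).
- move=> z z0; have := h5 z z0; congr (_ <= _)%E.
  by apply: eq_integral => s sS; rewrite (E z s sS).
Qed.

Section KacProcess.
Variables (R : realType) (d : nat) (gamma nu : R) (b : R -> R).
Hypotheses (hd : (3 <= d)%N) (hgamma : 0 <= gamma <= 1) (hnu : 0 <= nu < 1).
Hypotheses (hb : angular_profile nu b).

Lemma kac_process_kernel : exists kappa1 kappa2 : R, [/\ 0 < kappa1, 0 < kappa2 &
  forall N dO (Omega : measurableType dO) (P : probability Omega R)
    (X : R -> Omega -> state R d N), kac_process P gamma b X ->
  exists2 B, collision_kernel gamma kappa1 kappa2 B & kac_process_of P B X].
Proof.
have [kappa1 [kappa2 [k1 k2 H]]] := kernel_bounds gamma hd hnu hb.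
exists kappa1, kappa2; split => // N dO Omega P X [kX|[K K1 [theta0 ht kX]]].
  exists (kernel_B gamma b) => //; apply: kernel_B_bounds.
  by apply: H; left; rewrite oppr_lt0.
by exists (kernel_cut gamma b theta0) => //; apply: H; right; exists K.
Qed.

(** The constants come from the two drift estimates, which only depend on the
    kernel through its grazing moments, uniformly in the cutoff. *)
Lemma kac_maximal (p : R) : 2 <= p -> exists C1 C2 : R, [/\ 0 <= C1, 0 <= C2 &
  forall (q : R) (N : nat) (a3 : R),
      2 * p + gamma <= q -> (0 < N)%N -> 1 <= a3 ->
    forall (dO : measure_display) (Omega : measurableType dO)
      (P : probability Omega R) (X : R -> Omega -> state R d N),
      kac_process P gamma b X ->
      {ae P, forall om, Lambda q (X 0 om) <= a3} ->
    forall tfin eps : R, 0 <= tfin -> 0 < eps ->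
      (P [set om | ((Num.max (moment p (X 0 om)) C1 + eps)%:E
                     <= sup_moment p tfin X om)%E]
       <= (C2 * tfin * a3 * N%:R^-1 * eps ^- 2)%:E)%E].
Proof.
move=> p2; have /andP[g0 g1] := hgamma.
have [kappa1 [kappa2 [k1 k2 Hk]]] := kac_process_kernel.
have r2 : 2 <= 2 * p + gamma by lra.
have [c [C [c0 C0 driftr]]] := generator_moment_le d hgamma k1 k2 r2.
have [C1 [C2 [C10 C20 driftx]]] := generator_excess_le d hgamma k1 k2 p2.
have cC : 0 <= (C + 1) / c by rewrite divr_ge0 ?addr_ge0// ltW.
exists C1, (C2 * (1 + (C + 1) / c)); split => //.
  by rewrite mulr_ge0 ?(ltW C20)// addr_ge0.
move=> q N a3 qr N0 a31 dO Omega P X /Hk[B HB [mX cX [sg [sgp mkX gen]]]] Qa tfin eps t0 ep0.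
have p1 : 1 <= p by lra.
have r1 : 1 <= 2 * p + gamma by lra.
have C2N : 0 <= C2 / N%:R by rewrite divr_ge0// ltW.
have a30 : 0 <= a3 by lra.
have Qr : {ae P, forall om, moment (2 * p + gamma) (X 0 om) <= a3}.
  move: Qa; apply: filterS => om; apply: le_trans.
  have r0 : 0 <= 2 * p + gamma by lra.
  exact (moment_le_Lambda N0 r0 qr (path_state cX om (lexx 0))).
apply: le_trans (maximal_moment N0 mX cX sgp mkX p1 r1 c0 C0 C2N
  (gen _ (moment_w1_lipschitz d N0 r1)) _
  (fun m => gen _ (excess_w1_lipschitz d N0 m p1)) _ a30 Qr ep0 t0) _.
- by move=> mu Smu; exact: driftr.
- by move=> m mu Smu mC; exact: driftx.
rewrite lee_fin.
have -> : C2 * (1 + (C + 1) / c) * tfin * a3 / N%:R * eps ^- 2 =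
  tfin * (C2 / N%:R * (a3 * (1 + (C + 1) / c))) / eps ^+ 2.
  have : N%:R != 0 :> R by rewrite pnatr_eq0 -lt0n.
  have : eps != 0 by rewrite gt_eqF.
  by move: ((C + 1) / c) N%:R => w n e0 n0; field; rewrite n0 e0.
rewrite ler_wpM2r ?invr_ge0 ?sqr_ge0// ler_wpM2l// ler_wpM2l// mulrDr mulr1 lerD2l.
by rewrite ler_peMl.
Qed.

(** The infimum is at most [T] when the level is exceeded before [T + 1 / (n + 1)]
    for every [n]; by right-continuity this happens at a dyadic fraction of that
    time. *)
Lemma measurable_exceed_time (N : nat) dO (Omega : measurableType dO)
    (X : R -> Omega -> state R d N) (p c T : R) : (0 < N)%N -> 2 <= p -> 0 <= T ->
  (forall t, 0 <= t -> measurable_fun setT (X t)) ->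
  (forall om, cadlag (X ^~ om)) ->
  measurable [set om | (exceed_time p c X om <= T%:E)%E].
Proof.
move=> N0 p2 T0 mX cX; set lev := c / 2 `^ (p / 2 + 1).
have lip : w1_lipschitz N (@Lambda R d p) := Lambda_w1_lipschitz d N0 p2.
pose Tn n : R := T + n.+1%:R^-1.
have Tn0 n : T < Tn n by rewrite ltrDl invr_gt0.
have Tn00 n : 0 < Tn n by exact: le_lt_trans (Tn0 n).
pose s n l j : R := j%:R * (Tn n / 2 ^+ l).
have s0 n l j : 0 <= s n l j.
  by rewrite mulr_ge0// divr_ge0 ?exprn_ge0// ltW.
have -> : [set om | (exceed_time p c X om <= T%:E)%E] =
    \bigcap_n \bigcup_l \bigcup_(j in `I_(2 ^ l).+1)
      (fun om => Lambda p (X (s n l j) om)) @^-1` `]lev, +oo[.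
  apply/seteqP; split => om.
    move=> /= Tom n _.
    have : (exceed_time p c X om < (Tn n)%:E)%E.
      by apply: le_lt_trans Tom _; rewrite lte_fin.
    move=> /ereal_inf_lt[_ [t [t0 above] <-]]; rewrite lte_fin => tT.
    have [l [j jl jm]] := dyadic_dense t0 tT (path_above cX lip t0 above).
    by exists l => //; exists j => //=; rewrite in_itv/= andbT.
  move=> Dom; apply/lee_addgt0Pr => e e0.
  have [n ne] : exists n : nat, n.+1%:R^-1 < e.
    by have [n] := ltr_add_invr e0; exists n; rewrite -[ltLHS]add0r.
  have [l _ [j /= jl]] := Dom n I; rewrite in_itv/= andbT => above.
  apply: (@le_trans _ _ (s n l j)%:E).
    by apply: ereal_inf_lbound; exists (s n l j).
  rewrite -EFinD lee_fin; apply: (@le_trans _ _ (Tn n)); last by rewrite lerD2l ltW.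
  rewrite /s mulrCA ger_pMr// ler_pdivrMr ?exprn_gt0// mul1r -natrX ler_nat.
  by rewrite -ltnS.
apply: bigcapT_measurable => n; apply: bigcupT_measurable => l.
apply: fin_bigcup_measurable => // j _; rewrite -[X in measurable X]setTI.
have : measurable_fun setT (fun om => Lambda p (X (s n l j) om)).
  apply: (path_measurable mX cX (s0 n l j) (F := @Lambda R d p : state R d N -> R)).
  exact: lipschitz_measurable.
by apply => //; exact: measurable_itv.
Qed.

(** [Lambda p] is at most [2^(p/2)] times [1 + moment p], so once it exceeds the
    level, the moment exceeds its initial value and [C1] by at least [1]; the
    maximal inequality applies with [eps = 1], on intervals that shrink to
    [0, tfin]. *)
Lemma kac_exceed (p : R) : 2 <= p -> exists2 C : R, 1 <= C &
    forall (q : R) (N : nat) (a1 a3 : R),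
      2 * p + gamma <= q -> (0 < N)%N -> 1 <= a3 ->
    forall (dO : measure_display) (Omega : measurableType dO)
      (P : probability Omega R) (X : R -> Omega -> state R d N),
      kac_process P gamma b X ->
      {ae P, forall om, Lambda p (X 0 om) <= a1} ->
      {ae P, forall om, Lambda q (X 0 om) <= a3} ->
    forall tfin : R, 0 <= tfin ->
      (P [set om | (exceed_time p (C * a1) X om <= tfin%:E)%E]
       <= (C * tfin * a3 * N%:R^-1)%:E)%E.
Proof.
move=> p2; have [C1 [C2 [C10 C20 H]]] := kac_maximal p2.
have p0 : 0 <= p by lra. have p1 : 1 <= p by lra.
pose w : R := 2 `^ (p / 2); have w0 : 0 < w by rewrite powR_gt0.
have w1 : 1 <= w by rewrite -[leLHS](powRr0 2); apply: ler_powR; [lra|lra].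
pose C := 2 * w ^+ 2 * (C1 + 3) + C2.
have ww1 : 1 <= w ^+ 2 by rewrite expr_ge1// ltW.
exists C.
  have : 1 * (C1 + 3) <= w ^+ 2 * (C1 + 3) by rewrite ler_wpM2r//; lra.
  by rewrite /C; lra.
move=> q N a1 a3 qr N0 a31 dO Omega P X kX Pa1 Pa3 tfin t0.
have [B [mX cX _]] : exists B, kac_process_of P B X.
  by case: kX => [|[K _ [theta0 _]]] h; eexists; exact: h.
have SX om : stateset N (X 0 om) by exact: (path_state cX om (lexx 0)).
have [A [mA PA0 Asub]] := Pa1.
(* [Lambda p] is at least [1], so an almost sure upper bound is too. *)
have a11 : 1 <= a1.
  rewrite leNgt; apply/negP => a1lt.
  have : P setT = 0%E.
    apply: (subset_measure0 _ mA) => // om _; apply: Asub => /=.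
    apply/negP; rewrite -ltNge; apply: lt_le_trans a1lt _.
    exact (Lambda_ge1 N0 p0 (SX om)).
  by rewrite probability_setT => /eqP; rewrite eqe oner_eq0.
set S := [set om | _].
have mS : measurable S by exact: measurable_exceed_time.
have a30 : 0 <= a3 by lra.
pose Tn n : R := tfin + n.+1%:R^-1.
have Tn0 n : tfin < Tn n by rewrite ltrDl invr_gt0.
pose En n := [set om | ((Num.max (moment p (X 0 om)) C1 + 1)%:E
                     <= sup_moment p (Tn n) X om)%E].
have mE n : measurable (En n).
  apply: (measurable_sup_moment N0 mX cX p1); first exact: le_lt_trans (Tn0 n).
  apply: measurable_funD => //; apply: measurable_maxr => //.
  apply: (path_measurable mX cX (lexx 0) (F := @moment R d p : state R d N -> R)).
  by apply: lipschitz_measurable => //; exact: moment_w1_lipschitz.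
have SE n : S `<=` A `|` En n.
  move=> om Som; have [Aom|nA] := pselect (A om); [by left|right].
  have init : Lambda p (X 0 om) <= a1.
    by apply: contrapT => h; apply: nA; exact: Asub.
  have : (exceed_time p (C * a1) X om < (Tn n)%:E)%E.
    by apply: le_lt_trans Som _; rewrite lte_fin.
  move=> /ereal_inf_lt[_ [t [tge0 above] <-]]; rewrite lte_fin => tT.
  rewrite /En /=; apply: (@le_trans _ _ (moment p (X t om))%:E); last first.
    by apply: ereal_sup_ubound; exists t => //=; rewrite in_itv/= tge0 ltW.
  have St := path_state cX om tge0.
  have L0 := moment_le_Lambda N0 p0 (lexx p) (SX om).
  have Lt := Lambda_le_moment N0 p0 St.
  have lev : C * a1 / 2 `^ (p / 2 + 1) < w * (1 + moment p (X t om)).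
    exact: lt_le_trans above Lt.
  have E2 : (2 : R) `^ (p / 2 + 1) = w * 2.
    by rewrite powRD ?pnatr_eq0 ?implybT// powRr1.
  move: lev; rewrite E2 ltr_pdivrMr ?mulr_gt0// => lev.
  have low : 2 * w ^+ 2 * ((C1 + 3) * a1) <= C * a1.
    rewrite mulrA ler_wpM2r ?lerDl//; lra.
  have : 2 * w ^+ 2 * ((C1 + 3) * a1) < 2 * w ^+ 2 * (1 + moment p (X t om)).
    apply: le_lt_trans low _; apply: lt_le_trans lev _.
    by rewrite le_eqVlt; apply/orP; left; apply/eqP; ring.
  rewrite ltr_pM2l ?mulr_gt0 ?exprn_gt0// => key.
  have C1a : C1 <= C1 * a1 by rewrite ler_peMr.
  have m0 : moment p (X 0 om) <= a1 by exact: le_trans L0 init.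
  rewrite lee_fin; apply: (@le_trans _ _ (a1 + C1 + 1)).
    rewrite lerD2r ge_max; apply/andP; split; last by lra.
    by rewrite -[leLHS]addr0 lerD.
  by move: key C1a; move: (moment p _) => u; lra.
have PS n : (P S <= (C2 * Tn n * a3 * N%:R^-1)%:E)%E.
  apply: (@le_trans _ _ (P (A `|` En n))).
    by apply: le_measure; rewrite ?inE//; exact: measurableU.
  apply: le_trans (measureU2 _ _ _) _ => //.
  rewrite [X in (X + _)%E]PA0 add0e.
  have := H q N a3 qr N0 a31 dO Omega P X kX Pa3 (Tn n) 1.
  rewrite expr1n invr1 mulr1; apply => //.
  by rewrite ltW// (le_lt_trans t0).
have Py : P S = (fine (P S))%:E by rewrite fineK ?fin_num_measure.
rewrite Py lee_fin; apply: (@le_trans _ _ (C2 * tfin * a3 * N%:R^-1)); last first.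
  rewrite -!mulrA ler_wpM2r//; last by rewrite /C lerDr !mulr_ge0 ?addr_ge0// ltW.
  by rewrite !mulr_ge0// ?invr_ge0.
apply/ler_addgt0Pr => e e0.
pose D := C2 * a3 * N%:R^-1 + 1.
have D0 : 0 < D by rewrite ltr_wpDl// !mulr_ge0// invr_ge0.
have [n ne] : exists n : nat, n.+1%:R^-1 < e / D.
  have eD : 0 < e / D by rewrite divr_gt0.
  by have [n] := ltr_add_invr eD; exists n; rewrite -[ltLHS]add0r.
have := PS n; rewrite Py lee_fin => /le_trans; apply.
rewrite /Tn mulrDr 2!mulrDl lerD2l.
apply: (@le_trans _ _ (n.+1%:R^-1 * D)); last by rewrite -ler_pdivlMr// ltW.
have : 0 < n.+1%:R^-1 :> R by rewrite invr_gt0.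
by rewrite /D; move: (n.+1%:R^-1) (N%:R^-1) => u v u0; lra.
Qed.

End KacProcess.

Theorem lemma4p3 (R : realType) (d : nat) (gamma nu : R) (b : R -> R)
    (hd : (3 <= d)%N) (hgamma : 0 <= gamma <= 1) (hnu : 0 <= nu < 1)
    (hb : angular_profile nu b) (p : R) (hp : 2 <= p) :
  (exists C1 C2 : R,
    forall (q : R) (N : nat) (a3 : R),
      2 * p + gamma <= q -> (2 <= N)%N -> 1 <= a3 ->
    forall (dO : measure_display) (Omega : measurableType dO)
      (P : probability Omega R) (X : R -> Omega -> state R d N),
      kac_process P gamma b X ->
      {ae P, forall om, Lambda q (X 0 om) <= a3} ->
    forall tfin eps : R, 0 <= tfin -> 0 < eps ->
      (P [set om | ((Num.max (moment p (X 0 om)) C1 + eps)%:E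
                     <= sup_moment p tfin X om)%E]
       <= (C2 * tfin * a3 * N%:R^-1 * eps ^- 2)%:E)%E)
  /\
  (exists2 C : R, 1 <= C &
    forall (q : R) (N : nat) (a1 a3 : R),
      2 * p + gamma <= q -> (2 <= N)%N -> 1 <= a3 ->
    forall (dO : measure_display) (Omega : measurableType dO)
      (P : probability Omega R) (X : R -> Omega -> state R d N),
      kac_process P gamma b X ->
      {ae P, forall om, Lambda p (X 0 om) <= a1} ->
      {ae P, forall om, Lambda q (X 0 om) <= a3} ->
    forall tfin : R, 0 <= tfin ->
      (P [set om | (exceed_time p (C * a1) X om <= tfin%:E)%E]
       <= (C * tfin * a3 * N%:R^-1)%:E)%E).
Proof.
split.
  have [C1 [C2 [_ _ H]]] := kac_maximal hd hgamma hnu hb hp.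
  exists C1, C2 => q N a3 qr N2; exact: H qr (ltnW N2).
have [C C1 H] := kac_exceed hd hgamma hnu hb hp.
exists C => // q N a1 a3 qr N2; exact: H qr (ltnW N2).
Qed.
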